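(* Let $p$ be an odd prime. Let $\nu$ be a measure, for the $\sigma$-algebra $\Omega$, on the set of isomorphism classes of Schur $\sigma$-groups (for $p$) such that $$\int_G|\mathrm{Sur}_\sigma(G,H)|\,d\nu=1$$ for every finite $p$-group $H$ with a generator-inverting automorphism $\sigma$. Then $\nu=\mu_{BBH}$ (as measures on $\Omega$).
   Context: Fix an odd prime $p$. For a profinite group $G$, a generator-inverting automorphism (GI-automorphism) of $G$ is an automorphism $\sigma$ of $G$ that acts as inversion on some set of (topological) generators of $G$. Any two GI-automorphisms of a finitely generated pro-$p$ group $G$ are conjugate in $\mathrm{Aut}(G)$. For finitely generated pro-$p$ groups $G,H$ each admitting a GI-automorphism, fix one on each (both denoted $\sigma$); $\mathrm{Sur}_\sigma(G,H)$ is the set of continuous surjective homomorphisms $f:G\to H$ with $f\circ\sigma=\sigma\circ f$. Its cardinality does not depend on the choices. For a pro-$p$ group $G$, $d(G)=\dim H^1(G,\mathbb{Z}/p\mathbb{Z})$ and $r(G)=\dim H^2(G,\mathbb{Z}/p\mathbb{Z})$. A Schur $\sigma$-group is a finitely generated pro-$p$ group $G$ with finite abelianization, with $d(G)=r(G)$ (called its rank), and admitting a GI-automorphism. The lower $p$-central series is $P_0(G)=G$, and $P_{n+1}(G)$ is the closed subgroup generated by $[G,P_n(G)]$ and $P_n(G)^p$. Thus $P_1(G)=\Phi(G)$ is the Frattini subgroup. Put $Q_c(G)=G/P_c(G)$. Let $\Omega$ be the $\sigma$-algebra on the set of isomorphism classes of Schur $\sigma$-groups generated by the sets $\{G : Q_c(G)\cong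 P\}$, for all finite $p$-groups $P$ and all integers $c\ge 0$. Let $F_g$ be the free pro-$p$ group on $x_1,\dots,x_g$ with GI-automorphism $\sigma(x_i)=x_i^{-1}$. Let $X=\{s\in\Phi(F_g):\sigma(s)=s^{-1}\}$, and let $\mu$ be the natural profinite probability measure on $X$, i.e. the limit of the uniform measures on the finite sets $X_c=\{s\in\Phi(Q_c(F_g)):\sigma(s)=s^{-1}\}$ (the pushforward of $\mu$ to each $X_c$ is uniform). The product measure on $X^g$ is also denoted $\mu$. Let $$\mu_{CL}(g)=p^{-g^2}\prod_{k=1}^g(1-p^{-k})^{-2}\prod_{i=1}^\infty(1-p^{-i}).$$ The probability measure $\mu_{BBH}$ on isomorphism classes of Schur $\sigma$-groups is defined, for $A$ a set of isomorphism classes of rank $g$ Schur $\sigma$-groups, by $$\mu_{BBH}(A)=\mu_{CL}(g)\,\mu\big(\{(r_1,\dots,r_g)\in X^g : F_g/\langle\langle r_1,\dots,r_g\rangle\rangle\in A\}\big)$$ whenever the set on the right is measurable, and in general by adding over ranks $g\ge 0$. Here $\langle\langle\cdot\rangle\rangle$ denotes the closed normal subgroup generated. (The quotient fails to be a Schur $\sigma$-group of rank $g$ only with probability $0$.) The sets in $\Omega$ are measurable for $\mu_{BBH}$. *)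

(* Defs.v *)
From HB Require Import structures.
From mathcomp Require Import all_boot all_order all_algebra all_fingroup all_solvable.
From mathcomp Require Import generic_quotient finmap.
From mathcomp Require Import all_classical all_reals all_analysis.

Set Implicit Arguments.
Unset Strict Implicit.
Unset Printing Implicit Defensive.

Import numFieldNormedType.Exports.
Import GroupScope.

Local Open Scope classical_set_scope.
Local Open Scope quotient_scope.
Local Open Scope group_scope.

HB.mixin Record isTopologicalGroup G of monoid.Group G & Topological G := {
  mulg_continuous : continuous (fun x : G * G => x.1 * x.2) ;
  invg_continuous : continuous (fun x : G => x^-1)
}.

#[short(type="topologicalGroupType")]
HB.structure Definition TopologicalGroup :=
  {G of monoid.Group G & Topological G & isTopologicalGroup G}.

HB.instance Definition _ (H : groupType) := monoid.Group.on (discrete_topology H).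

Section DiscreteGroup.
Variable H : groupType.

Fact discrete_mulg_continuous :
  continuous (fun x : discrete_topology H * discrete_topology H => x.1 * x.2).
Proof.
move=> x A /nbhs_singleton Ax; exists ([set x.1], [set x.2]).
  by split; exact: discrete_set1.
by case=> a b /= [-> ->].
Qed.

Fact discrete_invg_continuous :
  continuous (fun x : discrete_topology H => x^-1).
Proof.
move=> x A /nbhs_singleton Ax.
by apply: (@filterS _ (nbhs x) _ [set x]); [move=> y ->|exact: discrete_set1].
Qed.

HB.instance Definition _ := isTopologicalGroup.Build (discrete_topology H)
  discrete_mulg_continuous discrete_invg_continuous.
End DiscreteGroup.

Definition is_subgroup (G : groupType) (N : set G) : Prop :=
  [/\ N 1, forall x y, N x -> N y -> N (x * y) & forall x, N x -> N x^-1].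

Definition conj_stable (G : groupType) (N : set G) : Prop :=
  forall x g, N x -> N (x ^ g).

Record normalSubgroup (G : groupType) := NormalSubgroup {
  nsub :> set G ;
  nsub_subgroup : is_subgroup nsub ;
  nsub_normal : conj_stable nsub }.

Section Quotient.
Variables (G : topologicalGroupType) (N : normalSubgroup G).

Definition coset_rel (x y : G) : bool := `[< nsub N (x^-1 * y) >].

Fact coset_rel_equiv : equiv_class_of coset_rel.
Proof.
have [N1 NM NV] := nsub_subgroup N.
split=> [x|x y|y x z]; rewrite /coset_rel.
- by apply/asboolP; rewrite mulVg.
- by apply/asboolP/asboolP => /NV; rewrite invMg invgK.
- move=> /asboolP xy /asboolP yz; apply/asboolP.
  by have := NM _ _ xy yz; rewrite mulgA mulgK.
Qed.

Canonical coset_equiv := EquivRelPack coset_rel_equiv.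

Definition quotientGroup : Type := quotient_topology {eq_quot coset_equiv}.
HB.instance Definition _ := Topological.on quotientGroup.

Definition qpi (x : G) : quotientGroup := \pi_({eq_quot coset_equiv})%qT x.
Definition qrepr (a : quotientGroup) : G := repr (a : {eq_quot coset_equiv}).

Fact qreprK : cancel qrepr qpi. Proof. exact: reprK. Qed.

Fact qpi_eqP x y : qpi x = qpi y <-> nsub N (x^-1 * y).
Proof.
split; first by move=> /eqmodP/asboolP.
by move=> Nxy; apply/eqmodP/asboolP.
Qed.

Let qone := qpi 1.
Let qinv a := qpi (qrepr a)^-1.
Let qmul a b := qpi (qrepr a * qrepr b).

Let N_conj x g : nsub N x -> nsub N (x ^ g). Proof. exact: nsub_normal. Qed.

Fact qpi_mul x y : qmul (qpi x) (qpi y) = qpi (x * y).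
Proof.
have [_ NM _] := nsub_subgroup N; apply/qpi_eqP.
set x' := qrepr _; set y' := qrepr _.
have /qpi_eqP Nx : qpi x' = qpi x by exact: qreprK.
have /qpi_eqP Ny : qpi y' = qpi y by exact: qreprK.
have -> : (x' * y')^-1 * (x * y) = (x'^-1 * x) ^ y' * (y'^-1 * y).
  by rewrite /conjg invMg !mulgA mulgK.
exact: NM (N_conj _ Nx) Ny.
Qed.

Fact qpi_inv x : qinv (qpi x) = qpi x^-1.
Proof.
have [_ _ NV] := nsub_subgroup N; apply/qpi_eqP.
set x' := qrepr _.
have /qpi_eqP Nx : qpi x' = qpi x by exact: qreprK.
have -> : x'^-1^-1 * x^-1 = (x'^-1 * x)^-1 ^ x'^-1.
  by rewrite /conjg invMg !invgK !mulgA mulgK.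
exact: N_conj (NV _ Nx).
Qed.

Let qmulA : associative qmul.
Proof.
move=> a b c; rewrite -(qreprK a) -(qreprK b) -(qreprK c).
by rewrite !qpi_mul mulgA.
Qed.
Let qmul1 : left_id qone qmul.
Proof. by move=> a; rewrite -(qreprK a) qpi_mul mul1g. Qed.
Let qmulr1 : right_id qone qmul.
Proof. by move=> a; rewrite -(qreprK a) qpi_mul mulg1. Qed.
Let qmulV : left_inverse qone qinv qmul.
Proof. by move=> a; rewrite -(qreprK a) qpi_inv qpi_mul mulVg. Qed.
Let qmulrV : right_inverse qone qinv qmul.
Proof. by move=> a; rewrite -(qreprK a) qpi_inv qpi_mul mulgV. Qed.

HB.instance Definition _ :=
  isGroup.Build quotientGroup qmulA qmul1 qmulr1 qmulV qmulrV.

Fact qpiM : {morph qpi : x y / x * y}.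
Proof. by move=> x y; rewrite -qpi_mul. Qed.
Fact qpiV : {morph qpi : x / x^-1}.
Proof. by move=> x; rewrite -qpi_inv. Qed.

Fact qpi_open (A : set quotientGroup) : open A <-> open (qpi @^-1` A).
Proof. by []. Qed.

Fact qpi_continuous : continuous qpi. Proof. exact: pi_continuous. Qed.

Fact translate_open (x : G) (A : set G) : open A -> open ((fun y => x * y) @^-1` A).
Proof.
apply: open_comp => y _.
apply: (@continuous_comp _ _ _ (fun z => (x, z)) (fun z : G * G => z.1 * z.2)).
  by apply: cvg_pair; [exact: cvg_cst|exact: cvg_id].
exact: mulg_continuous.
Qed.

Fact translater_open (x : G) (A : set G) : open A -> open ((fun y => y * x) @^-1` A).
Proof.
apply: open_comp => y _.
apply: (@continuous_comp _ _ _ (fun z => (z, x)) (fun z : G * G => z.1 * z.2)).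
  by apply: cvg_pair; [exact: cvg_id|exact: cvg_cst].
exact: mulg_continuous.
Qed.

Fact qpi_open_map (A : set G) : open A -> open (qpi @` A).
Proof.
move=> oA; apply/qpi_open.
have -> : qpi @^-1` (qpi @` A) = \bigcup_(n in nsub N) ((fun y => y * n) @^-1` A).
  apply/seteqP; split=> [x [y Ay /esym/qpi_eqP Nxy]|x [n Nn /= Axn]].
    by exists (x^-1 * y) => //=; rewrite mulgA mulgV mul1g.
  exists (x * n) => //; apply/esym/qpi_eqP.
  by rewrite mulgA mulVg mul1g.
by apply: bigcup_open => n _; exact: translater_open.
Qed.

Let qmul_continuous : continuous (fun a : quotientGroup * quotientGroup => a.1 * a.2).
Proof.
move=> [a b] A nA; rewrite nbhsE in nA; have [B [oB /= Bab] BA] := nA.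
rewrite -(qreprK a) -(qreprK b) -qpiM /= in Bab.
have /(@mulg_continuous G (qrepr a, qrepr b)) [/= [U V] [/= nU nV] UV] :
  nbhs (qrepr a * qrepr b) (qpi @^-1` B).
  by apply: open_nbhs_nbhs; split.
rewrite !nbhsE in nU nV.
have [U' [oU' U'a] UU'] := nU; have [V' [oV' V'b] VV'] := nV.
exists (qpi @` U', qpi @` V') => /=.
  split; apply: open_nbhs_nbhs; split.
  - exact: qpi_open_map.
  - by exists (qrepr a); rewrite ?qreprK.
  - exact: qpi_open_map.
  - by exists (qrepr b); rewrite ?qreprK.
case=> c d [/= [x U'x <-] [y V'y <-]]; apply: BA; rewrite /= -qpiM.
by apply: (UV (x, y)); split; [exact: UU'|exact: VV'].
Qed.

Let qinv_continuous : continuous (fun a : quotientGroup => a^-1).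
Proof.
apply/continuousP => A oA; apply/qpi_open.
have -> : qpi @^-1` ((fun a => a^-1) @^-1` A) = (fun x => x^-1) @^-1` (qpi @^-1` A).
  by apply/seteqP; split=> x /=; rewrite qpiV.
by apply: open_comp => [x _|]; [exact: invg_continuous|exact/qpi_open].
Qed.

HB.instance Definition _ := isTopologicalGroup.Build quotientGroup
  qmul_continuous qinv_continuous.

End Quotient.

Section ClosedGeneration.
Variable G : topologicalGroupType.

Definition closed_gen (S : set G) : set G :=
  smallest [set H | is_subgroup H /\ closed H] S.

Definition closed_normal_gen (S : set G) : set G :=
  smallest [set H | [/\ is_subgroup H, conj_stable H & closed H]] S.

Fact bigcap_subgroup (E : set (set G)) :
  (forall H, E H -> is_subgroup H) -> is_subgroup (\bigcap_(H in E) H).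
Proof.
move=> sE; split.
- by move=> H /sE[].
- by move=> x y Ex Ey H EH; have [_ HM _] := sE _ EH; exact: HM (Ex _ EH) (Ey _ EH).
- by move=> x Ex H EH; have [_ _ HV] := sE _ EH; exact: HV (Ex _ EH).
Qed.

Fact closed_gen_subgroup S : is_subgroup (closed_gen S).
Proof. by apply: bigcap_subgroup => H [[]]. Qed.

Fact closed_gen_closed S : closed (closed_gen S).
Proof. by apply: closed_bigI => H [[]]. Qed.

Fact conjg_continuous (g : G) : continuous (fun x : G => x ^ g).
Proof.
move=> y; rewrite /conjg.
apply: (@continuous_comp _ _ _ (fun z => (g^-1, z * g)) (fun z : G * G => z.1 * z.2)).
  apply: cvg_pair; first exact: cvg_cst.
  apply: (@continuous_comp _ _ _ (fun z => (z, g)) (fun z : G * G => z.1 * z.2)).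
    by apply: cvg_pair; [exact: cvg_id|exact: cvg_cst].
  exact: mulg_continuous.
exact: mulg_continuous.
Qed.

Fact closed_gen_conj S : conj_stable S -> conj_stable (closed_gen S).
Proof.
move=> cS x g; apply: (@smallest_sub _ _ _ ((fun x => x ^ g) @^-1` closed_gen S)).
  have [S1 SM SV] := closed_gen_subgroup S; split; [split|] => /=.
  - by rewrite conj1g.
  - by move=> a b Sa Sb; rewrite conjMg; exact: SM.
  - by move=> a Sa; rewrite conjVg; exact: SV.
  - have /continuous_closedP cg := @conjg_continuous g.
    exact: (cg _ (@closed_gen_closed S)).
by move=> y Sy; apply: sub_gen_smallest; exact: cS.
Qed.

Definition closed_gen_normal S (cS : conj_stable S) : normalSubgroup G :=
  NormalSubgroup (closed_gen_subgroup S) (closed_gen_conj cS).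

Fact closed_normal_gen_subgroup S : is_subgroup (closed_normal_gen S).
Proof. by apply: bigcap_subgroup => H [[]]. Qed.

Fact closed_normal_gen_conj S : conj_stable (closed_normal_gen S).
Proof. by move=> x g Sx H HS; have [[_ + _] _] := HS; apply; exact: Sx. Qed.

Definition normal_closure (S : set G) : normalSubgroup G :=
  NormalSubgroup (closed_normal_gen_subgroup S) (@closed_normal_gen_conj S).

Definition commutators : set G :=
  [set z | exists x y : G, z = [~ x, y]].

Fact commutators_conj : conj_stable commutators.
Proof. by move=> _ g [x [y ->]]; exists (x ^ g), (y ^ g); rewrite conjRg. Qed.

Definition closed_derived : normalSubgroup G :=
  closed_gen_normal commutators_conj.

Variable p : nat.

Definition lower_p_gens (P : set G) : set G :=
  [set z | (exists x y : G, P y /\ z = [~ x, y]) \/ (exists2 y, P y & z = y ^+ p)].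

Fixpoint lower_p_set (n : nat) : set G :=
  if n is m.+1 then closed_gen (lower_p_gens (lower_p_set m)) else setT.

Fact lower_p_gens_conj P : conj_stable P -> conj_stable (lower_p_gens P).
Proof.
move=> cP _ g [[x [y [Py ->]]]|[y Py ->]].
  by left; exists (x ^ g), (y ^ g); rewrite conjRg; split=> //; exact: cP.
by right; exists (y ^ g); [exact: cP|rewrite conjXg].
Qed.

Fact lower_p_set_subgroup n : is_subgroup (lower_p_set n).
Proof. by case: n => [|n]; [split|exact: closed_gen_subgroup]. Qed.

Fact lower_p_set_conj n : conj_stable (lower_p_set n).
Proof. by elim: n => [//|n IHn]; apply: closed_gen_conj; exact: lower_p_gens_conj. Qed.

Definition lower_p (n : nat) : normalSubgroup G :=
  NormalSubgroup (lower_p_set_subgroup n) (@lower_p_set_conj n).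

Definition lower_p_quotient (c : nat) : topologicalGroupType :=
  quotientGroup (lower_p c).

End ClosedGeneration.

Section Morphisms.
Variables G H : topologicalGroupType.

Definition continuous_hom (f : G -> H) : Prop :=
  {morph f : x y / x * y} /\ continuous f.

Definition top_group_iso (f : G -> H) : Prop :=
  continuous_hom f /\ exists g : H -> G, [/\ cancel f g, cancel g f & continuous g].

Definition isomorphic : Prop := exists f : G -> H, top_group_iso f.

End Morphisms.

Section ProP.
Variable p : nat.

(* Profinite = compact, Hausdorff and totally disconnected; pro-p: every open
   normal subgroup has index a power of p. *)
Definition pro_p_group (G : topologicalGroupType) : Prop :=
  [/\ compact [set: G], hausdorff_space G, totally_disconnected [set: G] &
      forall N : normalSubgroup G, open N ->
        exists k : nat, ([set: quotientGroup N] #= `I_(p ^ k))%card].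

Definition finitely_generated (G : topologicalGroupType) : Prop :=
  exists S : set G, finite_set S /\ closed_gen S = setT.

(* Automorphisms of a profinite group are bicontinuous. *)
Definition GI_automorphism (G : topologicalGroupType) (s : G -> G) : Prop :=
  top_group_iso s /\
  exists S : set G, closed_gen S = setT /\ forall x, S x -> s x = x^-1.

(* Universal property of the free pro-p group on x_0, ..., x_(g-1). *)
Definition free_pro_p (F : topologicalGroupType) (g : nat) (x : 'I_g -> F) :=
  pro_p_group F /\
  forall (H : topologicalGroupType) (y : 'I_g -> H), pro_p_group H ->
    exists! f : F -> H, continuous_hom f /\ forall i, f (x i) = y i.

End ProP.

(* dim_K (Z / B) = n: the classes of some e_0, ..., e_(n-1) in Z form a basis. *)
Definition has_quotient_dim (K : fieldType) (V : lmodType K)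
    (Z B : set V) (n : nat) : Prop :=
  exists e : 'I_n -> V, (forall i, Z (e i)) /\
    forall z, Z z -> exists! c : 'rV[K]_n, B (z - \sum_(i < n) c 0 i *: e i)%R.

(* H^1 and H^2 with coefficients in the trivial module Z/pZ, by continuous
   inhomogeneous cochains; the coboundary of a 0-cochain vanishes because the
   action is trivial. *)
Section Cohomology.
Local Open Scope ring_scope.
Variables (p : nat) (G : topologicalGroupType).

Definition continuous_cochain (T : topologicalType) (f : T -> 'F_p) : Prop :=
  continuous (f : T -> discrete_topology 'F_p).

Definition Z1 : set (G -> ('F_p)^o) :=
  [set f | continuous_cochain f /\ forall x y, f (x * y)%g = f x + f y].

Definition B1 : set (G -> ('F_p)^o) := [set 0].

Definition Z2 : set (G * G -> ('F_p)^o) :=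
  [set f | continuous_cochain f /\ forall x y z,
     f (y, z) - f (x * y, z)%g + f (x, y * z)%g - f (x, y) = 0].

Definition B2 : set (G * G -> ('F_p)^o) :=
  [set f | exists2 b : G -> 'F_p, continuous_cochain b &
     forall x y, f (x, y) = b y - b (x * y)%g + b x].

Definition dim_H1 (n : nat) : Prop := has_quotient_dim Z1 B1 n.
Definition dim_H2 (n : nat) : Prop := has_quotient_dim Z2 B2 n.

End Cohomology.

Section Schur.
Variable p : nat.

Definition is_schur_sigma (G : topologicalGroupType) : Prop :=
  [/\ pro_p_group p G, finitely_generated G,
      finite_set [set: quotientGroup (closed_derived G)],
      exists g, dim_H1 p G g /\ dim_H2 p G g &
      exists s : G -> G, GI_automorphism s].

(* A finitely generated profinite group has at most the cardinality of the
   continuum, so every one of them has an isomorphic copy whose carrier is in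
   Set.  Keeping the carriers this small is what makes the isomorphism classes
   form a type that can carry a sigma-algebra. *)
Record schurGroup := SchurGroup {
  schur_carrier : Set ;
  schur_structure : TopologicalGroup.axioms_ schur_carrier ;
  schur_groupP : is_schur_sigma (TopologicalGroup.Pack schur_structure) }.

Definition schur_group (G : schurGroup) : topologicalGroupType :=
  TopologicalGroup.Pack (schur_structure G).
Coercion schur_group : schurGroup >-> topologicalGroupType.

Record schurClass := SchurClass {
  schur_class : set schurGroup ;
  schur_classP : exists G : schurGroup,
    schur_class = [set H : schurGroup | isomorphic G H] }.

HB.instance Definition _ := gen_eqMixin schurClass.
HB.instance Definition _ := gen_choiceMixin schurClass.

Definition iso_class (G : schurGroup) : schurClass :=
  @SchurClass [set H : schurGroup | isomorphic G H] (ex_intro _ G erefl).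

Definition class_repr (C : schurClass) : schurGroup :=
  projT1 (cid (schur_classP C)).

End Schur.

Definition trivial_group : Set := unit.
HB.instance Definition _ := Finite.on trivial_group.
HB.instance Definition _ := @isGroup.Build trivial_group tt id (fun _ _ => tt)
  (fun _ _ _ => erefl) (fun x => let: tt := x in erefl) (fun x => let: tt := x in erefl) (fun=> erefl) (fun=> erefl).

Section Trivial.
Import GRing.Theory.
Variable p : nat.
Let T : topologicalGroupType := discrete_topology trivial_group.
Let triv (x y : T) : x = y.
Proof. by case: x y => [] []. Qed.
Let trivset (A : set T) : A 1 -> A = setT.
Proof. by move=> A1; apply/seteqP; split=> // x _; rewrite (triv x 1). Qed.
Let trivmap (U : topologicalType) (f : T -> U) : continuous f.
Proof. by move=> x A /nbhs_singleton Ax; apply: (@filterS _ (nbhs x) _ setT); [move=> y _ /=; rewrite (triv y x)|exact: filterT]. Qed.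

Let trivquot (N : normalSubgroup T) (a b : quotientGroup N) : a = b.
Proof. by rewrite -(qreprK a) -(qreprK b) (triv (qrepr a) (qrepr b)). Qed.

Let trivquot1 (N : normalSubgroup T) : [set: quotientGroup N] = [set 1].
Proof. by apply/seteqP; split=> // x _; exact: trivquot. Qed.

Let triv_proof : is_schur_sigma p T.
Proof.
have gen : closed_gen [set: T] = setT.
  by apply: trivset; apply: sub_gen_smallest.
split.
- split.
  + exact/finite_compact/finite_finset.
  + by move=> x y _; exact: triv.
  + move=> x _; rewrite (triv x 1); apply/seteqP; split=> [y _|_ ->].
      exact: triv.
    exact: connected_component_refl.
  + by move=> N _; exists 0%N; rewrite trivquot1 expn0; exact: card_set1.
- by exists setT; split=> //; exact: finite_finset.
- by rewrite trivquot1; exact: finite_set1.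
- exists 0%N; split; exists (fun=> 0%R); split=> [[]//|z Zz]; exists 0%R.
    split; last by move=> c _; apply/rowP => -[].
    rewrite big_ord0 subr0; case: Zz => _ zM.
    apply/funext => x; rewrite (triv x 1).
    by have /eqP := zM 1 1; rewrite mul1g -subr_eq subrr => /eqP <-.
  split; last by move=> c _; apply/rowP => -[].
  rewrite big_ord0 subr0; exists (fun x => z (x, x)); first exact: trivmap.
  by move=> x y; rewrite (triv x 1) (triv y 1) mul1g subrr add0r.
- exists id; split; last by exists setT; split=> // x _; exact: triv.
  by split; [split=> //; exact: trivmap|exists id; split=> //; exact: trivmap].
Qed.
Definition trivial_schur : schurGroup p :=
  @SchurGroup p trivial_group (TopologicalGroup.class T) triv_proof.

HB.instance Definition _ := isPointed.Build (schurClass p) (iso_class trivial_schur).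
End Trivial.

Section Omega.
Variable p : nat.

Definition omega_generators : set (set (schurClass p)) :=
  [set E | exists (P : finGroupType) (c : nat), p.-group [set: P]%SET /\
     E = [set C | isomorphic (lower_p_quotient (class_repr C) p c)
                             (discrete_topology P)]].

(* The set of isomorphism classes, equipped with the sigma-algebra Omega. *)
Definition schurSpace := g_sigma_algebraType omega_generators.

End Omega.

Section Sur.

Definition Sur_sigma (G H : topologicalGroupType) (sG : G -> G) (sH : H -> H) :
    set (G -> H) :=
  [set f | [/\ continuous_hom f, (forall y, exists x, f x = y) &
     forall x, f (sG x) = sH (f x)]].

Lemma schur_GI p (G : schurGroup p) : exists s : G -> G, GI_automorphism s.
Proof. by case: (schur_groupP G). Qed.

(* The GI-automorphism that is fixed on each Schur sigma-group; |Sur_sigma| does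
   not depend on this choice. *)
Definition schur_sigma p (G : schurGroup p) : G -> G := projT1 (cid (schur_GI G)).
Arguments schur_sigma {p} G _.

Definition card_Sur (R : realType) p (H : topologicalGroupType) (sH : H -> H)
    (C : schurClass p) : \bar R :=
  counting (Sur_sigma (schur_sigma (class_repr C)) sH).

End Sur.

(* Measurable types must be pointed, hence this alias pointed at 1. *)
Definition pointed_group (G : topologicalGroupType) : Type := G.
HB.instance Definition _ (G : topologicalGroupType) := Choice.on (pointed_group G).
HB.instance Definition _ (G : topologicalGroupType) :=
  isPointed.Build (pointed_group G) (1 : G).

Definition borel (G : topologicalGroupType) :=
  g_sigma_algebraType (@open G : set (set (pointed_group G))).

Section MuBBH.
Local Open Scope ring_scope.
Variables (R : realType) (p : nat).

(* The set X attached to (G, s): elements of Phi(G) = P_1(G) inverted by s. *)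
Definition inverted (G : topologicalGroupType) (s : G -> G) : set G :=
  [set x | nsub (lower_p G p 1) x /\ s x = x^-1%g].

(* The map induced by s on G / N; it does not depend on the representative as
   soon as s maps N into N, which is the case for N = P_c(G). *)
Definition quotient_map (G : topologicalGroupType) (N : normalSubgroup G)
    (s : G -> G) (a : quotientGroup N) : quotientGroup N := qpi N (s (qrepr a)).

(* A probability measure on X is seen as one on G for which X has measure 1; its
   image in Q_c(G) is the uniform measure on X_c, for every c. *)
Definition natural_measure (G : topologicalGroupType) (s : G -> G)
    (mu : set (borel G) -> \bar R) : Prop :=
  mu (inverted s) = 1%E /\
  forall (c : nat) (a : lower_p_quotient G p c),
    let Xc := inverted (@quotient_map G (lower_p G p c) s) in
    Xc a -> mu (inverted s `&` [set x | qpi (lower_p G p c) x = a]) =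
            ((#|` fset_set Xc|)%:R^-1)%:E.

Definition product_measure_of d (T : measurableType d) (g : nat)
    (mu : set T -> \bar R) (mug : set (g.-tuple T) -> \bar R) : Prop :=
  forall A : 'I_g -> set T, (forall i, measurable (A i)) ->
    mug [set r | forall i, A i (tnth r i)] = (\prod_(i < g) mu (A i))%E.

Definition mu_CL (g : nat) : R :=
  p%:R ^- (g ^ 2) * \prod_(1 <= k < g.+1) (1 - p%:R ^- k) ^- 2 *
  lim ((fun n : nat => \prod_(1 <= i < n.+1) (1 - p%:R ^- i : R)) @ \oo).

Definition schur_rank (g : nat) : set (schurClass p) :=
  [set C | dim_H1 p (class_repr C) g].

(* The tuples (r_1, ..., r_g) in X^g such that F / <<r_1, ..., r_g>> is a Schur
   sigma-group whose isomorphism class belongs to A. *)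
Definition relator_event (F : topologicalGroupType) (s : F -> F) (g : nat)
    (A : set (schurClass p)) : set (g.-tuple (borel F)) :=
  [set r | (forall i, inverted s (tnth r i)) /\
     exists G : schurGroup p,
       isomorphic (quotientGroup (normal_closure [set` (r : seq F)])) G /\
       A (iso_class G)].

Arguments relator_event {F} s g A _.

Definition mu_BBH (F : nat -> topologicalGroupType) (s : forall g, F g -> F g)
    (mug : forall g, set (g.-tuple (borel (F g))) -> \bar R)
    (A : set (schurClass p)) : \bar R :=
  (\sum_(0 <= g <oo)
     (mu_CL g)%:E * mug g (relator_event (s g) g (A `&` schur_rank g)))%E.

End MuBBH.

(* Main.v *)
Require Import Defs.
From HB Require Import structures.
From mathcomp Require Import all_boot all_order all_algebra all_fingroup all_solvable.
From mathcomp Require Import zify lra.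
From mathcomp Require boolp.

(* Multiplying a finite p-group H by a copy of F_p, inverted by sigma, multiplies
   |Sur_sigma(G, H)| by p^(d(G)) - p^(d(H)).  The moments of all H x F_p^k therefore
   give the factorial moments of p^(d(G) - d(H)) weighted by |Sur_sigma(G, H)|, and
   an alternating (Bonferroni-type) sieve recovers from them the integral of
   |Sur_sigma(G, H)| over the groups G with d(G) = d(H) = d; its value is mu_CL(d)
   times |GL_d(F_p)|.

   On the other side, for random relators r_1, ..., r_d in X an equivariant
   surjection F_d -> H kills each of them with probability 1 / |X(H)|, and there
   are |GL_d(F_p)| |X(H)|^d such surjections, so that the Boston-Bush-Hajir measure
   has the same integrals.  That F_d / <<r>> is
   almost surely a Schur sigma-group amounts to its having no quotient Z/p^n for
   large n, which is a union bound; H^2 is then computed by inflating cocycles to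
   F_d, where they become coboundaries.

   Finally, restricted to d(G) = d, the system of equations expressing the moments
   of the groups Q_c(G) through the masses of {Q_c = P} is triangular for the order
   of P, which is bounded in terms of c and d; so both measures agree on the
   generating pi-system. *)

Set Implicit Arguments.
Unset Strict Implicit.
Unset Printing Implicit Defensive.

Import GroupScope.
Local Open Scope group_scope.

(** * Equivariant surjections of finite p-groups *)

(** Everything is computed in finite groups: the quotients Q_c(G), represented by maps onto abstract
    finite groups ([finmodel]), since a surjection onto H only sees Q_c(G) once P_c(H) = 1. The
    automorphism fixed on G may be replaced by any other one, because GI-automorphisms of a finite
    p-group are conjugate; here, as in the counts of inverted elements, the oddness of p enters
    through square roots and fixed points of involutions. The obstacle is that the moment equations,
    all ranks together, involve quotients Q_c(G) of unbounded order, so that a downward induction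
    has no starting point. Fixing the rank cures this, but the restricted moments must be extracted
    without any prior control of the tail. The sieve achieves it because its truncation error is
    itself a factorial moment, times a coefficient of size at most 2^(-K). The absence of a quotient
    Z/p^(n+1) serves twice: it bounds the exponent of the abelianization, and it makes the square
    system of relators regular enough to yield 2-cocycles dual to the relators. *)

Section MorphFun.
Variables (G H : groupType) (f : G -> H).
Hypothesis fM : {morph f : x y / x * y}.

Lemma gmorph1 : f 1 = 1.
Proof. by apply: (@mulgI _ (f 1)); rewrite -fM !mulg1. Qed.

Lemma gmorphV x : f x^-1 = (f x)^-1.
Proof. by apply: (@mulgI _ (f x)); rewrite -fM !mulgV gmorph1. Qed.

Lemma gmorphX x n : f (x ^+ n) = f x ^+ n.
Proof. by elim: n => [|n IHn]; rewrite ?expg0 ?gmorph1// !expgS fM IHn. Qed.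

Lemma gmorphJ x y : f (x ^ y) = f x ^ f y.
Proof. by rewrite /conjg !fM gmorphV. Qed.

Lemma gmorphR x y : f [~ x, y] = [~ f x, f y].
Proof. by rewrite /commg /conjg !fM !gmorphV. Qed.

Lemma gmorph_inj : (forall x, f x = 1 -> x = 1) -> injective f.
Proof.
move=> K x y fxy; have : x * y^-1 = 1 by apply: K; rewrite fM gmorphV fxy mulgV.
by move=> /(congr1 (fun z => z * y)); rewrite -mulgA mulVg mulg1 mul1g.
Qed.

End MorphFun.

Section FixedPoint.

(** The points that are not fixed pair off, and removing such a pair preserves parity. The oddness
    of p enters here: cosets in a finite p-group have odd size. *)
Lemma odd_involution_fix (T : finType) (A : {set T}) (f : T -> T) :
  odd #|A| -> {in A, forall x, f x \in A} -> {in A, forall x, f (f x) = x} ->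
  exists2 x, x \in A & f x = x.
Proof.
have [n] := ubnP #|A|; elim: n A => // n IHn A; rewrite ltnS => An oA fA fK.
have [x xA] : exists x, x \in A by apply/card_gt0P; case: #|A| oA.
have [fx|nfx] := eqVneq (f x) x; first by exists x.
pose B := A :\ x :\ f x.
have cA : #|A| = (#|B|.+2)%N.
  by rewrite (cardsD1 x A) xA (cardsD1 (f x) (A :\ x)) !inE nfx fA.
have BA y : y \in B -> [/\ y != f x, y != x & y \in A].
  by rewrite !inE => /and3P[].
have [||||y yB fy] := IHn B.
- by apply: leq_trans An; rewrite cA.
- by move: oA; rewrite cA /= negbK.
- move=> y /BA[y1 y2 yA]; rewrite !inE fA// andbT.
  apply/andP; split; apply/eqP => e.
    by move: y2; rewrite -(fK _ yA) e fK// eqxx.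
  by move: y1; rewrite -e fK// eqxx.
- by move=> y /BA[_ _ yA]; exact: fK.
- by exists y => //; case: (BA y yB).
Qed.

End FixedPoint.

Section FiniteHom.

Definition is_mor (P H : finGroupType) (f : P -> H) : bool :=
  [forall x, forall y, f (x * y) == f x * f y].
Definition is_surj (P H : finType) (f : P -> H) : bool :=
  [forall y, exists x, f x == y].
Definition is_equiv (P H : finType) (s : P -> P) (t : H -> H) (f : P -> H) : bool :=
  [forall x, f (s x) == t (f x)].

Lemma is_morP (P H : finGroupType) (f : P -> H) :
  reflect {morph f : x y / x * y} (is_mor f).
Proof.
apply: (iffP forallP) => [h x y|h x]; first by have /forallP/(_ y)/eqP := h x.
by apply/forallP => y; apply/eqP.
Qed.

Lemma is_surjP (P H : finType) (f : P -> H) :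
  reflect (forall y, exists x, f x = y) (is_surj f).
Proof.
apply: (iffP forallP) => h y; first by have /existsP[x /eqP] := h y; exists x.
by apply/existsP; have [x <-] := h y; exists x.
Qed.

Lemma is_equivP (P H : finType) s t (f : P -> H) :
  reflect (forall x, f (s x) = t (f x)) (is_equiv s t f).
Proof. by apply: (iffP forallP) => h x; apply/eqP. Qed.

Lemma is_mor_ffun (P H : finGroupType) (f : P -> H) : is_mor (finfun f) = is_mor f.
Proof. by apply/is_morP/is_morP => h x y; have := h x y; rewrite !ffunE. Qed.

Lemma is_surj_ffun (P H : finType) (f : P -> H) : is_surj (finfun f) = is_surj f.
Proof.
by apply/is_surjP/is_surjP => h y; have [x <-] := h y; exists x; rewrite ffunE.
Qed.

Lemma is_equiv_ffun (P H : finType) s t (f : P -> H) :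
  is_equiv s t (finfun f) = is_equiv s t f.
Proof. by apply/is_equivP/is_equivP => h x; have := h x; rewrite !ffunE. Qed.

(** Total functions with boolean predicates, instead of morphisms with a domain, so that the
    surjections form a finite set that can be counted. *)
Definition sur (P : finGroupType) (s : P -> P) (H : finGroupType) (t : H -> H) :
  {set {ffun P -> H}} := [set f : {ffun P -> H} | [&& is_mor f, is_surj f & is_equiv s t f]].

Definition nsur P s H t := #|@sur P s H t|.

Lemma nsur_iso (P P' : finGroupType) (s : P -> P) (s' : P' -> P') (H : finGroupType)
    (t : H -> H) (e : P -> P') :
  {morph e : x y / x * y} -> bijective e -> (forall x, s' (e x) = e (s x)) ->
  nsur s t = nsur s' t.
Proof.
move=> eM [e' eK e'K] es.
have e'M : {morph e' : x y / x * y}.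
  by move=> x y; apply: (can_inj eK); rewrite eM !e'K.
have e's x : s (e' x) = e' (s' x).
  by apply: (can_inj eK); rewrite -es !e'K.
rewrite /nsur; have -> : sur s t = [set [ffun x => f (e x)] | f : {ffun P' -> H} in sur s' t].
  apply/setP => f; rewrite inE; apply/and3P/imsetP => [[/is_morP fM /is_surjP fS /is_equivP fs]|].
    exists [ffun x => f (e' x)]; last by apply/ffunP => x; rewrite !ffunE eK.
    rewrite inE is_mor_ffun is_surj_ffun is_equiv_ffun; apply/and3P; split.
    - by apply/is_morP => x y; rewrite e'M fM.
    - by apply/is_surjP => y; have [x <-] := fS y; exists (e x); rewrite eK.
    - by apply/is_equivP => x; rewrite -e's fs.
  move=> [g + ->]; rewrite inE is_mor_ffun is_surj_ffun is_equiv_ffun.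
  move=> /and3P[/is_morP gM /is_surjP gS /is_equivP gs]; split.
  - by apply/is_morP => x y; rewrite eM gM.
  - by apply/is_surjP => y; have [x <-] := gS y; exists (e' x); rewrite e'K.
  - by apply/is_equivP => x; rewrite -es gs.
rewrite card_imset// => f g /ffunP fg; apply/ffunP => x.
by have := fg (e' x); rewrite !ffunE e'K.
Qed.

Lemma nsur_gt0_card (P : finGroupType) s (H : finGroupType) t :
  (0 < @nsur P s H t)%N -> (#|H| <= #|P|)%N.
Proof.
move=> /card_gt0P[f]; rewrite inE => /and3P[_ /is_surjP fS _].
pose g y := projT1 (boolp.cid (fS y)).
have gK : cancel g f by move=> y; rewrite /g; case: boolp.cid.
by apply: (@leq_card _ _ g); exact: can_inj gK.
Qed.

(** With [nsur_gt0_card], this makes the matrix of surjection counts triangular for the group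
    order. *)
Lemma nsur_iso_card (P : finGroupType) s (H : finGroupType) t :
  (0 < @nsur P s H t)%N -> #|P| = #|H| ->
  exists e : P -> H, {morph e : x y / x * y} /\ bijective e.
Proof.
move=> /card_gt0P[f]; rewrite inE => /and3P[/is_morP fM /is_surjP fS _] PH.
exists f; split=> //.
pose g y := projT1 (boolp.cid (fS y)).
have gK : cancel g f by move=> y; rewrite /g; case: boolp.cid.
have gI : injective g by exact: can_inj gK.
have : bijective g by apply: (inj_card_bij gI); rewrite PH.
by move=> gb; apply: (bij_can_bij gb).
Qed.

(** The diagonal entries of that triangular matrix. *)
Lemma nsur_self (P : finGroupType) (s : P -> P) : (0 < nsur s s)%N.
Proof.
apply/card_gt0P; exists [ffun x => x]; rewrite inE is_mor_ffun is_surj_ffun is_equiv_ffun.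
by apply/and3P; split; [apply/is_morP|apply/is_surjP => y; exists y|apply/is_equivP].
Qed.

End FiniteHom.

(** * Characters to F_p, the Frattini subgroup and GI-automorphisms *)

Section Fp.
Variable p : nat.
Hypothesis p_prime : prime p.

Lemma Fp_mulgE (a b : 'F_p) : a * b = (a + b)%R. Proof. by []. Qed.
Lemma Fp_mulgC (a b : 'F_p) : a * b = b * a. Proof. by rewrite !Fp_mulgE GRing.addrC. Qed.
Lemma Fp_expgE (a : 'F_p) n : a ^+ n = (a *+ n)%R.
Proof. by elim: n => // n IHn; rewrite expgS IHn GRing.mulrS. Qed.

Lemma Fp_cyclic (a b : 'F_p) : b != 1 -> exists k, b ^+ k = a.
Proof.
move=> b0; exists (nat_of_ord (a / b)%R); rewrite Fp_expgE -GRing.mulr_natr natr_Zp.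
by rewrite GRing.mulrC GRing.divfK.
Qed.

Definition homs (P : finGroupType) := [set f : {ffun P -> 'F_p} | is_mor f].
Definition nhom P := #|homs P|.

Definition negates (P : finGroupType) (s : P -> P) : Prop :=
  forall h : P -> 'F_p, {morph h : x y / x * y} -> forall x, h (s x) = (h x)^-1.

Definition ext_inv (H : finGroupType) (t : H -> H) (x : H * 'F_p) : H * 'F_p :=
  (t x.1, x.2^-1).

Lemma hom_factor (P H K : finGroupType) (f : P -> H) (g : P -> K) :
  {morph f : x y / x * y} -> (forall y, exists x, f x = y) ->
  {morph g : x y / x * y} -> (forall x, f x = 1 -> g x = 1) ->
  exists2 h : H -> K, {morph h : x y / x * y} & forall x, g x = h (f x).
Proof.
move=> fM fS gM fg; pose h y := g (projT1 (boolp.cid (fS y))).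
have hE x : g x = h (f x).
  rewrite /h; case: boolp.cid => z /= fz; have : g (z^-1 * x) = 1.
    by apply: fg; rewrite fM (gmorphV fM) fz mulVg.
  by rewrite gM (gmorphV gM) => /(congr1 (fun t => g z * t)); rewrite mulKVg mulg1.
exists h => // x y; have [x' <-] := fS x; have [y' <-] := fS y.
by rewrite -fM -!hE gM.
Qed.

(** A pair (f, h) is onto H x F_p iff f is onto and h does not factor through f. Composition with f
    embeds the characters of H into those of P, and the equivariance of h is automatic by
    [negates]. *)
Lemma nsur_ext (P : finGroupType) (s : P -> P) (H : finGroupType) (t : H -> H) :
  negates s -> nsur s (ext_inv t) = (nsur s t * (nhom P - nhom H))%N.
Proof.
move=> sN.
pose good (fh : {ffun P -> H} * {ffun P -> 'F_p}) :=
  (fh.1 \in sur s t) && (fh.2 \in homs P :\: [set [ffun x => h (fh.1 x)] | h : {ffun H -> 'F_p} in homs H]).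
have -> : nsur s (ext_inv t) = #|[set fh | good fh]|.
  pose pr (f : {ffun P -> (H * 'F_p)%type}) := ([ffun x => (f x).1], [ffun x => (f x).2]).
  have -> : [set fh | good fh] = [set pr f | f in sur s (ext_inv t)].
    apply/setP => -[f h]; rewrite inE /good /=; apply/andP/imsetP => [[]|[g + [-> ->]]].
      rewrite inE => /and3P[/is_morP fM /is_surjP fS /is_equivP fs].
      rewrite !inE => /andP[nh /is_morP hM].
      exists [ffun x => (f x, h x)]; last by congr pair; apply/ffunP => x; rewrite !ffunE.
      rewrite inE is_mor_ffun is_surj_ffun is_equiv_ffun; apply/and3P; split.
      - by apply/is_morP => x y; rewrite fM hM.
      - apply/is_surjP => -[a b].
        (* The powers of [x0] move the second coordinate freely and leave the first one fixed. *)
        have [x0 [fx0 hx0]] : exists x, f x = 1 /\ h x != 1.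
          apply: boolp.contrapT => nx; move/negP: nh; apply; apply/imsetP.
          have [|k kM kE] := hom_factor fM fS hM.
            by move=> x fx; apply/eqP/negPn/negP => hx; apply: nx; exists x.
          exists [ffun x => k x]; first by rewrite inE is_mor_ffun; apply/is_morP.
          by apply/ffunP => x; rewrite !ffunE kE.
        have [x1 fx1] := fS a.
        have [k kE] := Fp_cyclic ((h x1)^-1 * b) hx0.
        exists (x1 * x0 ^+ k); congr pair.
          by rewrite fM (gmorphX fM) fx0 expg1n mulg1.
        by rewrite hM (gmorphX hM) kE mulKVg.
      - by apply/is_equivP => x; rewrite /ext_inv /= fs sN.
    rewrite inE => /and3P[/is_morP gM /is_surjP gS /is_equivP gs]; split.
      rewrite inE is_mor_ffun is_surj_ffun is_equiv_ffun; apply/and3P; split.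
      - by apply/is_morP => x y; rewrite gM.
      - by apply/is_surjP => y; have [x gx] := gS (y, 1); exists x; rewrite gx.
      - by apply/is_equivP => x; rewrite gs.
    rewrite !inE is_mor_ffun; apply/andP; split; last by apply/is_morP => x y; rewrite gM.
    apply/imsetP => -[k]; rewrite inE => /is_morP kM /ffunP kE.
    have F1 : (1%R : 'F_p) != 1 by rewrite GRing.oner_neq0.
    have [x gx] := gS (1, 1%R); have := kE x; rewrite !ffunE gx /= (gmorph1 kM) => e.
    by rewrite e eqxx in F1.
  rewrite card_imset// => f g [/ffunP fg1 /ffunP fg2]; apply/ffunP => x.
  have := fg1 x; have := fg2 x; rewrite !ffunE.
  by case: (f x) (g x) => [a b] [c d] /= -> ->.
rewrite -sum1dep_card -(pair_big_dep (fun f => f \in sur s t) (fun f h => h \in homs P :\: [set [ffun x => k (f x)] | k : {ffun H -> 'F_p} in homs H]) (fun _ _ => 1%N)) /=.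
rewrite /nsur -sum_nat_const; apply: eq_bigr => f; rewrite inE => /and3P[/is_morP fM /is_surjP fS _].
rewrite sum1_card cardsD (setIidPr _); last first.
  apply/subsetP => _ /imsetP[k + ->]; rewrite !inE is_mor_ffun => /is_morP kM.
  by apply/is_morP => x y; rewrite fM kM.
rewrite card_imset// => k k' /ffunP kk; apply/ffunP => y; have [x <-] := fS y.
by have := kk x; rewrite !ffunE.
Qed.

Lemma nhom_ext (H : finGroupType) : nhom (H * 'F_p)%type = (p * nhom H)%N.
Proof.
pose g (ah : 'F_p * {ffun H -> 'F_p}) : {ffun H * 'F_p -> 'F_p} :=
  [ffun x => (ah.2 x.1 + ah.1 * x.2)%R].
rewrite /nhom; have -> : homs (H * 'F_p)%type = [set g ah | ah in setX [set: 'F_p] (homs H)].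
  apply/setP => f; rewrite inE; apply/is_morP/imsetP => [fM|[[a h]]].
    exists (f (1, 1%R), [ffun x => f (x, 1)]).
      rewrite !inE is_mor_ffun /=; apply/is_morP => x y; rewrite -fM; congr (f _); congr pair.
      by rewrite mulg1.
    apply/ffunP => -[x b]; rewrite !ffunE /=.
    pose u : (H * 'F_p)%type := (1, 1%R); pose v : (H * 'F_p)%type := (x, 1).
    have -> : (x, b) = v * u ^+ (nat_of_ord b).
      have -> : u ^+ (nat_of_ord b) = (1, (1%R : 'F_p) ^+ (nat_of_ord b)).
        by elim: (nat_of_ord b) => // n IHn; rewrite !expgS IHn; congr pair; rewrite mulg1.
      by rewrite Fp_expgE natr_Zp; congr pair; rewrite ?mulg1// mul1g.
    rewrite fM (gmorphX fM) Fp_mulgE Fp_expgE -GRing.mulr_natr natr_Zp.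
    congr (_ + _)%R.
  rewrite !inE => /andP[_ /is_morP hM] -> [x b] [y c]; rewrite !ffunE /= hM !Fp_mulgE.
  by rewrite GRing.mulrDr GRing.addrACA.
rewrite card_in_imset ?cardsX ?cardsT ?card_Fp// => -[a h] [b k].
rewrite !inE => /andP[_ /is_morP hM] /andP[_ /is_morP kM] /ffunP e.
have ha : h =1 k.
  by move=> x; have := e (x, 0%R); rewrite !ffunE /= !GRing.mulr0 !GRing.addr0.
congr pair; last exact/ffunP.
have := e (1, 1%R); rewrite !ffunE /= (gmorph1 hM) (gmorph1 kM) !GRing.mulr1.
by move=> /GRing.addrI.
Qed.

(* A proper subgroup of a finite p-group lies in a maximal one, which is normal
   of index p. *)
Lemma proper_hom (P : finGroupType) (L : {group P}) :
  p.-group [set: P] -> L \proper [set: P] ->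
  exists h : P -> 'F_p, [/\ {morph h : x y / x * y}, exists x, h x != 1 &
    forall x, x \in L -> h x = 1].
Proof.
move=> pP LP.
have [LE|[M mM LM]] := maximal_exists (proper_sub LP); first by rewrite LE properxx in LP.
have nM := p_maximal_normal pP mM.
have iM := p_maximal_index pP mM.
have [_ nMP] := andP nM.
have cQ : #|[set: P] / M| = p by rewrite card_quotient.
have iso : [set: P] / M \isog [set: 'F_p].
  rewrite isog_cyclic_card ?prime_cyclic ?cQ ?cardsT ?card_Fp//.
  by rewrite eqxx.
have /isogP[phi phiI phiE] := iso.
have inN x : x \in 'N(M) by apply: (subsetP nMP); rewrite inE.
have inQ x : coset M x \in [set: P] / M by rewrite mem_quotient// inE.
exists (fun x => phi (coset M x)); split.
- by move=> x y; rewrite morphM ?inN// morphM ?inQ.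
- have : M \proper [set: P] by exact: maxgroupp mM.
  move=> /properP[_ [x _ xM]]; exists x.
  by rewrite morph_injm_eq1//; apply: contra xM => /eqP; exact: coset_idr (inN x).
- by move=> x /(subsetP LM) xM; rewrite coset_id// morph1.
Qed.

(** The Frattini subgroup, as the common kernel of all characters to F_p; [fratE] identifies it with
    P_1. *)
Definition frat (P : finGroupType) : {set P} :=
  [set x | [forall h : {ffun P -> 'F_p}, is_mor h ==> (h x == 1)]].

Lemma fratP (P : finGroupType) (x : P) :
  reflect (forall h : P -> 'F_p, {morph h : x y / x * y} -> h x = 1) (x \in frat P).
Proof.
rewrite inE; apply: (iffP forallP) => h => [k kM|k].
  have /implyP := h (finfun k); rewrite is_mor_ffun ffunE => /(_ (introT (is_morP _) kM)).
  by move/eqP.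
by apply/implyP => /is_morP kM; apply/eqP/h.
Qed.

Lemma frat_group_set (P : finGroupType) : group_set (frat P).
Proof.
apply/group_setP; split; first by apply/fratP => h hM; exact: gmorph1.
by move=> x y /fratP fx /fratP fy; apply/fratP => h hM; rewrite hM fx// fy// mulg1.
Qed.
Canonical frat_group (P : finGroupType) := Group (frat_group_set P).

Record GI (P : finGroupType) (s : P -> P) : Prop := IsGI {
  GI_morph : {morph s : x y / x * y};
  GI_gen : exists2 A : {set P}, <<A>> = [set: P] & {in A, forall x, s x = x^-1} }.

Lemma gen_mor_eq (P H : finGroupType) (A : {set P}) (f g : P -> H) :
  <<A>> = [set: P] -> {morph f : x y / x * y} -> {morph g : x y / x * y} ->
  {in A, f =1 g} -> f =1 g.
Proof.
move=> gA fM gM fg x.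
have gE : group_set [set x | f x == g x].
  apply/group_setP; split; first by rewrite inE (gmorph1 fM) (gmorph1 gM).
  by move=> y z; rewrite !inE fM gM => /eqP -> /eqP ->.
have : <<A>> \subset Group gE by rewrite gen_subG; apply/subsetP => y yA; rewrite inE fg.
by rewrite gA => /subsetP/(_ x); rewrite !inE => /(_ isT)/eqP.
Qed.

Lemma GI_invol (P : finGroupType) (s : P -> P) : GI s -> involutive s.
Proof.
move=> [sM [A gA sA]] x.
have := @gen_mor_eq P P A (s \o s) id gA; apply => //=.
- by move=> y z; rewrite /= !sM.
- by move=> y yA; rewrite /= (sA y)// (gmorphV sM) (sA y)// invgK.
Qed.

Lemma GI_negates (P : finGroupType) (s : P -> P) : GI s -> negates s.
Proof.
move=> [sM [A gA sA]] h hM; apply: (gen_mor_eq gA).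
- by move=> x y; rewrite sM hM.
- by move=> x y; rewrite hM invMg Fp_mulgC.
- by move=> x xA; rewrite sA// (gmorphV hM).
Qed.

Lemma pgroup_odd (P : finGroupType) (B : {group P}) : odd p -> p.-group [set: P] -> odd #|B|.
Proof.
move=> op /(pgroupS (subsetT B)) pB; rewrite (card_pgroup pB) oddX op orbT.
by [].
Qed.

Section Conjugacy.
Variables (P : finGroupType) (s s' : P -> P).
Hypotheses (p_odd : odd p) (pP : p.-group [set: P]) (GIs : GI s) (GIs' : GI s').

(** If the fixed subgroup were proper, a nontrivial character h would kill it. A fibre of h over a
    value other than 1 is f-stable of odd size, so it contains a fixed point, which h should
    kill. *)
Lemma involution_trivial (f : P -> P) : {morph f : x y / x * y} -> involutive f ->
  (forall h : P -> 'F_p, {morph h : x y / x * y} -> forall x, h (f x) = h x) ->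
  f =1 id.
Proof.
move=> fM fK hf.
have gE : group_set [set x | f x == x].
  apply/group_setP; split; first by rewrite inE (gmorph1 fM).
  by move=> y z; rewrite !inE fM => /eqP -> /eqP ->.
have [LP x|] := boolP ([set: P] \subset Group gE).
  by have /subsetP/(_ x) := LP; rewrite !inE => /(_ isT)/eqP.
move=> nL; have LP : Group gE \proper [set: P] by rewrite properE subsetT.
have [h [hM [x hx] hL]] := proper_hom pP LP.
have kE : group_set [set y | h y == 1].
  apply/group_setP; split; first by rewrite inE (gmorph1 hM).
  by move=> y z; rewrite !inE hM => /eqP -> /eqP ->; rewrite mulg1.
have [|||y] := @odd_involution_fix P [set y | h y == h x] f.
- have -> : [set y | h y == h x] = [set x * k | k in Group kE].
    apply/setP => y; rewrite inE; apply/eqP/imsetP => [hy|[k]].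
      by exists (x^-1 * y); rewrite ?inE ?mulKVg// hM (gmorphV hM) hy mulVg.
    by rewrite inE => /eqP hk ->; rewrite hM hk mulg1.
  rewrite card_imset; last exact: mulgI.
  exact: pgroup_odd.
- by move=> y; rewrite !inE hf.
- by move=> y _; exact: fK.
- by rewrite inE => /eqP hy fy; move: hx; rewrite -hy hL ?eqxx// inE fy.
Qed.

(* The product of the two involutions acts trivially on the Frattini quotient,
   so it has odd order m; its (m+1)/2-th power conjugates one into the other. *)
Lemma GI_conjugate : exists e : P -> P,
  [/\ {morph e : x y / x * y}, bijective e & forall x, s' (e x) = e (s x)].
Proof.
pose a1 := perm (inv_inj (GI_invol GIs)); pose a2 := perm (inv_inj (GI_invol GIs')).
have a1K : a1 * a1 = 1 by apply/permP => x; rewrite permM !permE (GI_invol GIs).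
have a2K : a2 * a2 = 1 by apply/permP => x; rewrite permM !permE (GI_invol GIs').
pose phi := a1 * a2; pose m := #[phi].
have phiM k : {morph (phi ^+ k) : x y / x * y}.
  elim: k => [|k IHk] x y; first by rewrite expg0 !perm1.
  by rewrite expgSr !permM IHk !permE (GI_morph GIs) (GI_morph GIs').
have phih k (h : P -> 'F_p) : {morph h : x y / x * y} -> forall x, h ((phi ^+ k) x) = h x.
  move=> hM; elim: k => [|k IHk] x; first by rewrite expg0 perm1.
  rewrite expgSr !permM !permE (GI_negates GIs')// (GI_negates GIs)// invgK.
  exact: IHk.
(* For even m, phi^(m/2) would be an involution preserving every character, hence trivial, against
   the definition of the order. *)
have om : odd m.
  apply/negPn/negP => em; have m2 : m = (m./2 + m./2)%N by rewrite addnn -[LHS]odd_double_half (negbTE em).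
  have m0 : (0 < m./2)%N by have := order_gt0 phi; rewrite -/m; lia.
  have : phi ^+ m./2 = 1.
    apply/permP => x; rewrite perm1; apply: (involution_trivial (f := phi ^+ m./2)) => //.
    - by move=> y; rewrite -permM -expgD -m2 expg_order perm1.
    - by move=> h hM y; exact: phih.
  move/eqP; rewrite -order_dvdn -/m => /(dvdn_leq m0); lia.
pose k := (m.+1)./2; pose e := phi ^+ k.
(* Each of two involutions inverts their product by conjugation. *)
have a1phi j : a1 * phi ^+ j = phi ^- j * a1.
  elim: j => [|j IHj]; first by rewrite expg0 invg1 mulg1 mul1g.
  rewrite {1}expgSr mulgA IHj expgS invMg -!mulgA; congr (_ * _).
  rewrite /phi mulgA a1K mul1g invMg.
  have -> : a2^-1 = a2 by apply: (mulgI a2); rewrite mulgV a2K.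
  have -> : a1^-1 = a1 by apply: (mulgI a1); rewrite mulgV a1K.
  by rewrite -mulgA a1K mulg1.
have key : a1 * e = e * a2.
  rewrite /e a1phi; apply: (mulgI (phi ^+ k)); rewrite mulKVg mulgA -expgD.
  have -> : (k + k = m.+1)%N by rewrite addnn /k; lia.
  by rewrite expgSr expg_order mul1g /phi -mulgA a2K mulg1.
exists e; split; [exact: phiM|by exists (e^-1)%g; [exact: permK|exact: permKV]|].
by move=> x; have := congr1 (fun a : {perm P} => a x) key; rewrite !permM !permE.
Qed.

Lemma nsur_GI (H : finGroupType) (t : H -> H) : nsur s t = nsur s' t.
Proof. by have [e [eM eb es]] := GI_conjugate; exact: nsur_iso eM eb es. Qed.

End Conjugacy.

Section Inverted.
Variables (P : finGroupType) (s : P -> P).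
Hypotheses (p_odd : odd p) (pP : p.-group [set: P]).
Hypotheses (sM : {morph s : x y / x * y}) (sK : involutive s).

Definition invd (B : {set P}) : {set P} := [set y in B | s y == y^-1].

(* [y |-> u^-1 y u^-1], with [u] a square root of an inverted element of the
   fibre, carries the inverted elements of the fibre into the kernel. *)
Lemma inverted_fiber (B : {group P}) (H : finGroupType) (f : P -> H) (y0 : P) (t : H -> H) :
  {morph f : x y / x * y} -> (forall x, f (s x) = t (f x)) ->
  y0 \in B -> (forall x, x \in B -> s x \in B) -> t (f y0) = (f y0)^-1 ->
  #|[set y in invd B | f y == f y0]| = #|[set y in invd B | f y == 1]|.
Proof.
move=> fM ft y0B sB ty0.
have tV x : t (f x)^-1 = (t (f x))^-1.
  by rewrite -(gmorphV fM) -!ft (gmorphV sM) (gmorphV fM).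
(* The fixed points of y -> s(y)^-1 are the inverted elements, and the fibre is a coset of a
   subgroup of B, hence of odd size. *)
have [|||x] := @odd_involution_fix P [set y in B | f y == f y0] (fun y => (s y)^-1).
- have kE : group_set [set y in B | f y == 1].
    apply/group_setP; split; first by rewrite !inE group1 (gmorph1 fM) eqxx.
    move=> y z; rewrite !inE fM => /andP[yB /eqP ->] /andP[zB /eqP ->].
    by rewrite groupM// mulg1 eqxx.
  have -> : [set y in B | f y == f y0] = [set y0 * k | k in Group kE].
    apply/setP => y; rewrite inE; apply/andP/imsetP => [[yB /eqP fy]|[k]].
      exists (y0^-1 * y); rewrite ?mulKVg// !inE groupM ?groupV//= fM (gmorphV fM) fy mulVg.
      by [].
    by rewrite !inE => /andP[kB /eqP fk] ->; rewrite groupM// fM fk mulg1.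
  by rewrite card_imset; [exact: pgroup_odd|exact: mulgI].
- move=> y; rewrite !inE => /andP[yB /eqP fy].
  by rewrite groupV sB// (gmorphV fM) ft fy ty0 invgK eqxx.
- by move=> y _; rewrite (gmorphV sM) invgK sK.
rewrite !inE => /andP[xB /eqP fx] sx.
have {}sx : s x = x^-1 by rewrite -{2}sx invgK.
have ox : odd #[x].
  have : odd #|<[x]>| by exact: pgroup_odd.
  by [].
(* As x has odd order, this power squares to x; being a power of x, it is inverted too. *)
pose u := x ^+ (#[x].+1)./2.
have uu : u * u = x.
  rewrite /u -expgD addnn; have -> : ((#[x].+1)./2).*2 = #[x].+1 by lia.
  by rewrite expgSr expg_order mul1g.
have su : s u = u^-1 by rewrite /u (gmorphX sM) sx expVgn.
have uB : u \in B by rewrite groupX.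
rewrite -fx -(card_imset (f := fun y => u^-1 * y * u^-1)); last first.
  by move=> y z /mulIg /mulgI.
apply: eq_card => z; rewrite !inE; apply/imsetP/andP => [[y]|[/andP[zB sz] fz]].
  rewrite !inE => /andP[/andP[yB /eqP sy] /eqP fy] ->; split.
    by rewrite !groupM ?groupV//= !sM (gmorphV sM) su sy !invMg !invgK mulgA.
  by rewrite !fM fy (gmorphV fM) -uu fM mulKg mulgV.
exists (u * z * u); last by rewrite -!mulgA mulgV mulg1 mulKg.
rewrite !inE !groupM//= !sM su (eqP sz) !invMg mulgA eqxx /=.
by rewrite !fM (eqP fz) mulg1 -fM uu.
Qed.

End Inverted.

End Fp.

(** * Counting surjections onto H x F_p^k and from quotients of free groups *)

Section Counting.
Variable p : nat.
Hypothesis p_prime : prime p.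

Fixpoint ext (H : finGroupType) (k : nat) : finGroupType :=
  if k is k'.+1 then (ext H k' * 'F_p)%type : finGroupType else H.

Fixpoint ext_aut (H : finGroupType) (t : H -> H) (k : nat) : ext H k -> ext H k :=
  if k is k'.+1 then ext_inv (p := p) (@ext_aut H t k') else t.

Lemma nhom_extk (H : finGroupType) k : nhom p (ext H k) = (p ^ k * nhom p H)%N.
Proof. by elim: k => [|k IHk]; rewrite ?mul1n//= nhom_ext// IHk expnS mulnA. Qed.

(** For p-groups the i-th factor is p^(d(P)) - p^(i + d(H)): varying k gives the factorial moments
    on which the sieve operates. *)
Lemma nsur_extk (P : finGroupType) (s : P -> P) (H : finGroupType) (t : H -> H) k :
  negates p s ->
  nsur s (ext_aut t (k := k)) = (nsur s t * \prod_(i < k) (nhom p P - p ^ i * nhom p H))%N.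
Proof.
move=> sN; elim: k => [|k IHk]; first by rewrite big_ord0 muln1.
by rewrite /= nsur_ext// IHk big_ord_recr /= mulnA nhom_extk.
Qed.

Lemma card_ext (H : finGroupType) k : #|ext H k| = (#|H| * p ^ k)%N.
Proof.
elim: k => [|k IHk]; first by rewrite muln1.
by rewrite /= card_prod IHk card_Fp// expnSr mulnA.
Qed.

Lemma pgroup_ext (H : finGroupType) k : p.-group [set: H] -> p.-group [set: ext H k].
Proof.
by rewrite /pgroup !cardsT card_ext pnatM => ->; rewrite pnatX pnat_id.
Qed.

Lemma GI_ext (H : finGroupType) (t : H -> H) k : GI t -> GI (ext_aut t (k := k)).
Proof.
move=> tGI; elim: k => [//|k [sM [A gA sA]]]; split=> [[x a] [y b]|].
  by rewrite /= /ext_inv /=; congr pair; rewrite ?sM// invMg Fp_mulgC.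
pose i1 (x : ext H k) : ext H k.+1 := (x, 1).
pose i2 (a : 'F_p) : ext H k.+1 := (1, a).
have i1M : {morph i1 : x y / x * y} by move=> x y; congr pair; rewrite mulg1.
have i2M : {morph i2 : x y / x * y} by move=> x y; congr pair; rewrite mulg1.
exists ([set i1 x | x in A] :|: [set i2 a | a : 'F_p]); last first.
  move=> _ /setUP[/imsetP[x xA ->]|/imsetP[a _ ->]]; congr pair => /=.
  - exact: sA.
  - by rewrite invg1; exact: (gmorph1 sM).
apply/setP => -[x a]; rewrite inE.
set B := _ :|: _; have -> : (x, a) = i1 x * i2 a by congr pair; rewrite ?mulg1 ?mul1g.
rewrite groupM//; last by apply/mem_gen/setUP; right; exact: imset_f.
have gE : group_set [set y | i1 y \in <<B>>].
  apply/group_setP; split; first by rewrite inE (gmorph1 i1M) group1.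
  by move=> y z; rewrite !inE i1M; exact: groupM.
have : <<A>> \subset Group gE.
  rewrite gen_subG; apply/subsetP => y yA; rewrite inE.
  by apply/mem_gen/setUP; left; exact: imset_f.
by rewrite gA => /subsetP/(_ x); rewrite !inE; apply.
Qed.

Definition Vp (d : nat) : finGroupType := ext trivial_group d.
Definition Vp_inv (d : nat) : Vp d -> Vp d := ext_aut (H := trivial_group) id (k := d).

Lemma Vp_invE d (v : Vp d) : Vp_inv v = v^-1.
Proof.
elim: d v => [|d IHd] v; first by case: v.
by case: v => v a; rewrite /Vp_inv /= /ext_inv /=; congr pair; exact: IHd.
Qed.

Lemma nhom_trivial : nhom p trivial_group = 1%N.
Proof.
rewrite /nhom; apply/eqP/cards1P; exists [ffun=> 1]; apply/setP => f; rewrite !inE.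
apply/is_morP/eqP => [fM|-> x y]; last by rewrite !ffunE mulg1.
by apply/ffunP => -[]; rewrite ffunE (gmorph1 fM : f tt = 1).
Qed.

Lemma nhom_Vp d : nhom p (Vp d) = (p ^ d)%N.
Proof. by rewrite nhom_extk nhom_trivial muln1. Qed.

Lemma pgroup_Vp d : p.-group [set: Vp d].
Proof. by apply: pgroup_ext; rewrite /pgroup cardsT card_unit. Qed.

Lemma frat_Vp d : frat p (Vp d) = 1.
Proof.
elim: d => [|d IHd]; apply/setP => x.
  apply/fratP/set1gP => [_|-> h hM]; first by case: x.
  exact: gmorph1.
apply/idP/set1gP => [/fratP fx|->]; last by rewrite group1.
case: x fx => v a fx; congr pair; last first.
  by apply: (fx (fun y => y.2)).
apply/set1gP; rewrite -IHd; apply/fratP => h hM.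
by apply: (fx (fun y => h y.1)) => y z; rewrite -hM.
Qed.

(** When [nhom p P] is p^d, the product is the order of GL_d(F_p). *)
Lemma nsur_Vp (P : finGroupType) (s : P -> P) d : negates p s ->
  nsur s (@Vp_inv d) = (\prod_(i < d) (nhom p P - p ^ i))%N.
Proof.
move=> sN; rewrite nsur_extk// nhom_trivial.
have -> : nsur s (id : trivial_group -> trivial_group) = 1%N.
  apply/eqP/cards1P; exists [ffun=> tt]; apply/setP => f; rewrite !inE.
  have -> : f = [ffun=> tt] by apply/ffunP => x; rewrite ffunE; case: (f x).
  rewrite eqxx is_mor_ffun is_surj_ffun is_equiv_ffun; apply/and3P; split.
  - exact/is_morP.
  - by apply/is_surjP => -[]; exists 1.
  - exact/is_equivP.
by rewrite mul1n; apply: eq_bigr => i _; rewrite muln1.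
Qed.

Lemma GI_Vp d : GI (@Vp_inv d).
Proof.
apply: GI_ext; split=> //; exists [set: trivial_group]; last by move=> [].
exact: (genGid [set: trivial_group]%G).
Qed.

Section FreeCount.
Variables (d : nat) (Q : finGroupType) (x : 'I_d -> Q) (s : Q -> Q).
Hypotheses (gx : <<[set x i | i : 'I_d]>> = [set: Q]) (sM : {morph s : y z / y * z}).
Hypotheses (sx : forall i, s (x i) = (x i)^-1) (hQ : nhom p Q = (p ^ d)%N).

(** Q plays the role of Q_c(F_d), which has this universal property for the p-groups H with P_c(H) =
    1 ([model_free]). *)
Definition free_for (H : finGroupType) : Prop :=
  forall y : 'I_d -> H, exists2 f : Q -> H, {morph f : a b / a * b} & forall i, f (x i) = y i.

Definition gens (H : finGroupType) (y : 'I_d -> H) := <<[set y i | i : 'I_d]>> == [set: H].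

Lemma free_GI : GI s.
Proof. by split=> //; exists [set x i | i : 'I_d] => // _ /imsetP[i _ ->]. Qed.

Lemma morphic_gens (K H : finGroupType) (f : K -> H) (y : 'I_d -> K) :
  {morph f : a b / a * b} -> gens y -> is_surj f = gens (f \o y).
Proof.
move=> fM gy.
have fM' : {in [set: K] &, {morph f : a b / a * b}} by move=> a b _ _; exact: fM.
pose phi := Morphism fM'.
have imE : <<[set f (y i) | i : 'I_d]>> = phi @* [set: K].
  have -> : phi @* [set: K] = phi @* <<[set y i | i : 'I_d]>> by rewrite (eqP gy).
  rewrite morphim_gen ?subsetT//; congr <<_>>.
  rewrite morphimEsub ?subsetT// -imset_comp; exact: eq_imset.
rewrite /gens /comp imE; apply/is_surjP/eqP => [fS|fE h].
  apply/setP => h; rewrite inE; have [k <-] := fS h.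
  by apply/morphimP; exists k; rewrite ?inE.
have : h \in phi @* [set: K] by rewrite fE inE.
by case/morphimP => k _ _ ->; exists k.
Qed.

(** A morphism amounts to the images of the generators; it is equivariant exactly when t inverts
    these images, and onto exactly when they generate H. *)
Lemma nsur_free (H : finGroupType) (t : H -> H) : {morph t : a b / a * b} -> free_for H ->
  nsur s t = #|[set y : {ffun 'I_d -> H} | gens y && [forall i, t (y i) == (y i)^-1]]|.
Proof.
move=> tM frH.
rewrite /nsur -(card_in_imset (f := fun f : {ffun Q -> H} => [ffun i => f (x i)])).
  apply: eq_card => y; rewrite [RHS]inE; apply/imsetP/andP => [[f + ->]|[gy /forallP ty]].
    rewrite inE => /and3P[/is_morP fM fS /is_equivP fs]; split.
      move: fS; rewrite (morphic_gens fM (y := x)) ?/gens ?gx// => /eqP gE; rewrite -gE.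
      by apply/eqP; congr <<_>>; apply: eq_imset => i; rewrite ffunE.
    by apply/forallP => i; rewrite !ffunE -fs sx (gmorphV fM).
  have [f fM fx] := frH y; exists (finfun f); last by apply/ffunP => i; rewrite !ffunE fx.
  rewrite inE is_mor_ffun is_surj_ffun is_equiv_ffun; apply/and3P; split.
  - exact/is_morP.
  - rewrite (morphic_gens fM (y := x)) ?/gens ?gx//.
    by rewrite -(eqP gy); apply/eqP; congr <<_>>; apply: eq_imset => i; rewrite /= fx.
  - apply/is_equivP; apply: (gen_mor_eq gx) => [a b|a b|_ /imsetP[i _ ->]].
    + by rewrite sM fM.
    + by rewrite fM tM.
    + by rewrite sx (gmorphV fM) fx (eqP (ty i)).
move=> f g; rewrite !inE => /and3P[/is_morP fM _ _] /and3P[/is_morP gM _ _] /ffunP fg.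
apply/ffunP; apply: (gen_mor_eq gx) => // _ /imsetP[i _ ->].
by have := fg i; rewrite !ffunE.
Qed.

Hypothesis p_odd : odd p.

(* A surjection [q : H -> Vp d] exists by counting and every character of [H]
   factors through it, so that [y] generates [H] iff [q \o y] generates [Vp d]
   and the kernel of [q] is the Frattini subgroup. *)
Lemma nsur_free_count (H : finGroupType) (t : H -> H) :
  p.-group [set: H] -> GI t -> nhom p H = (p ^ d)%N -> free_for H -> free_for (Vp d) ->
  nsur s t = ((\prod_(i < d) (p ^ d - p ^ i)) * #|invd t (frat p H)| ^ d)%N.
Proof.
move=> pH tGI hH frH frV.
have tN : negates p t := GI_negates tGI; have tM := GI_morph tGI.
have : (0 < nsur t (@Vp_inv d))%N.
  rewrite nsur_Vp// hH prodn_gt0// => i.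
  by rewrite subn_gt0 ltn_exp2l// prime_gt1.
move=> /card_gt0P[q]; rewrite inE => /and3P[/is_morP qM /is_surjP qS /is_equivP qt].
have charq (h : H -> 'F_p) : {morph h : a b / a * b} ->
    exists2 k : Vp d -> 'F_p, {morph k : a b / a * b} & forall y, h y = k (q y).
  move=> hM.
  have E : [set [ffun y => k (q y)] | k : {ffun Vp d -> 'F_p} in homs p (Vp d)] = homs p H.
    apply/eqP; rewrite eqEcard; apply/andP; split.
      apply/subsetP => _ /imsetP[k + ->]; rewrite !inE is_mor_ffun => /is_morP kM.
      by apply/is_morP => a b; rewrite qM kM.
    rewrite card_imset; first by rewrite -/(nhom p H) -/(nhom p (Vp d)) hH nhom_Vp.
    move=> k k' /ffunP kk; apply/ffunP => v; have [y <-] := qS v.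
    by have := kk y; rewrite !ffunE.
  have : finfun h \in homs p H by rewrite inE is_mor_ffun; exact/is_morP.
  rewrite -E => /imsetP[k]; rewrite inE => /is_morP kM /ffunP hk.
  by exists k => // y; have := hk y; rewrite !ffunE.
have kerq y : (q y == 1) = (y \in frat p H).
  apply/eqP/fratP => [qy h hM|fy].
    by have [k kM ->] := charq h hM; rewrite qy; exact: gmorph1.
  apply/set1gP; rewrite -(frat_Vp d); apply/fratP => h hM.
  by apply: (fy (fun z => h (q z))) => a b; rewrite qM hM.
have gensq (y : {ffun 'I_d -> H}) : gens y = gens (q \o y).
  apply/idP/idP => gy.
    by rewrite -(morphic_gens qM gy); apply/is_surjP.
  apply: contraT => ngy.
  have LP : <<[set y i | i : 'I_d]>> \proper [set: H] by rewrite properEneq subsetT andbT.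
  have [h [hM [z hz] hL]] := proper_hom p_prime pH LP.
  have [k kM hk] := charq h hM.
  have : k =1 (fun=> 1).
    apply: (gen_mor_eq (eqP gy) kM); first by move=> a b; rewrite mulg1.
    by move=> _ /imsetP[i _ ->]; rewrite /= -hk hL//; apply/mem_gen/imset_f.
  by move=> k1; rewrite hk k1 eqxx in hz.
have fib v : #|[set y in invd t [set: H] | q y == v]| = #|invd t (frat p H)|.
  have [y0 qy0] := qS v.
  have := @inverted_fiber p p_prime H t p_odd pH tM (GI_invol tGI) [set: H]%G (Vp d) q y0 (@Vp_inv d) qM qt.
  rewrite inE Vp_invE qy0 => -> //; last by move=> z _; rewrite inE.
  by apply: eq_card => y; rewrite inE kerq !inE /= andbC.
rewrite (nsur_free tM frH).
(* The order of GL_d(F_p) is read as a number of surjections Q -> [Vp d], so that [nsur_free] turns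
   it into the number of generating tuples of [Vp d]. *)
have <- : nsur s (@Vp_inv d) = (\prod_(i < d) (p ^ d - p ^ i))%N.
  by rewrite nsur_Vp ?hQ//; exact: (GI_negates free_GI).
rewrite (nsur_free _ frV); last exact: GI_morph (GI_Vp d).
have -> : [set y : {ffun 'I_d -> Vp d} | gens y && [forall i, Vp_inv (y i) == (y i)^-1]]
        = [set y : {ffun 'I_d -> Vp d} | gens y].
  apply/setP => y; rewrite !inE andb_idr// => _.
  by apply/forallP => i; rewrite Vp_invE.
rewrite -sum_nat_const -sum1dep_card.
(* The tuples above a given generating tuple v form a product of d fibres of q, all of the size
   given by [fib]. *)
rewrite (partition_big (fun y : {ffun 'I_d -> H} => [ffun i => q (y i)])
  (mem [set v : {ffun 'I_d -> Vp d} | gens v])) /=; last first.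
  move=> y /andP[gy _]; rewrite inE /gens; move: gy; rewrite gensq /gens => /eqP <-.
  by apply/eqP; congr <<_>>; apply: eq_imset => i; rewrite ffunE.
apply: eq_bigr => v; rewrite inE => gv; rewrite sum1dep_card.
have -> : #|[set y : {ffun 'I_d -> H} | gens y && [forall i, t (y i) == (y i)^-1] &
             [ffun i => q (y i)] == v]| =
  #|family (fun i : 'I_d => mem [set y in invd t [set: H] | q y == v i])|.
  apply: eq_card => y; rewrite !inE; apply/andP/familyP => [[/andP[_ /forallP ty] /eqP <-] i|fy].
    by rewrite !inE ty ffunE eqxx.
  have qy i : q (y i) = v i by have := fy i; rewrite !inE => /andP[_ /eqP].
  split; last by apply/eqP/ffunP => i; rewrite ffunE.
  apply/andP; split; last by apply/forallP => i; have := fy i; rewrite !inE => /andP[].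
  rewrite gensq /gens -(eqP gv); apply/eqP; congr <<_>>; apply: eq_imset => i.
  by rewrite /= qy.
rewrite card_family foldrE big_map big_enum /= (eq_bigr (fun=> #|invd t (frat p H)|)).
  by rewrite prod_nat_const card_ord.
by move=> i _; exact: fib.
Qed.

End FreeCount.

Section ImageMeasure.
Variables (Q H : finGroupType) (s : Q -> Q) (t : H -> H) (f : Q -> H).
Hypotheses (p_odd : odd p) (pQ : p.-group [set: Q]) (pH : p.-group [set: H]).
Hypotheses (sM : {morph s : a b / a * b}) (sK : involutive s).
Hypotheses (fM : {morph f : a b / a * b}) (ft : forall a, f (s a) = t (f a)).
Hypothesis fratS : forall h, h \in frat p H -> exists2 a, a \in frat p Q & f a = h.

(** The map f sends the inverted Frattini elements of Q onto those of H, with fibres of equal size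
    by [inverted_fiber]. In other words it carries the uniform measure to the uniform measure. *)
Lemma invd_frat_card :
  (#|invd t (frat p H)| * #|[set a in invd s (frat p Q) | f a == 1%g]|)%N = #|invd s (frat p Q)|.
Proof.
have fratf a : a \in frat p Q -> f a \in frat p H.
  move=> /fratP fa; apply/fratP => h hM.
  by apply: (fa (fun y => h (f y))) => y z; rewrite fM hM.
rewrite -sum_nat_const -[RHS]sum1_card.
rewrite [RHS](partition_big f (mem (invd t (frat p H)))) /=; last first.
  move=> a; rewrite !inE => /andP[fa /eqP sa]; move: (fratf a).
  by rewrite !inE => ->//; rewrite -ft sa (gmorphV fM) eqxx.
apply: eq_bigr => h; rewrite inE => /andP[/fratS[a fa <-] /eqP ta].
have := @inverted_fiber p p_prime Q s p_odd pQ sM sK (frat_group p Q) H f a t fM ft fa.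
move=> <- //; first by rewrite sum1dep_card; apply: eq_card => b; rewrite !inE.
move=> b /fratP fb; apply/fratP => h' h'M.
by apply: (fb (fun y => h' (s y))) => y z; rewrite sM h'M.
Qed.

End ImageMeasure.

End Counting.

(** * Burnside's basis theorem, by counting characters *)

Section Rank.
Variable p : nat.
Hypothesis p_prime : prime p.

Lemma nhom_surj (P H : finGroupType) (f : P -> H) :
  {morph f : x y / x * y} -> (forall y, exists x, f x = y) -> (nhom p H <= nhom p P)%N.
Proof.
move=> fM fS; rewrite /nhom.
rewrite -(@card_in_imset _ _ (fun h : {ffun H -> 'F_p} => [ffun y => h (f y)]) (homs p H)).
  apply: subset_leq_card; apply/subsetP => _ /imsetP[h /[!inE] /is_morP hM ->].
  by rewrite is_mor_ffun; apply/is_morP => x y; rewrite fM hM.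
move=> h h' _ _ /ffunP E; apply/ffunP => y; have [x <-] := fS y.
by have := E x; rewrite !ffunE.
Qed.

Lemma nsur_gt0_nhom (P H : finGroupType) (s : P -> P) (t : H -> H) :
  (0 < nsur s t)%N -> (nhom p H <= nhom p P)%N.
Proof.
by case/card_gt0P => f; rewrite inE => /and3P[/is_morP fM /is_surjP fS _]; exact: nhom_surj fM fS.
Qed.

Variable P : finGroupType.
Hypothesis pP : p.-group [set: P].

Let kill (K : {set P}) := [set h in homs p P | [forall x in K, h x == 1]].

(** Take x outside the kernel of a nontrivial character h0 that kills K. Multiplying by the p powers
    of h0 the characters that kill both x and K gives distinct characters killing K, as their values
    at x show. *)
Let kill_step (K : {group P}) : K :!=: [set: P] ->
  exists x, (#|kill <<x |: K>>| * p <= #|kill K|)%N.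
Proof.
move=> KP; have [|h0 [h0M [x h0x] h0K]] := @proper_hom p p_prime P K pP.
  by rewrite properE subsetT /= subTset.
exists x; pose sh (ha : {ffun P -> 'F_p} * 'F_p) : {ffun P -> 'F_p} :=
  [ffun y => ha.1 y * h0 y ^+ (ha.2 : nat)].
have h0X (a : 'F_p) : h0 x ^+ (a : nat) = (h0 x * a)%R.
  by rewrite Fp_expgE -GRing.mulr_natr natr_Zp.
rewrite -[X in (_ * X <= _)%N](card_Fp p_prime) -cardsT -cardsX.
rewrite -(@card_in_imset _ _ sh); first apply: subset_leq_card.
  apply/subsetP => _ /imsetP[[h a] /[!inE] /= /andP[/andP[/is_morP hM /forall_inP hK] _] ->].
  rewrite is_mor_ffun; apply/andP; split.
    apply/is_morP => u v /=; rewrite hM h0M expgMn; last exact: Fp_mulgC.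
    by rewrite !mulgA -[h u * _ * _]mulgA [h v * _]Fp_mulgC mulgA.
  apply/forall_inP => y yK; rewrite ffunE /= h0K// expg1n mulg1; apply: hK.
  by apply/mem_gen; rewrite inE yK orbT.
move=> [h a] [h' a'] /[!inE] /= /andP[/andP[/is_morP hM /forall_inP hK] _].
move=> /andP[/andP[/is_morP h'M /forall_inP h'K] _] /ffunP E.
have xK : x \in <<x |: K>> by apply/mem_gen; rewrite !inE eqxx.
have := E x; rewrite !ffunE /= (eqP (hK _ xK)) (eqP (h'K _ xK)) !mul1g => ea.
have aa' : a = a'.
  by apply: (GRing.mulfI (h0x : h0 x != 0%R)); rewrite -!h0X.
rewrite aa' in E *; congr (_, _); apply/ffunP => y.
by have := E y; rewrite !ffunE /=; exact: mulIg.
Qed.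

(** Each added generator divides by at least p the number of characters killing the subgroup. After
    d steps only the trivial one can be left, and by [proper_hom] the subgroup is then
    everything. *)
Lemma nhom_gens d : nhom p P = (p ^ d)%N ->
  exists s : seq P, (size s <= d)%N /\ <<[set x in s]>> = [set: P].
Proof.
move=> hP; have H i : exists s : seq P, (size s <= i)%N /\
    (<<[set x in s]>> = [set: P] \/ (#|kill <<[set x in s]>>| * p ^ i <= nhom p P)%N).
  elim: i => [|i [s [si [sP|sk]]]].
  - exists [::]; split=> //; right; rewrite expn0 muln1; apply: subset_leq_card.
    by apply/subsetP => h; rewrite inE => /andP[].
  - by exists s; split; [exact: leqW|left].
  - have [sP|nsP] := eqVneq <<[set x in s]>> [set: P].
      by exists s; split; [exact: leqW|left].
    have [x xk] := @kill_step <<[set x in s]>>%G nsP.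
    exists (x :: s); split=> //; right; rewrite expnS mulnA.
    have -> : <<[set y in x :: s]>> = <<x |: <<[set y in s]>> >>.
      by rewrite set_cons -[LHS]joingE -[RHS]joingE joing_idr.
    by apply: leq_trans sk; rewrite leq_mul2r xk orbT.
have [s [sd [sP|sk]]] := H d; first by exists s.
exists s; split=> //; apply/eqP; apply: contraT => nsP.
have [|h [hM [x hx] hK]] := @proper_hom p p_prime P <<[set x in s]>>%G pP.
  by rewrite properE subsetT /= subTset.
have : (1 < #|kill <<[set x in s]>>|)%N.
  apply/card_gt1P; exists (finfun h), (finfun (fun=> 1)); split.
  - rewrite !inE is_mor_ffun; apply/andP; split; first exact/is_morP.
    by apply/forall_inP => y /hK; rewrite ffunE => ->.
  - rewrite !inE is_mor_ffun; apply/andP; split; first by apply/is_morP => u v; rewrite mulg1.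
    by apply/forall_inP => y _; rewrite ffunE.
  - by apply: contraNneq hx => /ffunP/(_ x); rewrite !ffunE => ->.
have pd : (0 < p ^ d)%N by rewrite expn_gt0 prime_gt0.
by move: sk; rewrite hP; nia.
Qed.

End Rank.

From mathcomp Require Import generic_quotient finmap.
From mathcomp Require Import all_classical all_reals all_analysis.
From mathcomp Require Import measurable_realfun.

Import numFieldNormedType.Exports.
Local Open Scope classical_set_scope.
Local Open Scope group_scope.

(** * Profinite groups *)

Section MorphSubgroup.
Variables (G H : groupType) (f : G -> H).
Hypothesis fM : {morph f : x y / x * y}.

Lemma is_subgroup_preimage (K : set H) : is_subgroup K -> is_subgroup (f @^-1` K).
Proof.
move=> [K1 KM KV]; split => [|x y|x] /=; rewrite ?(gmorph1 fM) ?fM ?(gmorphV fM)//.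
  exact: KM.
exact: KV.
Qed.

Lemma is_subgroup_image (K : set G) : is_subgroup K -> is_subgroup (f @` K).
Proof.
move=> [K1 KM KV]; split => [|_ _ [x Kx <-] [y Ky <-]|_ [x Kx <-]].
- by exists 1; rewrite ?(gmorph1 fM).
- by exists (x * y); rewrite ?fM//; exact: KM.
- by exists x^-1; rewrite ?(gmorphV fM)//; exact: KV.
Qed.

Lemma conj_stable_preimage (K : set H) : conj_stable K -> conj_stable (f @^-1` K).
Proof. by move=> cK x g /= Kx; rewrite /= (gmorphJ fM); exact: cK. Qed.

End MorphSubgroup.

Lemma is_subgroup1 (G : groupType) : is_subgroup [set (1 : G)].
Proof. by split=> [|x y /= -> ->|x /= ->]; rewrite ?mulg1 ?invg1. Qed.

Lemma conj_stable1 (G : groupType) : conj_stable [set (1 : G)].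
Proof. by move=> x g /= ->; rewrite conj1g. Qed.

Section ProfiniteBase.

(* In a compact Hausdorff space the intersection of the clopen neighbourhoods
   of a point is connected, hence equal to its component. *)
Lemma compact_tdisc_zero_dimensional (T : topologicalType) :
  hausdorff_space T -> compact [set: T] -> totally_disconnected [set: T] ->
  zero_dimensional T.
Proof.
move=> hT cT dT x y xy.
pose E := [set C : set T | clopen C /\ C x].
pose Q := \bigcap_(C in E) C.
have Qx : Q x by move=> C [].
suff cQ : connected Q.
  have : ~ Q y.
    move=> Qy; have : connected_component setT x y by exists Q.
    by rewrite dT// => yx; rewrite yx eqxx in xy.
  by move=> /existsNP[C /not_implyP[[opC Cx] nCy]]; exists C.
have Qcl : closed Q by apply: closed_bigI => C [[]].
move=> B [b Bb] [W oW BW] [K cK BK].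
have cB : closed B by rewrite BK; exact: closedI.
have nB : set_nbhs B (~` (Q `&` ~` W)).
  apply/set_nbhsP; exists (~` (Q `&` ~` W)); split=> //.
    by rewrite openC; apply: closedI => //; rewrite closedC.
  by move=> z; rewrite BW => -[_ Wz] [].
have [U /set_nbhsP[V [oV BV VU]] clU] := compact_normal hT cT cB nB.
have QUB : Q `&` closure U `<=` B.
  move=> z [Qz Uz]; rewrite BW; split=> //.
  by apply: contrapT => nWz; exact: (clU z Uz).
pose K' := closure U `&` ~` V.
have cK' : closed K' by apply: closedI; [exact: closed_closure|rewrite closedC].
(* Otherwise the traces on K' of the clopen neighbourhoods of x form a proper filter, and a cluster
   point of it lies in both Q and K', against QUB. *)
have [C EC CK'] : exists2 C, E C & C `&` K' = set0.
  apply: contrapT => nC.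
  have : compact K' by apply: (subclosed_compact _ cT).
  pose FF0 := filter_from E (fun C => C `&` K').
  have FF : ProperFilter FF0.
    apply: filter_from_proper; last first.
      by move=> C EC; apply/set0P/eqP => C0; apply: nC; exists C.
    apply: filter_from_filter; first by exists setT; split=> //; exact: clopenT.
    move=> C1 C2 [k1 x1] [k2 x2]; exists (C1 `&` C2).
      by split=> //; exact: clopenI.
    by move=> z [[? ?] ?].
  move=> /(_ _ FF)[]; first by exists setT; [split=> //; exact: clopenT|move=> z []].
  move=> z [K'z zF]; have Qz : Q z.
    move=> C EC; have [[opC cC] Cx] := EC; apply: cC => N nN.
    have FC : FF0 C by exists C => // t [].
    by have [t [Ct Nt]] := zF _ _ FC nN; exists t.
  case: K'z => Uz; apply; apply: BV; exact: QUB.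
have VclU : V `<=` closure U by move=> z /VU; exact: subset_closure.
have [Cco Cx] := EC; have [opC cC] := Cco.
have clCV : clopen (C `&` V).
  split; first exact: openI.
  suff -> : C `&` V = C `&` closure U by apply: closedI => //; exact: closed_closure.
  apply/seteqP; split=> z [Cz Vz]; split=> //; first exact: VclU.
  apply: contrapT => nVz; have : (C `&` K') z by split.
  by rewrite CK'.
(* If V contains x, then C meets V in a clopen neighbourhood of x, which contains Q, so Q = B. If
   not, the complement of that clopen set is a neighbourhood of x that misses the point b of Q. *)
have [Vx|nVx] := pselect (V x).
  have QCV : Q `<=` C `&` V by move=> z; apply; split.
  apply/seteqP; split=> z; first by rewrite BW => -[].
  by move=> Qz; apply: QUB; split=> //; have [_ /VclU] := QCV z Qz.
exfalso; have : (~` (C `&` V)) b.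
  have Qb : Q b by move: Bb; rewrite BW => -[].
  by apply: Qb; split; [exact: clopenC|move=> []].
by apply; split; [move: Bb; rewrite BW => -[Qb _]; exact: Qb|exact: BV].
Qed.

Lemma mulgl_continuous (G : topologicalGroupType) (x : G) : continuous (fun y => x * y).
Proof. by apply/continuousP => A; exact: translate_open. Qed.

Lemma open_subgroup_closed (G : topologicalGroupType) (H : set G) :
  is_subgroup H -> open H -> closed H.
Proof.
move=> [H1 HM HV] oH x /(_ ((fun y => x^-1 * y) @^-1` H)).
case.
  apply: open_nbhs_nbhs; split; first exact: translate_open.
  by rewrite /= mulVg.
move=> y [Hy /= Hxy]; have := HM _ _ Hy (HV _ Hxy).
by rewrite invMg invgK mulgA mulgV mul1g.
Qed.

Lemma subgroup_nbhs_open (G : topologicalGroupType) (H : set G) :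
  is_subgroup H -> nbhs 1 H -> open H.
Proof.
move=> [H1 HM HV] nH; rewrite openE => x Hx; rewrite /interior.
have : nbhs x ((fun y => x^-1 * y) @^-1` H).
  by apply: (@mulgl_continuous G x^-1 x); rewrite mulVg.
apply: filterS => y /= Hy.
by have := HM _ _ Hx Hy; rewrite mulgA mulgV mul1g.
Qed.

(* The elements all of whose conjugates preserve a clopen neighbourhood of 1
   under right translation form a normal subgroup, open by the tube lemma. *)
Lemma profinite_base (G : topologicalGroupType) (U : set G) :
  compact [set: G] -> hausdorff_space G -> totally_disconnected [set: G] ->
  nbhs 1 U -> exists N : normalSubgroup G, open N /\ N `<=` U.
Proof.
move=> cG hG dG nU.
have zG := compact_tdisc_zero_dimensional hG cG dG.
have [C [C1 [opC cC]] CU] : filter_from [set D : set G | D 1 /\ clopen D] id U.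
  exact: (zero_dimensional_cvg (x := 1) hG zG cG).
pose S := [set g : G | forall x k, C k -> C (k * g ^ x)].
pose N := [set g | S g /\ S g^-1].
have SM a b : S a -> S b -> S (a * b).
  by move=> Sa Sb x k Ck; rewrite conjMg mulgA; apply: Sb; exact: Sa.
have SJ a b : S a -> S (a ^ b) by move=> Sa x k Ck; rewrite -conjgM; exact: Sa.
have sN : is_subgroup N.
  split=> [|x y [? ?] [? ?]|x []]; last by split; rewrite ?invgK.
    by split=> x k Ck; rewrite ?invg1 conj1g mulg1.
  by split; rewrite ?invMg; exact: SM.
have nN : conj_stable N by move=> x g [? ?]; split; rewrite -?conjVg; exact: SJ.
exists (NormalSubgroup sN nN); split; last first.
  by move=> g [/(_ 1 1 C1) + _]; rewrite conjg1 mul1g => /CU.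
apply: subgroup_nbhs_open => //=.
have nS : nbhs 1 S.
  have cCc : compact C by exact: (subclosed_compact cC cG).
  have /compact_near_coveringP K1 := compact_setX cG cCc.
  suff : \forall g \near (1 : G), [set: G] `*` C `<=` (fun xk => C (xk.2 * g ^ xk.1)).
    by apply: filterS => g Pg x k Ck; exact: (Pg (x, k)).
  apply: K1 => -[x k] [_ /= Ck].
  pose h := fun q : (G * G) * G => q.1.2 * q.2 ^ q.1.1.
  have ch : continuous h.
    move=> q; rewrite /h /conjg.
    apply: (@continuous_comp _ _ _ (fun q : (G * G) * G => (q.1.2, q.1.1^-1 * (q.2 * q.1.1)))
             (fun z : G * G => z.1 * z.2)); last exact: mulg_continuous.
    have c11 : {for q, continuous (fun q : (G * G) * G => q.1.1)}.
      by apply: (continuous_comp (f := fst) (g := fst)); exact: cvg_fst.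
    apply: cvg_pair; first by apply: (continuous_comp (f := fst) (g := snd)); [exact: cvg_fst|exact: cvg_snd].
    apply: (@continuous_comp _ _ _ (fun q : (G * G) * G => (q.1.1^-1, (q.2 * q.1.1)))
             (fun z : G * G => z.1 * z.2)); last exact: mulg_continuous.
    apply: cvg_pair.
      by apply: (continuous_comp c11); exact: invg_continuous.
    apply: (@continuous_comp _ _ _ (fun q : (G * G) * G => (q.2, q.1.1))
             (fun z : G * G => z.1 * z.2)); last exact: mulg_continuous.
    by apply: cvg_pair => //; exact: cvg_snd.
  have : nbhs (((x, k), 1) : (G * G) * G) (h @^-1` C).
    apply: ch; apply: open_nbhs_nbhs; split=> //.
    by rewrite /h /= conj1g mulg1.
  by apply: filterS => -[].
apply: filterI => //.
have /(_ S) := @invg_continuous G 1; rewrite invg1 => /(_ nS).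
by apply: filterS.
Qed.

End ProfiniteBase.

(** * Lower p-central series and finite models *)

Section TransportGroup.
Variables (Q : groupType) (n : nat) (f : Q -> 'I_n) (g : 'I_n -> Q).
Hypotheses (fK : cancel f g) (gK : cancel g f).

(** An alias indexed by the bijection, so that the transported group structure does not clash with
    another one on ['I_n]. *)
Definition transport_group of cancel f g & cancel g f : Type := 'I_n.
Local Notation T := (transport_group fK gK).
HB.instance Definition _ := Finite.copy T 'I_n.

Let tmul (x y : T) : T := f (g x * g y).
Let tone : T := f 1.
Let tinv (x : T) : T := f (g x)^-1.
Let tmulA : associative tmul.
Proof. by move=> x y z; rewrite /tmul !fK mulgA. Qed.
Let tmul1 : left_id tone tmul.
Proof. by move=> x; rewrite /tmul /tone fK mul1g gK. Qed.
Let tmulr1 : right_id tone tmul.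
Proof. by move=> x; rewrite /tmul /tone fK mulg1 gK. Qed.
Let tmulV : left_inverse tone tinv tmul.
Proof. by move=> x; rewrite /tmul /tinv fK mulVg. Qed.
Let tmulrV : right_inverse tone tinv tmul.
Proof. by move=> x; rewrite /tmul /tinv fK mulgV. Qed.
HB.instance Definition _ := isGroup.Build T tmulA tmul1 tmulr1 tmulV tmulrV.

Lemma transport_finGroup : exists (P : finGroupType) (e : Q -> P),
  {morph e : x y / x * y} /\ bijective e.
Proof.
exists T, f; split; last by exists g.
by move=> x y; rewrite {2}/mul /= /tmul !fK.
Qed.

End TransportGroup.

Lemma finite_groupType (Q : groupType) : finite_set [set: Q] ->
  exists (P : finGroupType) (e : Q -> P), {morph e : x y / x * y} /\ bijective e.
Proof.
move=> /finite_setP[n /card_set_bijP[h hb]].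
have hn x : (h x < n)%N by have [hf _ _] := hb; exact: (hf x).
pose f x : 'I_n := Ordinal (hn x).
have [hf hi hs] := hb.
have sg (i : 'I_n) : exists x, f x = i.
  by have [x _ hx] := hs i (ltn_ord i); exists x; apply: val_inj.
pose g i := projT1 (cid (sg i)).
have gK : cancel g f by move=> i; rewrite /g; case: cid.
have fK : cancel f g.
  by move=> x; apply: hi; rewrite ?inE//; have := gK (f x) => /(congr1 val).
exact: transport_finGroup fK gK.
Qed.

Lemma is_subgroup_expg (G : groupType) (K : set G) x n :
  is_subgroup K -> K x -> K (x ^+ n).
Proof.
move=> [K1 KM _] Kx; elim: n => [|n IHn]; first by rewrite expg0.
by rewrite expgS; exact: KM.
Qed.

Lemma commgM (G : groupType) (x y z : G) : [~ x, y * z] = [~ x, z] * [~ x, y] ^ z.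
Proof. by rewrite /commg /conjg invMg !mulgA !mulgK. Qed.

(** A finite quotient G/N given by a map onto an abstract [finGroupType], to which the theory of
    finite groups applies directly, unlike the quotient type. *)
Definition finmodel (G : groupType) (N : set G) (P : finGroupType) (f : G -> P) : Prop :=
  [/\ {morph f : x y / x * y}, (forall y, exists x, f x = y) & forall x, f x = 1 <-> N x].

Lemma finmodel_eq (G : groupType) (N : set G) (P : finGroupType) (f : G -> P) :
  finmodel N f -> forall x y, f x = f y <-> N (x^-1 * y).
Proof.
move=> [fM fS fK] x y; rewrite -fK fM (gmorphV fM); split=> [->|]; first by rewrite mulVg.
by move=> /(congr1 (fun z => f x * z)); rewrite mulgA mulgV mul1g mulg1.
Qed.

Lemma quotient_finmodel (G : topologicalGroupType) (N : normalSubgroup G) :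
  finite_set [set: quotientGroup N] -> exists (P : finGroupType) (f : G -> P), finmodel N f.
Proof.
move=> /finite_groupType[P [e [eM [e' eK e'K]]]]; exists P, (e \o qpi N); split.
- by move=> x y /=; rewrite qpiM eM.
- by move=> y; exists (qrepr (e' y)); rewrite /= qreprK e'K.
- move=> x /=; rewrite -{1}(gmorph1 eM); have N1 : qpi N 1 = 1 by exact: (gmorph1 (@qpiM G N)).
  split.
    by move=> /(can_inj eK)/esym; rewrite -N1 => /qpi_eqP; rewrite invg1 mul1g.
  by move=> Nx; congr e; rewrite -N1; apply/esym/qpi_eqP; rewrite invg1 mul1g.
Qed.

Lemma finmodel_continuous (G : topologicalGroupType) (N : set G) (P : finGroupType)
    (f : G -> P) : finmodel N f -> open N -> continuous (f : G -> discrete_topology P).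
Proof.
move=> fm oN; apply/continuousP => A _; rewrite openE => x Ax; rewrite /interior.
have : open ((fun y => x^-1 * y) @^-1` N) by exact: translate_open.
rewrite openE => /(_ x); rewrite /= mulVg; case: (fm) => fM _ fK.
have N1 : N 1 by apply/fK; exact: gmorph1.
move=> /(_ N1); apply: filterS => y /= Ny.
by have [_ /(_ Ny) <-] := finmodel_eq fm x y.
Qed.

Lemma discrete_continuous (X : discreteTopologicalType) (U : topologicalType)
  (f : X -> U) : continuous f.
Proof. by apply/continuousP => A _; exact: discrete_open. Qed.

Lemma continuous_ker_closed (G : topologicalGroupType) (P : groupType) (f : G -> P) :
  continuous (f : G -> discrete_topology P) -> closed [set x | f x = 1].
Proof.
move=> /continuous_closedP cf; have -> : [set x | f x = 1] = f @^-1` [set 1] by [].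
by apply: cf; exact: discrete_closed.
Qed.

Lemma card_eq_finset (U : Type) (A : set U) (T : finType) (B : {set T}) (f : T -> U) :
  (forall b, b \in B -> A (f b)) -> {in B &, injective f} ->
  (forall a, A a -> exists2 b, b \in B & f b = a) -> (A #= `I_#|B|)%card.
Proof.
move=> fB fI fS.
have -> : A = (fun i : 'I_#|B| => f (enum_val i)) @` [set: 'I_#|B|].
  apply/seteqP; split=> [a /fS[b Bb <-]|_ [i _ <-]]; last exact/fB/enum_valP.
  by exists (enum_rank_in Bb b) => //; rewrite enum_rankK_in.
apply: card_eq_trans (_ : [set: 'I_#|B|] #= `I_#|B|)%card; last by rewrite card_eq_sym; exact: card_II.
apply: inj_card_eq => i j _ _ /fI; rewrite !enum_valP => /(_ isT isT).
exact: enum_val_inj.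
Qed.

Lemma finmodel_card (G : topologicalGroupType) (N : normalSubgroup G)
  (P : finGroupType) (f : G -> P) : finmodel N f -> ([set: quotientGroup N] #= `I_#|P|)%card.
Proof.
move=> fm; have [fM fS fK] := fm.
pose g y := qpi N (projT1 (cid (fS y))).
have gE x : g (f x) = qpi N x.
  by rewrite /g; case: cid => z /= /(finmodel_eq fm)/qpi_eqP.
rewrite -cardsT; apply: (@card_eq_finset _ _ _ _ g) => //.
  move=> y z _ _; have [x <-] := fS y; have [x' <-] := fS z; rewrite !gE.
  by move=> /qpi_eqP/(finmodel_eq fm).
by move=> a _; exists (f (qrepr a)); rewrite ?inE// gE qreprK.
Qed.

Section Models.
Variable p : nat.

Lemma pgroup_card (P : finGroupType) k : prime p -> #|P| = (p ^ k)%N ->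
  p.-group [set: P]%SET.
Proof. by move=> pp Pk; rewrite /pgroup cardsT Pk pnatX pnat_id. Qed.

Lemma pro_p_finmodel (G : topologicalGroupType) (N : normalSubgroup G) :
  prime p -> pro_p_group p G -> open N ->
  exists (P : finGroupType) (f : G -> P), finmodel N f /\ p.-group [set: P]%SET.
Proof.
move=> pp [_ _ _ ind] /ind[k Nk].
have [|P [f fm]] := @quotient_finmodel G N; first by apply/finite_setP; exists (p ^ k)%N.
exists P, f; split=> //; apply: (@pgroup_card _ k) => //.
apply/card_eq_II; apply: (card_eq_trans _ Nk).
by rewrite card_eq_sym (finmodel_card fm).
Qed.

Lemma discrete_pro_p (P : finGroupType) : p.-group [set: P]%SET ->
  pro_p_group p (discrete_topology P).
Proof.
move=> pP; split.
- exact/finite_compact/finite_finset.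
- exact: discrete_hausdorff.
- exact/zero_dimension_totally_disconnected/discrete_zero_dimension.
- move=> N _; have [|Q [f fm]] := @quotient_finmodel _ N.
    have -> : [set: quotientGroup N] = qpi N @` [set: discrete_topology P].
      by apply/seteqP; split=> // a _; exists (qrepr a); rewrite ?qreprK.
    by apply: finite_image; exact: finite_finset.
  exists (logn p #|Q|); have [fM fS fK] := fm.
  have -> : (p ^ logn p #|Q|)%N = #|Q|; last exact: (finmodel_card fm).
  have fM' : {in [set: P]%SET &, {morph (f : P -> Q) : x y / x * y}} by move=> x y _ _; exact: fM.
  pose phi := Morphism fM'.
  have := morphim_pgroup phi pP.
  have -> : (phi @* [set: P]%G)%g = [set: Q]%SET.
    apply/setP => y; rewrite inE; have [x <-] := fS y.
    by apply/morphimP; exists x; rewrite ?inE.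
  by move=> /card_pgroup; rewrite cardsT => <-.
Qed.

Section LowerP.
Implicit Types G H : topologicalGroupType.

Lemma closed_gen_min G (S K : set G) : is_subgroup K -> closed K -> S `<=` K ->
  closed_gen S `<=` K.
Proof. by move=> sK cK; apply: smallest_sub. Qed.

Lemma sub_closed_gen G (S : set G) : S `<=` closed_gen S.
Proof. exact: sub_gen_smallest. Qed.

Lemma lower_p_closed G n : closed (lower_p_set (G := G) p n).
Proof. by case: n => [|n]; [exact: closedT|exact: closed_gen_closed]. Qed.

Lemma lower_p_gens_sub G n :
  lower_p_gens p (lower_p_set (G := G) p n) `<=` lower_p_set p n.+1.
Proof. exact: sub_closed_gen. Qed.

Lemma lower_pS G n : lower_p_set (G := G) p n.+1 `<=` lower_p_set p n.
Proof.
have [_ NM NV] := @lower_p_set_subgroup G p n.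
have [/= N1 _ _] := @lower_p_set_subgroup G p n.
apply: closed_gen_min; [exact: lower_p_set_subgroup|exact: lower_p_closed|].
move=> z [[x [y [Py ->]]]|[y Py ->]].
  rewrite commgEr; apply: NM => //.
  by apply: lower_p_set_conj; exact: NV.
by apply: is_subgroup_expg => //; exact: lower_p_set_subgroup.
Qed.

Lemma lower_p_le G m n : (m <= n)%N ->
  lower_p_set (G := G) p n `<=` lower_p_set p m.
Proof.
move=> /subnK <-; elim: (n - m)%N => [//|k IHk].
by rewrite addSn; apply: subset_trans IHk; exact: lower_pS.
Qed.

Lemma lower_p_hom G H (f : G -> H) n : continuous_hom f ->
  forall x, lower_p_set p n x -> lower_p_set p n (f x).
Proof.
move=> [fM fc]; elim: n => [//|n IHn]; apply: closed_gen_min.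
- by apply: is_subgroup_preimage => //; exact: lower_p_set_subgroup.
- by move/continuous_closedP : fc => fc; apply: fc; exact: lower_p_closed.
- move=> z [[x [y [Py ->]]]|[y Py ->]]; apply: lower_p_gens_sub.
    by left; exists (f x), (f y); split; [exact: IHn|rewrite (gmorphR fM)].
  by right; exists (f y); [exact: IHn|rewrite (gmorphX fM)].
Qed.

(** In the discrete group H the image of P_(n+1)(G) is a closed subgroup, and by induction it
    contains the generators of P_(n+1)(H). *)
Lemma lower_p_lift G (H : groupType) (f : G -> H) n :
  {morph f : x y / x * y} -> (forall y, exists x, f x = y) ->
  forall y : discrete_topology H, lower_p_set p n y ->
  exists2 x, lower_p_set p n x & f x = y.
Proof.
move=> fM fS; elim: n => [y _|n IHn]; first by have [x <-] := fS y; exists x.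
apply: closed_gen_min; last first.
- move=> z [[x [y [/IHn[y' Py' <-] ->]]]|[y /IHn[y' Py' <-] ->]].
    have [x' <-] := fS x; exists [~ x', y']; last by rewrite (gmorphR fM).
    by apply: lower_p_gens_sub; left; exists x', y'.
  exists (y' ^+ p); last by rewrite (gmorphX fM).
  by apply: lower_p_gens_sub; right; exists y'.
- exact: discrete_closed.
- have := @is_subgroup_image G (discrete_topology H) f fM _ (@lower_p_set_subgroup G p n.+1).
  exact.
Qed.

Lemma model_lower_p1 G (P : finGroupType) (f : G -> P) n :
  finmodel (lower_p_set p n) f ->
  forall y : discrete_topology P, lower_p_set p n y -> y = 1.
Proof.
by move=> [fM fS fK] y /(lower_p_lift fM fS)[x /fK + <-].
Qed.

(** The universal property of Q_n(G) among discrete groups with trivial P_n: a continuous morphism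
    to such a group kills P_n(G). *)
Lemma model_factor G (H : groupType) (P : finGroupType) (f : G -> P) (g : G -> H) n :
  finmodel (lower_p_set p n) f -> {morph g : x y / x * y} ->
  continuous (g : G -> discrete_topology H) ->
  (forall y : discrete_topology H, lower_p_set p n y -> y = 1) ->
  exists2 h : P -> H, {morph h : x y / x * y} & forall x, g x = h (f x).
Proof.
move=> fm gM gc H1; have [fM fS fK] := fm.
pose h y := g (projT1 (cid (fS y))).
have hE x : g x = h (f x).
  rewrite /h; case: cid => z /= /(finmodel_eq fm) /= Nzx.
  have : g (z^-1 * x) = 1 by apply: H1; apply: lower_p_hom Nzx; split.
  by rewrite gM (gmorphV gM) => /(congr1 (fun t => g z * t)); rewrite mulgA mulgV mul1g mulg1.
exists h => // x y; have [x' <-] := fS x; have [y' <-] := fS y.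
by rewrite -fM -!hE gM.
Qed.

(** An upper bound n for the index of N in K; it is multiplicative along chains and asks for no
    quotient. *)
Definition cosets (G : groupType) (n : nat) (K N : set G) : Prop :=
  exists t : nat -> G, forall x, K x -> exists i, (i < n)%N /\ N ((t i)^-1 * x).

Lemma cosets_trans (G : groupType) m n (K L N : set G) :
  cosets m K L -> cosets n L N -> cosets (m * n) K N.
Proof.
move=> [t tP] [u uP]; exists (fun k => t (k %/ n)%N * u (k %% n)%N).
move=> x /tP[i [im /uP[j [jn Nx]]]]; exists (i * n + j)%N; split.
  by case: (n) jn im => // n' jn im; nia.
have n0 : (0 < n)%N by exact: leq_ltn_trans jn.
by rewrite divnMDl// divn_small// addn0 modnMDl modn_small// invMg -mulgA.
Qed.

Lemma cosets_closed G n (K N : set G) : is_subgroup K -> N `<=` K -> closed N ->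
  cosets n K N -> closed K.
Proof.
move=> [K1 KM KV] NK cN [t tP].
have -> : K = \bigcup_(i in [set i | (i < n)%N /\ K (t i)]) ((fun x => (t i)^-1 * x) @^-1` N).
  apply/seteqP; split=> [x Kx|x [i [_ Ki] /= /NK Nx]].
    have [i [im Nx]] := tP x Kx; exists i => //; split=> //.
    have := KM _ _ Kx (KV _ (NK _ Nx)); rewrite invMg invgK mulgA mulgV mul1g; exact.
  by have := KM _ _ Ki Nx; rewrite mulgA mulgV mul1g.
apply: closed_bigcup.
  by apply: sub_finite_set (finite_II n) => i [].
move=> i _; have /continuous_closedP c := @mulgl_continuous G (t i)^-1; exact: c.
Qed.

Lemma cosets_open G n (N : set G) : is_subgroup N -> closed N ->
  cosets n setT N -> open N.
Proof.
move=> [N1 NM NV] cN [t tP].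
have -> : N = ~` \bigcup_(i in [set i | (i < n)%N /\ ~ N (t i)])
    ((fun x => (t i)^-1 * x) @^-1` N).
  apply/seteqP; split=> [x Nx [i [_ nN] /= Ntx]|x nx].
    apply: nN; have := NM _ _ Nx (NV _ Ntx); rewrite invMg invgK mulgA mulgV mul1g; exact.
  have [i [im Nx]] := tP x I; have [Nt|nNt] := pselect (N (t i)).
    by have := NM _ _ Nt Nx; rewrite mulgA mulgV mul1g.
  by exfalso; apply: nx; exists i.
rewrite openC; apply: closed_bigcup.
  by apply: sub_finite_set (finite_II n) => i [].
move=> i _; have /continuous_closedP c := @mulgl_continuous G (t i)^-1; exact: c.
Qed.

Lemma commg_central (G : groupType) (a b u v : G) : (forall g, commute g a) ->
  (forall g, commute g b) -> [~ u * a, v * b] = [~ u, v].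
Proof.
move=> ca cb; rewrite /commg conjgM conjMg.
have cJ (g h : G) : commute g h -> h ^ g = h by move=> gh; rewrite /conjg -gh mulKg.
have cJ' (g h : G) : commute g h -> g ^ h = g by move=> gh; rewrite /conjg gh mulKg.
rewrite (cJ _ _ (ca v)) cJ'; last exact: cb.
by rewrite (ca u) (ca (u ^ v)) invMg !mulgA mulgVK.
Qed.

(** One adjoins the elements one at a time: modulo N each is central of exponent p, so the products
    of its powers with K form a subgroup covered by p cosets of K, hence closed. Here p is any
    positive integer; [pres_abelianization] takes a power of the prime. *)
Lemma cosets_central G (N : normalSubgroup G) (k : nat) (s : nat -> G) :
  closed (nsub N) -> (0 < p)%N ->
  (forall i, (i < k)%N -> (forall g, nsub N [~ g, s i]) /\ nsub N (s i ^+ p)) ->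
  exists K : set G, [/\ is_subgroup K, closed K, nsub N `<=` K,
    forall i, (i < k)%N -> K (s i) & cosets (p ^ k) K (nsub N)].
Proof.
move=> cN p0; elim: k => [|k IHk] sP.
  exists (nsub N); split=> //; first exact: nsub_subgroup.
  by exists (fun=> 1) => x Nx; exists 0%N; rewrite invg1 mul1g.
have [i /ltnW|K [sK cK NK Ks covK]] := IHk; first exact: sP.
have [sc sp] := sP k (ltnSn k); have [K1 KM KV] := sK.
set s0 := s k in sc sp *.
have KX x n : K x -> K (x ^+ n) by exact: is_subgroup_expg.
pose K' := [set x | exists n, K (s0 ^- n * x)].
have sXc n g : nsub N [~ g, s0 ^+ n].
  have [_ NM _] := nsub_subgroup N.
  elim: n => [|n IHn]; first by rewrite expg0 commg1; case: (nsub_subgroup N).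
  rewrite expgS commgM; apply: NM; [exact: IHn|exact: nsub_normal].
have K'E x : K' x -> exists n, (n < p)%N /\ K (s0 ^- n * x).
  move=> [n Kn]; exists (n %% p)%N; split; first exact: ltn_pmod.
  have -> : s0 ^- (n %% p) * x = (s0 ^+ p) ^+ (n %/ p) * (s0 ^- n * x).
    have -> : s0 ^+ n = (s0 ^+ p) ^+ (n %/ p) * s0 ^+ (n %% p).
      by rewrite -expgnA mulnC -expgnDr -divn_eq.
    rewrite invMg !mulgA; congr (_ * x).
    have cm : commute ((s0 ^+ p) ^+ (n %/ p)) (s0 ^- (n %% p)).
      by apply: commuteV; do !apply: commuteX; apply: commute_sym; do !apply: commuteX; exact: commute_refl.
    by rewrite cm mulgK.
  by apply: KM => //; apply: KX; exact: NK.
have cov' : cosets p K' K.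
  exists (fun n => s0 ^+ n) => x /K'E[n [np Kx]]; exists n; split=> //.
have K'M x y : K' x -> K' y -> K' (x * y).
  move=> [m Km] [n Kn].
  - exists (n + m)%N; rewrite expgnDr invMg.
    have -> : s0 ^- m * s0 ^- n * (x * y) =
      (s0 ^- m * x) * ([~ x, s0 ^+ n] * (s0 ^- n * y)).
      by rewrite /commg /conjg !mulgA !mulgK.
    by apply: (KM _ _ Km); apply: (KM _ _ _ Kn); exact/NK/sXc.
have sK' : is_subgroup K'.
  split=> [|//|x [m Km]].
  - by exists 0%N; rewrite expg0 invg1 mul1g.
  - have [n [np Kn]] := K'E x (ex_intro _ m Km).
    have -> : x^-1 = (s0 ^- n * x)^-1 * (s0 ^+ (p - n) * (s0 ^+ p)^-1).
      have -> : s0 ^+ p = s0 ^+ n * s0 ^+ (p - n) by rewrite -expgnDr subnKC// ltnW.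
      by rewrite !invMg invgK !mulgA mulgK mulgK.
    apply: (K'M _ _); first by exists 0%N; rewrite expg0 invg1 mul1g; exact: KV.
    apply: (K'M _ _); first by exists (p - n)%N; rewrite mulVg.
    by exists 0%N; rewrite expg0 invg1 mul1g; exact/KV/NK.
exists K'; split=> //.
- by apply: (cosets_closed sK' _ cK cov') => x Kx; exists 0%N; rewrite expg0 invg1 mul1g.
- by move=> x /NK Kx; exists 0%N; rewrite expg0 invg1 mul1g.
- move=> i; rewrite ltnS leq_eqVlt => /orP[/eqP ->|ik].
    by exists 1%N; rewrite expg1 mulVg.
  by exists 0%N; rewrite expg0 invg1 mul1g; exact: Ks.
- by rewrite expnS; exact: cosets_trans cov' covK.
Qed.

Definition gen_by G (d : nat) : Prop :=
  exists s : nat -> G, closed_gen [set s i | i in `I_d] = setT.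

(** The exponent counts elements generating one layer modulo the next: the d generators of G for the
    first layer, then, with B cosets so far, the B^2 commutators and B p-th powers of
    representatives. *)
Fixpoint lower_p_bound (d n : nat) : nat :=
  if n is m.+1 then
    lower_p_bound d m * p ^ (if m is 0 then d else (lower_p_bound d m ^ 2 + lower_p_bound d m))
  else 1.

(* Modulo P_(n+2) the generators of P_(n+1) are central of exponent p and only
   depend on the cosets modulo P_(n+1) of their arguments: finitely many suffice. *)
Lemma lower_p_cosets G d n : (0 < p)%N -> gen_by G d ->
  cosets (lower_p_bound d n) [set: G] (lower_p_set p n).
Proof.
move=> p0 [s sP]; elim: n => [|n IHn].
  by exists (fun=> 1) => x _; exists 0%N.
apply: (cosets_trans IHn).
case: n IHn => [|n] IHn.
  have [i _|K [sK cK NK Ks covK]] := @cosets_central G (lower_p G p 1) d s (lower_p_closed (n:=1)) p0.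
    split=> [g|]; apply: lower_p_gens_sub; first by left; exists g, (s i).
    by right; exists (s i).
  move: covK; have -> // : K = setT.
  apply/seteqP; split=> // x _; move: (I : [set: G] x); rewrite -sP.
  by apply: closed_gen_min => // _ [i ik <-]; exact: Ks.
have [t tP] := IHn; set B := lower_p_bound d n.+1 in t tP *.
(* The index k = i B + j codes the commutator of the representatives i and j; the last B indices
   code the p-th powers. *)
pose u k := if (k < B ^ 2)%N then [~ t (k %/ B)%N, t (k %% B)%N] else t (k - B ^ 2)%N ^+ p.
(* A commutator or power of representatives need not lie in P_(n+1); those outside are replaced by
   1. *)
pose v k := if pselect (lower_p_set p n.+1 (u k)) then u k else 1.
have [i _|K [sK cK NK Ks covK]] :=
    @cosets_central G (lower_p G p n.+2) (B ^ 2 + B) v (lower_p_closed (n:=n.+2)) p0.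
  have Pv : lower_p_set p n.+1 (v i).
    by rewrite /v; case: pselect => //= _; case: (@lower_p_set_subgroup G p n.+1).
  by split=> [g|]; apply: lower_p_gens_sub; [left; exists g, (v i)|right; exists (v i)].
have B0 : (0 < B)%N by have [i [+ _]] := tP 1 I; exact: leq_ltn_trans.
move: covK; suff PK : lower_p_set p n.+1 `<=` K.
  by move=> [w wP]; exists w => x /PK/wP.
have [K1 KM KV] := sK.
have [P1 PM PV] := @lower_p_set_subgroup G p n.+1.
have Pcen (g z : G) : lower_p_set p n.+1 z -> lower_p_set p n.+2 [~ g, z].
  by move=> Pz; apply: lower_p_gens_sub; left; exists g, z.
have Pexp (z : G) : lower_p_set p n.+1 z -> lower_p_set p n.+2 (z ^+ p).
  by move=> Pz; apply: lower_p_gens_sub; right; exists z.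
pose N := lower_p G p n.+2.
have qc g z : lower_p_set p n.+1 z -> commute (qpi N g) (qpi N z).
  move=> Pz; rewrite /commute -!qpiM; apply/qpi_eqP.
  have -> : (g * z)^-1 * (z * g) = [~ g, z]^-1 by rewrite invMg /commg /conjg !invMg !invgK !mulgA.
  by have [_ _] := nsub_subgroup N; apply; exact: Pcen.
have q1 z : nsub N z -> qpi N z = 1.
  move=> Nz; rewrite -(gmorph1 (@qpiM _ N)); apply/esym/qpi_eqP; by rewrite invg1 mul1g.
(* If w lies in P_(n+1), so does any [u i] congruent to it modulo P_(n+2), and then [v i] is
   [u i]. *)
have transfer w i : lower_p_set p n.+1 w -> (i < B ^ 2 + B)%N -> qpi N w = qpi N (u i) -> K w.
  move=> Pw iB wu; have Nwu : nsub N (w^-1 * u i) by apply/qpi_eqP.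
  have Pui : lower_p_set p n.+1 (u i).
    have := PM _ _ Pw (@lower_pS G n.+1 _ Nwu); rewrite mulgA mulgV mul1g; exact.
  have := Ks i iB; rewrite /v; case: pselect => [/= hu Ku|//].
  have := KM _ _ Ku (KV _ (NK _ Nwu)); rewrite invMg invgK mulgA mulgV mul1g; exact.
apply: closed_gen_min => // z zg.
have Pz : lower_p_set p n.+1 z by exact: lower_p_gens_sub.
case: zg => [[x [y [Py zE]]]|[y Py zE]]; have [j [jB Ny]] := tP y I.
  have [i [iB Nx]] := tP x I; apply: (transfer _ (i * B + j)%N Pz).
    by nia.
  have iBj : (i * B + j < B ^ 2)%N by nia.
  rewrite /u iBj divnMDl// divn_small// addn0 modnMDl modn_small//.
  have xE : x = t i * ((t i)^-1 * x) by rewrite mulgA mulgV mul1g.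
  have yE : y = t j * ((t j)^-1 * y) by rewrite mulgA mulgV mul1g.
  have qcen a : lower_p_set p n.+1 a -> forall g, commute g (qpi N a).
    by move=> Pa g; rewrite -(qreprK g); exact: qc.
  rewrite zE {1}xE {1}yE !(gmorphR (@qpiM _ N)) !(@qpiM _ N (t _)).
  by rewrite commg_central //; exact: qcen.
apply: (transfer _ (B ^ 2 + j)%N Pz); first by rewrite ltn_add2l.
rewrite /u ltnNge leq_addr /= addKn zE.
have -> : y = t j * ((t j)^-1 * y) by rewrite mulgA mulgV mul1g.
rewrite !(gmorphX (@qpiM _ N)) qpiM expgMn; last exact: qc.
by rewrite -(gmorphX (@qpiM _ N) (_ * y)) (q1 _ (Pexp _ Ny)) mulg1.
Qed.

End LowerP.

End Models.

(** * The lower p-central series of a finite p-group *)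

Section FiniteLowerP.
Variable p : nat.
Hypothesis p_prime : prime p.

Lemma group_set_of (P : finGroupType) (K : set P) : is_subgroup K ->
  group_set [set x : P | `[< K x >]]%SET.
Proof.
move=> [K1 KM _]; apply/group_setP; split; first by rewrite inE; apply/asboolP.
by move=> x y; rewrite !inE => Kx Ky; exact: KM.
Qed.

Lemma is_subgroup_group (P : finGroupType) (B : {group P}) : is_subgroup [set x : P | x \in B].
Proof.
split => /= [|x y|x]; first exact: group1.
  exact: groupM.
by rewrite groupV.
Qed.

Lemma lower_p_discrete_step (P : finGroupType) n (B : {group P}) :
  (forall x y : P, lower_p_set (G := discrete_topology P) p n y -> [~ x, y] \in B) ->
  (forall y : P, lower_p_set (G := discrete_topology P) p n y -> y ^+ p \in B) ->
  forall y : P, lower_p_set (G := discrete_topology P) p n.+1 y -> y \in B.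
Proof.
move=> BR BX; apply: (@closed_gen_min (discrete_topology P) _ [set x | x \in B]).
- exact: is_subgroup_group.
- exact: discrete_closed.
- by move=> z [[x [y [Py ->]]]|[y Py ->]]; [exact: BR|exact: BX].
Qed.

(** A nontrivial term has a subgroup M of index p that is normal in P. Modulo M this term has order
    p and is normal in a p-group, hence central, so the next term lies in M. *)
Lemma lower_p_finite (P : finGroupType) : p.-group [set: P]%SET ->
  exists c, forall y : discrete_topology P, lower_p_set p c y -> y = 1.
Proof.
move=> pP; pose L n := Group (group_set_of (@lower_p_set_subgroup (discrete_topology P) p n)).
have inL n (x : P) : x \in L n <-> lower_p_set (G := discrete_topology P) p n x.
  by rewrite inE; split => /asboolP.
(* Either the series has already reached 1, or each of the n steps has decreased the order. *)
suff H n : (#|L n| <= 1)%N \/ (#|L n| + n <= #|P|.+1)%N.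
  exists #|P|.+1 => y /inL yL; have L1 : (0 < #|L #|P|.+1|)%N by exact: cardG_gt0.
  have [L1'|] := H #|P|.+1; last by rewrite addnC; lia.
  have /card_le1_trivg LE : (#|L #|P|.+1| <= 1)%N by [].
  by move: yL; rewrite LE => /set1gP.
elim: n => [|n [IHn|IHn]].
- by right; rewrite addn0 (leq_trans (max_card _))// leqnSn.
- left; apply: leq_trans IHn; apply: subset_leq_card; apply/fintype.subsetP => x.
  by move=> /inL /lower_pS /inL.
- have [L1|L1] := leqP #|L n| 1.
    left; apply: leq_trans L1; apply: subset_leq_card; apply/fintype.subsetP => x.
    by move=> /inL /lower_pS /inL.
  have nL : fingroup.normal (L n) [set: P]%G.
    rewrite /fingroup.normal finset.subsetT /=; apply/normsP => g _; apply/setP => x.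
    rewrite mem_conjg; apply/idP/idP => /inL Lx; apply/inL.
      by have := @lower_p_set_conj (discrete_topology P) p n _ g Lx; rewrite conjgKV.
    exact: (@lower_p_set_conj (discrete_topology P) p n _ g^-1 Lx).
  have pL : p.-group (L n) by exact: pgroupS (finset.subsetT _) pP.
  have lL : (0 < logn p #|L n|)%N.
    by move: L1; rewrite {1}(card_pgroup pL); case: (logn p _).
  have [M [ML nM cM]] := normal_pgroup pP nL (leq_pred (logn p #|L n|)).
  have LM : #|L n| = (p * #|M|)%N by rewrite cM -expnS prednK// -card_pgroup.
  have M0 := cardG_gt0 M.
  right; suff : (#|L n.+1| <= #|M|)%N by have := prime_gt1 p_prime; nia.
  apply: subset_leq_card; apply/fintype.subsetP => x /inL.
  have [_ nMP] := andP nM.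
  have inN y : y \in 'N(M) by apply: (fintype.subsetP nMP); rewrite inE.
  have cLM : #|L n / M| = p.
    rewrite card_quotient; last by apply/fintype.subsetP => y _.
    by rewrite -divgS// LM mulnK.
  have LZ : L n / M \subset 'Z([set: P]%G / M).
    have pQ : p.-group ([set: P]%G / M) by exact: quotient_pgroup.
    have := @meet_center_nil _ ([set: P]%G / M)%G (L n / M)%G (pgroup_nil pQ).
    move=> /(_ (quotient_normal _ nL)); rewrite -cardG_gt1 cLM prime_gt1// => /(_ isT).
    by apply: prime_meetG; rewrite cLM.
  apply: lower_p_discrete_step => [z y /inL yL|y /inL yL].
    apply: coset_idr (inN _) _; rewrite morphR ?inN//; apply/eqP/commgP.
    have : coset M y \in 'Z([set: P]%G / M) by apply: (fintype.subsetP LZ); exact: mem_quotient.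
    move=> /centerP[_ H]; apply/commute_sym/H; apply: mem_quotient; exact: finset.in_setT.
  apply: coset_idr (inN _) _; rewrite morphX ?inN//.
  by apply/eqP; rewrite -order_dvdn -cLM; apply: order_dvdG; exact: mem_quotient.
Qed.

(** Characters to F_p kill commutators and p-th powers. Conversely every maximal subgroup is the
    kernel of a character, so the common kernel lies in the usual Frattini subgroup, which
    commutators and p-th powers generate. *)
Lemma fratE (P : finGroupType) : p.-group [set: P]%SET ->
  forall y : P, lower_p_set (G := discrete_topology P) p 1 y <-> y \in frat p P.
Proof.
move=> pP y; split.
  apply: (@lower_p_discrete_step P 0 (frat_group p P)) => [x z _|z _]; apply/fratP => h hM.
    by rewrite (gmorphR hM); apply/eqP/commgP; exact: Fp_mulgC.
  by rewrite (gmorphX hM) Fp_expgE -GRing.mulr_natr pchar_Fp_0// GRing.mulr0.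
move=> /fratP yf.
pose L := Group (group_set_of (@lower_p_set_subgroup (discrete_topology P) p 1)).
have inL (x : P) : x \in L <-> lower_p_set (G := discrete_topology P) p 1 x.
  by rewrite inE; split => /asboolP.
apply/inL; have : 'Phi([set: P]%SET) \subset L.
  rewrite (Phi_joing pP) join_subG; apply/andP; split.
    rewrite gen_subG; apply/fintype.subsetP => _ /imset2P[a b _ _ ->].
    apply/inL; apply: (@lower_p_gens_sub p (discrete_topology P) 0).
    by left; exists a, b.
  rewrite (MhoE 1 pP) gen_subG; apply/fintype.subsetP => _ /imsetP[a _ ->].
  apply/inL; apply: (@lower_p_gens_sub p (discrete_topology P) 0).
  by right; exists a; rewrite ?expn1.
move=> /fintype.subsetP; apply; apply/bigcapP => M /predU1P[->|mM]; first by rewrite inE.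
have MP := maxgroupp mM.
have [h [hM [x hx] hL]] := proper_hom p_prime pP MP.
have kE : group_set [set z | h z == 1]%SET.
  apply/group_setP; split; first by rewrite inE (gmorph1 hM).
  by move=> a b; rewrite !inE hM => /eqP -> /eqP ->; rewrite mulg1.
have MK : M \subset Group kE by apply/fintype.subsetP => z zM; rewrite inE hL.
have [_ maxM] := maxgroupP mM.
have := maxM (Group kE) _ MK => /= <-; first by rewrite inE yf.
rewrite fintype.properE finset.subsetT /=; apply/fintype.subsetPn; exists x; first by rewrite inE.
by rewrite inE.
Qed.

Lemma Fp_lower_p1 (y : discrete_topology 'F_p) : lower_p_set p 1 y -> y = 1.
Proof.
have pF : p.-group [set: 'F_p]%SET by rewrite /pgroup cardsT card_Fp// pnat_id.
by move=> /(fratE pF)/fratP; apply.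
Qed.

Lemma frat_lift (Q H : finGroupType) (f : Q -> H) :
  p.-group [set: Q]%SET -> p.-group [set: H]%SET ->
  {morph f : a b / a * b} -> (forall h, exists a, f a = h) ->
  forall h, h \in frat p H -> exists2 a, a \in frat p Q & f a = h.
Proof.
move=> pQ pH fM fS h /(fratE pH) hf.
have [a Pa fa] := @lower_p_lift p (discrete_topology Q) H f 1 fM fS h hf.
by exists a => //; apply/fratE.
Qed.

Lemma GI_automorphismP (H : finGroupType) (t : discrete_topology H -> discrete_topology H) :
  GI_automorphism t <-> GI (t : H -> H).
Proof.
split=> [[[[tM _] _] [S [gS tS]]]|tGI].
  split=> //; exists [set x : H | `[< S x >]]%SET; last by move=> x; rewrite inE => /asboolP/tS.
  apply/setP => x; rewrite [in RHS]inE; set B := <<_>>.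
  have : closed_gen S `<=` [set x | x \in B].
    apply: closed_gen_min.
    - exact: (@is_subgroup_group H <<_>>%G).
    - exact: discrete_closed.
    - by move=> z Sz; apply/mem_gen; rewrite inE; apply/asboolP.
  by rewrite gS => /(_ x I).
have [tM [A gA tA]] := tGI; have tK := GI_invol tGI.
have ct : continuous t by exact: discrete_continuous.
split; first by split; [split|exists t; split].
exists [set x | x \in A]; split=> //; apply/seteqP; split=> // x _.
have : <<A>> \subset Group (group_set_of (@closed_gen_subgroup (discrete_topology H) [set x | x \in A])).
  rewrite gen_subG; apply/fintype.subsetP => y yA; rewrite inE; apply/asboolP.
  exact: sub_closed_gen.
rewrite gA => /fintype.subsetP/(_ x); rewrite finset.in_setT => /(_ isT).
by rewrite inE => /asboolP.
Qed.

End FiniteLowerP.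

(** * Finite quotients of finitely generated pro-p groups *)

Section ProPModels.
Variable p : nat.
Hypothesis p_prime : prime p.
Implicit Types G : topologicalGroupType.

Lemma finitely_generated_gen_by G : finitely_generated G -> exists d, gen_by G d.
Proof.
move=> [S [/finite_seqP[r Sr] gS]]; exists (size r), (nth 1 r).
rewrite -gS; congr closed_gen; rewrite Sr; apply/seteqP; split=> [_ [i ir <-]|x /= xr].
  exact: mem_nth.
by exists (index x r); rewrite /= ?index_mem// nth_index.
Qed.

Lemma lower_p_open G d c : gen_by G d -> open (lower_p_set (G := G) p c).
Proof.
move=> gd; apply: (cosets_open _ _ (lower_p_cosets c (prime_gt0 p_prime) gd)).
- exact: lower_p_set_subgroup.
- exact: lower_p_closed.
Qed.

Lemma cosets_finite G n (N : normalSubgroup G) : cosets n setT (nsub N) ->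
  finite_set [set: quotientGroup N].
Proof.
move=> [t tP].
have -> : [set: quotientGroup N] = (fun i => qpi N (t i)) @` `I_n.
  apply/seteqP; split=> // a _; have [i [ni Ni]] := tP (qrepr a) I.
  by exists i => //; rewrite -[RHS]qreprK; apply/qpi_eqP.
apply: finite_image; exact: finite_II.
Qed.

Lemma lower_p_model G d c : gen_by G d -> pro_p_group p G ->
  exists (P : finGroupType) (f : G -> P),
    [/\ finmodel (lower_p_set p c) f, p.-group [set: P]%SET, 
        continuous (f : G -> discrete_topology P) & (#|P| <= lower_p_bound p d c)%N].
Proof.
move=> gd pG; have oL := lower_p_open c gd.
have [P [f [fm pP]]] := @pro_p_finmodel p G (lower_p G p c) p_prime pG oL.
exists P, f; split=> //; first exact: finmodel_continuous fm oL.
have [t tP] := lower_p_cosets c (prime_gt0 p_prime) gd.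
have [fM fS fK] := fm.
have sub : {subset [set: P]%SET <= [seq f (t i) | i <- iota 0 (lower_p_bound p d c)]}.
  move=> y _; have [x <-] := fS y; have [i [ib Li]] := tP x I.
  apply/mapP; exists i; first by rewrite mem_iota.
  by apply/esym/(finmodel_eq fm).
rewrite -cardsT cardE; apply: leq_trans (uniq_leq_size (enum_uniq _) _) _.
  by move=> y; rewrite mem_enum; exact: sub.
by rewrite size_map size_iota.
Qed.

(** The finite p-group G/N has a trivial term in its lower p-central series, and the series of G
    maps into that of G/N. *)
Lemma lower_p_small G (N : normalSubgroup G) : pro_p_group p G -> open N ->
  exists c, lower_p_set p c `<=` nsub N.
Proof.
move=> pG oN; have [P [f [fm pP]]] := pro_p_finmodel p_prime pG oN.
have [c cP] := lower_p_finite p_prime pP.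
exists c => x Lx; have [fM fS fK] := fm; apply/fK/cP.
have fc : continuous_hom (f : G -> discrete_topology P).
  by split=> //; exact: finmodel_continuous fm oN.
exact: (lower_p_hom fc).
Qed.

Lemma pro_p_separated G (C : set G) (x : G) : pro_p_group p G ->
  is_subgroup C -> closed C -> ~ C x ->
  exists N : normalSubgroup G, open N /\ forall n, nsub N n -> ~ C (x * n).
Proof.
move=> [cG hG dG _] sC cC nCx.
have nU : nbhs 1 ((fun y => x * y) @^-1` (~` C)).
  apply: (@mulgl_continuous G x); rewrite mulg1; apply: open_nbhs_nbhs; split=> //.
  by rewrite openC.
have [N [oN NU]] := profinite_base cG hG dG nU.
by exists N; split=> // n /NU.
Qed.

Lemma pro_p_lower_p1 G (x : G) : pro_p_group p G ->
  (forall c, lower_p_set p c x) -> x = 1.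
Proof.
move=> pG Lx; apply: contrapT => x1; have [cG hG dG _] := pG.
have c1 : closed [set (1 : G)] by apply: accessible_closed_set1; exact: hausdorff_accessible.
have [|N [oN Nx]] := @pro_p_separated G [set 1] x pG (is_subgroup1 G) c1 => //.
have [c cN] := lower_p_small pG oN; have [_ _ NV] := nsub_subgroup N.
apply: (Nx x^-1); last by rewrite mulgV.
exact/NV/cN.
Qed.

Lemma induced_GI G (s : G -> G) (P : finGroupType) (f : G -> P) c :
  GI_automorphism s -> finmodel (lower_p_set p c) f ->
  continuous (f : G -> discrete_topology P) ->
  exists2 t : P -> P, GI t & forall x, f (s x) = t (f x).
Proof.
move=> [[[sM sc] _] [S [gS sS]]] fm fc; have [fM fS fK] := fm.
have gM : {morph f \o s : x y / x * y} by move=> x y /=; rewrite sM fM.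
have gc : continuous (f \o s : G -> discrete_topology P).
  by move=> x; apply: continuous_comp; [exact: sc|exact: fc].
have [t tM tE] := model_factor fm gM gc (model_lower_p1 fm).
exists t => //; split=> //.
exists [set y : P | `[< exists2 x, S x & f x = y >]]%SET; last first.
  by move=> y; rewrite inE => /asboolP[x Sx <-]; rewrite -tE /= sS// (gmorphV fM).
apply/setP => y; rewrite [in RHS]inE; set B := <<_>>; have [x <-] := fS y.
have : closed_gen S `<=` f @^-1` [set y | y \in B].
  apply: closed_gen_min.
  - by apply: is_subgroup_preimage => //; exact: (@is_subgroup_group P <<_>>%G).
  - by move/continuous_closedP : fc; apply; exact: discrete_closed.
  - by move=> z Sz; apply/mem_gen; rewrite inE; apply/asboolP; exists z.
by rewrite gS => /(_ x I).
Qed.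

(** Morphisms to a group with trivial P_c factor through Q_c(G). This is the passage from the
    profinite count to the finite one. *)
Lemma Sur_sigma_model G (s : G -> G) (P : finGroupType) (f : G -> P) (s' : P -> P) c
    (H : finGroupType) (t : discrete_topology H -> discrete_topology H) :
  finmodel (lower_p_set p c) f -> continuous (f : G -> discrete_topology P) ->
  (forall x, f (s x) = s' (f x)) ->
  (forall y : discrete_topology H, lower_p_set p c y -> y = 1) ->
  (Sur_sigma s t #= `I_(nsur s' (t : H -> H)))%card.
Proof.
move=> fm fc fs H1; have [fM fS fK] := fm.
apply: (@card_eq_finset _ _ _ (sur s' (t : H -> H)) (fun h : {ffun P -> H} => (h \o f : G -> discrete_topology H))).
- move=> h; rewrite inE => /and3P[/is_morP hM /is_surjP hS /is_equivP hs]; split.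
  + split; first by move=> x y /=; rewrite fM hM.
    move=> x; apply: (@continuous_comp _ (discrete_topology P) (discrete_topology H)); first exact: fc.
    exact: discrete_continuous.
  + by move=> y; have [z <-] := hS y; have [x <-] := fS z; exists x.
  + by move=> x /=; rewrite fs hs.
- move=> h k _ _ hk; apply/ffunP => y; have [x <-] := fS y.
  by have := congr1 (fun g => g x) hk.
- move=> g [[gM gc] gS gs].
  have [h hM hE] := @model_factor p G H P f g c fm gM gc H1.
  exists (finfun h); last by apply/funext => x /=; rewrite ffunE hE.
  rewrite inE is_mor_ffun is_surj_ffun is_equiv_ffun; apply/and3P; split.
  + exact/is_morP.
  + by apply/is_surjP => y; have [x <-] := gS y; exists (f x); rewrite hE.
  + by apply/is_equivP => y; have [x <-] := fS y; rewrite -fs -!hE gs.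
Qed.

Lemma counting_card (R : realType) (T : choiceType) (A : set T) n :
  (A #= `I_n)%card -> counting A = n%:R%:E :> \bar R.
Proof.
move=> An; have fA : finite_set A by apply/finite_setP; exists n.
rewrite /counting asboolT//; congr (_%:E).
by rewrite (card_fset_set An).
Qed.

End ProPModels.

(** * Free pro-p groups *)

Section CyclicQuotient.
Variables (p n : nat).
Hypothesis p_prime : prime p.
Notation Zpn := 'Z_(p ^ n.+1).

Lemma expn_gt1 : (1 < p ^ n.+1)%N.
Proof. by rewrite -{1}(expn0 p) ltn_exp2l// prime_gt1. Qed.

Lemma Zpn_expg (a : Zpn) k : a ^+ k = (a *+ k)%R. Proof. by []. Qed.

Lemma Zpn_expg_pn (a : Zpn) : a ^+ (p ^ n.+1) = 1.
Proof. by rewrite Zpn_expg -GRing.mulr_natr pchar_Zp ?expn_gt1// GRing.mulr0. Qed.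

Lemma card_Zpn : #|{: Zpn}| = (p ^ n.+1)%N.
Proof. by rewrite card_ord Zp_cast// expn_gt1. Qed.

Lemma pgroup_Zpn : p.-group [set: Zpn]%SET.
Proof. exact: pgroup_card card_Zpn. Qed.

Lemma Zpn_gen (a : Zpn) : (1%R : Zpn) ^+ (a : nat) = a.
Proof. by rewrite Zpn_expg natr_Zp. Qed.

(* A non-unit of [Z/p^(n+1)] is killed by [p^n]; a unit generates. *)
Lemma Zpn_unitP (a : Zpn) : a ^+ (p ^ n) != 1 -> exists k, a ^+ k = 1%R.
Proof.
move=> a1; have aU : (a \is a GRing.unit)%R.
  rewrite -(natr_Zp a) unitZpE ?expn_gt1// coprime_pexpl//.
  rewrite prime_coprime//; apply: contra a1 => /dvdnP[m am].
  rewrite -(Zpn_gen a) am -expgnA -mulnA -expnS.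
  by rewrite mulnC expgnA Zpn_expg_pn expg1n.
exists (a^-1)%R; rewrite Zpn_expg -GRing.mulr_natr natr_Zp.
by rewrite GRing.mulrV.
Qed.

(** In the abelianization, an element whose order is the exponent p^e generates a direct factor.
    Projecting onto this factor gives a cyclic quotient of order p^e, which surjects onto Z/p^(n+1)
    because z forces e > n. *)
Lemma cyclic_quotient (P : finGroupType) (z : P) : p.-group [set: P]%SET ->
  z ^+ (p ^ n) \notin [set: P]%G^`(1) ->
  exists h : P -> Zpn, {morph h : x y / x * y} /\ forall y, exists x, h x = y.
Proof.
move=> pP nz; set D := [set: P]^`(1)%G in nz.
have nD : [set: P]%G \subset 'N(D) by exact: der_norm.
have inD x : x \in 'N(D) by apply: (fintype.subsetP nD); rewrite inE.
set B := ([set: P]%G / D)%G.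
have cB : abelian B by exact: der_abelian 0 _.
have inB x : coset D x \in B by exact: mem_quotient.
have [H HB] := abelian_type_subproof B; have [x ox] := HB cB.
move=> /dprodP[_ BE _ tI].
have {}BE : (<[x]> * H)%g = B by [].
have pB : p.-group B by exact: quotient_pgroup.
have [e eE] : exists e, exponent B = (p ^ e)%N.
  by exists (logn p (exponent B)); rewrite -p_part part_pnat_id// pnat_exponent.
have ne : (n.+1 <= e)%N.
  rewrite ltnNge; apply/negP => en; move/negP: nz; apply.
  rewrite -/D; apply: coset_idr (inD _) _; rewrite morphX ?inD//.
  have -> : (p ^ n)%N = (p ^ e * p ^ (n - e))%N by rewrite -expnD subnKC.
  by rewrite expgnA -eE expg_exponent ?inB// expg1n.
have HsB : H \subset B by rewrite -BE mulG_subr.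
have nHB : B \subset 'N(H) by apply: cents_norm; exact: (sub_abelian_cent cB).
have xB : x \in B by apply: (fintype.subsetP _ _ (cycle_id x)); rewrite -BE mulG_subl.
have qE : B / H = <[coset H x]>.
  by rewrite -quotient_cycle ?(fintype.subsetP nHB)// -BE quotientMidr.
have oq : #[coset H x] = (p ^ e)%N.
  have cBH : (#|<[x]>| * #|H|)%N = #|B| by rewrite -TI_cardMg// BE.
  rewrite orderE -qE card_quotient// -divgS// -cBH mulnK ?cardG_gt0//.
  by rewrite -eE -ox.
have dvd : #[1%R : Zpn] %| #[coset H x].
  rewrite oq order_dvdn; apply/eqP; rewrite -(subnKC ne) expnD expgnA.
  by rewrite Zpn_expg_pn expg1n.
pose phi := eltm_morphism dvd.
have inC y : coset H (coset D y) \in <[coset H x]> by rewrite -qE; apply: mem_quotient; exact: inB.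
exists (fun y => phi (coset H (coset D y))); split.
  move=> a b; rewrite morphM ?inD// morphM ?(fintype.subsetP nHB) ?inB// morphM ?inC//.
have [x' _ xE] : exists2 x', x' \in [set: P]%SET & x = coset D x'.
  by have /morphimP[x' _ x'P ->] := xB; exists x'.
move=> y; exists (x' ^+ (y : nat)).
rewrite morphX ?inD// morphX ?(fintype.subsetP nHB) ?inB//.
have -> : coset_morphism H (coset_morphism D x') = coset H x by rewrite xE.
by rewrite /phi /= eltmE Zpn_gen.
Qed.

End CyclicQuotient.

Section FreeProP.
Variables (p g : nat) (F : topologicalGroupType) (x : 'I_g -> F).
Hypotheses (p_prime : prime p) (F_free : free_pro_p p x).
Let pF : pro_p_group p F. Proof. by case: F_free. Qed.

Lemma free_hom (H : finGroupType) (y : 'I_g -> H) : p.-group [set: H]%SET ->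
  exists2 f : F -> H, continuous_hom (f : F -> discrete_topology H) &
    forall i, f (x i) = y i.
Proof.
move=> pH; have [_ /(_ (discrete_topology H) y (discrete_pro_p pH))] := F_free.
by move=> [f [[fc fx] _]]; exists f.
Qed.

Lemma free_hom_eq (H : finGroupType) (f f' : F -> H) : p.-group [set: H]%SET ->
  continuous_hom (f : F -> discrete_topology H) ->
  continuous_hom (f' : F -> discrete_topology H) ->
  (forall i, f (x i) = f' (x i)) -> f = f'.
Proof.
move=> pH fc fc' ff.
have [_ /(_ (discrete_topology H) (f' \o x) (discrete_pro_p pH))] := F_free.
by move=> [f0 [_ f0u]]; rewrite -(f0u f')// -(f0u f).
Qed.

(** If the closed subgroup generated by the x_i were proper, its image in some finite quotient would
    be proper and killed by a nontrivial character; this contradicts the uniqueness of the morphism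
    sending every x_i to 1. *)
Lemma free_generated : closed_gen [set x i | i in [set: 'I_g]] = setT.
Proof.
set C := closed_gen _; apply/seteqP; split=> // y _; apply: contrapT => nCy.
have sC : is_subgroup C by exact: closed_gen_subgroup.
have [C1 CM CV] := sC.
have [N [oN Ny]] := pro_p_separated pF sC (@closed_gen_closed _ _) nCy.
have [P [f [fm pP]]] := pro_p_finmodel p_prime pF oN.
have [fM fS fK] := fm; have fc := finmodel_continuous fm oN.
pose L := Group (group_set_of (is_subgroup_image fM sC)).
have nfy : f y \notin L.
  rewrite inE; apply/negP => /asboolP[z Cz /esym /(finmodel_eq fm) Nyz].
  by apply: (Ny _ Nyz); rewrite mulKVg.
have LP : (L \proper [set: P]%SET)%SET.
  rewrite fintype.properE finset.subsetT; apply/fintype.subsetPn.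
  by exists (f y) => //; rewrite inE.
have [h [hM [z hz] hL]] := proper_hom p_prime pP LP.
have pFp : p.-group [set: 'F_p]%SET by rewrite /pgroup cardsT card_Fp// pnat_id.
have : (fun z => h (f z)) = (fun=> 1).
  apply: (free_hom_eq pFp).
  - split; first by move=> a b; rewrite fM hM.
    move=> a; apply: (@continuous_comp _ (discrete_topology P) (discrete_topology 'F_p)); first exact: fc.
    exact: discrete_continuous.
  - by split; [move=> a b; rewrite mulg1|move=> a; exact: cvg_cst].
  - move=> i; apply: hL; rewrite inE; apply/asboolP; exists (x i) => //.
    by apply: sub_closed_gen; exists i.
have [w fw] := fS z.
by move=> /(congr1 (fun k => k w)); rewrite fw => h1; rewrite h1 eqxx in hz.
Qed.

Lemma free_gen_by : gen_by F g.
Proof.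
exists (fun k => if insub k is Some i then x i else 1); rewrite -free_generated.
congr closed_gen; apply/seteqP; split=> [_ [i /= ig <-]|_ [i _ <-]].
  by rewrite insubT; exists (Ordinal ig).
by exists (i : nat); rewrite /= ?ltn_ord// valK.
Qed.

Section FreeModel.
Variables (c : nat) (Q : finGroupType) (f : F -> Q).
Hypotheses (fm : finmodel (lower_p_set p c) f)
           (fc : continuous (f : F -> discrete_topology Q)).

Lemma gen_image (P : finGroupType) (h : F -> P) : {morph h : a b / a * b} ->
  continuous (h : F -> discrete_topology P) -> (forall y, exists z, h z = y) ->
  <<[set h (x i) | i : 'I_g]>> = [set: P]%SET.
Proof.
move=> hM hc hS; apply/setP => y; rewrite [in RHS]inE; set B := <<_>>.
have [z <-] := hS y.
have : closed_gen [set x i | i in [set: 'I_g]] `<=` h @^-1` [set y | y \in B].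
  apply: closed_gen_min.
  - by apply: is_subgroup_preimage => //; exact: (@is_subgroup_group P <<_>>%G).
  - by move/continuous_closedP : hc; apply; exact: discrete_closed.
  - by move=> _ [i _ <-]; apply/mem_gen; exact: imset_f.
by rewrite free_generated => /(_ z I).
Qed.

Lemma model_gen : <<[set f (x i) | i : 'I_g]>> = [set: Q]%SET.
Proof. by have [fM fS _] := fm; exact: gen_image. Qed.

Lemma model_free (H : finGroupType) : p.-group [set: H]%SET ->
  (forall y : discrete_topology H, lower_p_set p c y -> y = 1) ->
  free_for (f \o x) H.
Proof.
move=> pH H1 y; have [h [hM hc] hx] := free_hom y pH.
have [k kM kE] := model_factor fm hM hc H1.
by exists k => // i; rewrite -hx kE.
Qed.

(** As c > 0, all characters factor through Q, so they correspond to arbitrary values on the g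
    generators. *)
Lemma nhom_free_model : (0 < c)%N -> nhom p Q = (p ^ g)%N.
Proof.
move=> c0; have F1 (y : discrete_topology 'F_p) : lower_p_set p c y -> y = 1.
  by move=> Ly; apply: (Fp_lower_p1 p_prime); exact: lower_p_le Ly.
have pFp : p.-group [set: 'F_p]%SET by rewrite /pgroup cardsT card_Fp// pnat_id.
rewrite /nhom -(card_in_imset (f := fun h : {ffun Q -> 'F_p} => [ffun i => h (f (x i))])).
  rewrite (_ : imset _ _ = [set: {ffun 'I_g -> 'F_p}]%SET); first by rewrite cardsT card_ffun card_Fp// card_ord.
  apply/setP => y; rewrite [in RHS]inE; apply/imsetP.
  have [k kM kx] := model_free pFp F1 y.
  exists (finfun k); first by rewrite inE is_mor_ffun; exact/is_morP.
  by apply/ffunP => i; rewrite !ffunE; have := kx i.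
move=> h k; rewrite !inE => /is_morP hM /is_morP kM /ffunP hk; apply/ffunP.
apply: (gen_mor_eq model_gen) => // _ /imsetP[i _ ->].
by have := hk i; rewrite !ffunE.
Qed.

End FreeModel.

Section FreeSigma.
Variable s : F -> F.
Hypotheses (s_iso : top_group_iso s) (s_inv : forall i, s (x i) = (x i)^-1).

Lemma free_GI_automorphism : GI_automorphism s.
Proof.
split=> //; exists [set x i | i in [set: 'I_g]]; split; first exact: free_generated.
by move=> _ [i _ <-].
Qed.

Lemma GI_automorphism_invol (G : topologicalGroupType) (t : G -> G) :
  hausdorff_space G -> GI_automorphism t -> involutive t.
Proof.
move=> hG [[[tM tc] _] [S [gS tS]]] y.
have : closed_gen S `<=` [set y | (t (t y)) * y^-1 = 1].
  apply: closed_gen_min.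
  - split; first by rewrite /= !(gmorph1 tM) mulgV.
    + by move=> a b /divg1_eq ta /divg1_eq tb /=; rewrite !tM ta tb mulgV.
    + by move=> a /divg1_eq ta /=; rewrite !(gmorphV tM) ta mulgV.
  - have c1 : closed [set (1 : G)] by apply: accessible_closed_set1; exact: hausdorff_accessible.
    have ck : continuous (fun y => t (t y) * y^-1).
      move=> z; apply: (@continuous_comp _ _ _ (fun y => (t (t y), y^-1)) (fun z : G * G => z.1 * z.2)); last exact: mulg_continuous.
      apply: cvg_pair; last exact: invg_continuous.
      by apply: (@continuous_comp _ _ _ t t); exact: tc.
    by move/continuous_closedP : ck => /(_ _ c1).
  - by move=> z Sz /=; rewrite (tS z)// (gmorphV tM) (tS z)// invgK mulgV.
by rewrite gS => /(_ y I) /divg1_eq.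
Qed.

End FreeSigma.

End FreeProP.

(** * Presentations and cohomology *)

Section Twist.
Variables (p : nat) (P : finGroupType) (f : P -> P -> 'F_p).
Local Open Scope ring_scope.

Definition cocycle : Prop :=
  forall x y z, f y z - f (x * y)%g z + f x (y * z)%g - f x y = 0.

Lemma cocycle1l : cocycle -> forall z, f 1%g z = f 1%g 1%g.
Proof.
by move=> fc z; have /eqP := fc 1%g 1%g z; rewrite !mul1g GRing.subrr GRing.add0r GRing.subr_eq0 => /eqP.
Qed.

Lemma cocycle1r : cocycle -> forall z, f z 1%g = f 1%g 1%g.
Proof.
move=> fc z; have /eqP := fc z 1%g 1%g; rewrite !mulg1.
by rewrite GRing.addrK GRing.subr_eq0 => /eqP.
Qed.

(** The extension of P by F_p with factor set -f. With this sign the first coordinate, although not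
    a morphism, has coboundary f. *)
Definition twist of cocycle : Type := ('F_p * P)%type.
Hypothesis fc : cocycle.
Local Notation E := (twist fc).
HB.instance Definition _ := Finite.copy E ('F_p * P)%type.

Let emul (a b : E) : E := (a.1 + b.1 - f a.2 b.2, (a.2 * b.2)%g).
(** The cocycle is not normalized, hence the value f(1, 1) in the neutral element. *)
Let eone : E := (f 1%g 1%g, 1%g).
Let einv (a : E) : E := (f 1%g 1%g + f a.2 (a.2)^-1%g - a.1, (a.2)^-1%g).

Let emulA : associative emul.
Proof.
move=> [a u] [b v] [c w]; rewrite /emul /=; congr pair; last exact: mulgA.
have := fc u v w; set A := f v w; set B := f (u * v)%g w; set C := f u (v * w)%g.
move=> /GRing.subr0_eq <-; rewrite GRing.opprD GRing.opprB !GRing.addrA.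
by rewrite [RHS](@GRing.add _).[ACl 1*2*6*4*5*3*7] GRing.addrK.
Qed.
Let emul1 : left_id eone emul.
Proof.
by move=> [a u]; rewrite /emul /= mul1g (cocycle1l fc) GRing.addrAC GRing.subrr GRing.add0r.
Qed.
Let emulr1 : right_id eone emul.
Proof.
by move=> [a u]; rewrite /emul /= mulg1 (cocycle1r fc) GRing.addrK.
Qed.
Let emulrV : right_inverse eone einv emul.
Proof.
by move=> [a u]; rewrite /emul /einv /= mulgV (GRing.addrC a) GRing.subrK GRing.addrK.
Qed.
Let emulV : left_inverse eone einv emul.
Proof.
move=> [a u]; rewrite /emul /einv /= mulVg; congr pair.
have := fc u u^-1%g u; rewrite mulgV mulVg (cocycle1l fc) (cocycle1r fc).
by rewrite GRing.subrK => /GRing.subr0_eq ->; rewrite GRing.subrK GRing.addrK.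
Qed.
HB.instance Definition _ := isGroup.Build E emulA emul1 emulr1 emulV emulrV.

Lemma twist_group : prime p -> p.-group [set: P]%SET ->
  exists (E : finGroupType) (e1 : E -> 'F_p) (e2 : E -> P) (e : 'F_p -> P -> E),
  [/\ p.-group [set: E]%SET, {morph e2 : a b / (a * b)%g},
      forall a b, e1 (a * b)%g = e1 a + e1 b - f (e2 a) (e2 b) &
      forall a u, e2 (e a u) = u].
Proof.
move=> pp pP; exists (twist fc : finGroupType), fst, snd, (fun a u => (a, u)); split=> //.
rewrite /pgroup cardsT card_prod card_Fp// pnatM pnat_id//=.
by move: pP; rewrite /pgroup cardsT.
Qed.

End Twist.

Section FreeCohomology.
Variables (p g : nat) (F : topologicalGroupType) (x : 'I_g -> F).
Hypotheses (p_prime : prime p) (F_free : free_pro_p p x).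
Let pF : pro_p_group p F. Proof. by case: F_free. Qed.

(** A continuous map from the compact group F x F to a discrete space is uniformly locally constant,
    so it factors through a finite quotient of F in each variable. *)
Lemma locally_constant (T : choiceType) (k : F * F -> discrete_topology T) :
  continuous k -> exists N : normalSubgroup F, open N /\
  forall a b m n, nsub N m -> nsub N n -> k (a * m, b * n) = k (a, b).
Proof.
move=> kc; have [cF hF dF _] := pF.
have /compact_near_coveringP cFF := compact_setX cF cF.
have : \forall mn \near ((1, 1) : F * F), [set: F] `*` [set: F] `<=`
    (fun ab => k (ab.1 * mn.1, ab.2 * mn.2) = k ab).
  apply: (cFF (F * F)%type (nbhs ((1, 1) : F * F)) (fun mn ab => k (ab.1 * mn.1, ab.2 * mn.2) = k ab) (nbhs_filter _)).
  move=> [a b] _.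
  pose h1 := fun q : (F * F) * (F * F) => k (q.1.1 * q.2.1, q.1.2 * q.2.2).
  have c11 : continuous (fun q : (F * F) * (F * F) => q.1.1).
    by move=> q; apply: (@continuous_comp _ _ _ fst fst); exact: cvg_fst.
  have c12 : continuous (fun q : (F * F) * (F * F) => q.1.2).
    by move=> q; apply: (@continuous_comp _ _ _ fst snd); [exact: cvg_fst|exact: cvg_snd].
  have c21 : continuous (fun q : (F * F) * (F * F) => q.2.1).
    by move=> q; apply: (@continuous_comp _ _ _ snd fst); [exact: cvg_snd|exact: cvg_fst].
  have c22 : continuous (fun q : (F * F) * (F * F) => q.2.2).
    by move=> q; apply: (@continuous_comp _ _ _ snd snd); exact: cvg_snd.
  have cM (u v : (F * F) * (F * F) -> F) : continuous u -> continuous v -> continuous (fun q => u q * v q).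
    move=> cu cv q; apply: (@continuous_comp _ _ _ (fun q => (u q, v q)) (fun z : F * F => z.1 * z.2)); last exact: mulg_continuous.
    by apply: cvg_pair; [exact: cu|exact: cv].
  have ch1 : continuous h1.
    move=> q; apply: (@continuous_comp _ _ _ (fun q : (F * F) * (F * F) => (q.1.1 * q.2.1, q.1.2 * q.2.2)) k); last exact: kc.
    by apply: cvg_pair; apply: cM.
  have n1 : nbhs (((a, b), (1, 1)) : (F * F) * (F * F)) (h1 @^-1` [set k (a, b)]).
    by apply: ch1; rewrite /h1 /= !mulg1; exact: discrete_set1.
  have n2 : nbhs (((a, b), (1, 1)) : (F * F) * (F * F)) ((fun q => k q.1) @^-1` [set k (a, b)]).
    have : continuous (fun q : (F * F) * (F * F) => k q.1).
      by move=> q; apply: (@continuous_comp _ _ _ fst k); [exact: cvg_fst|exact: kc].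
    by apply; exact: discrete_set1.
  apply: filterS2 n1 n2 => -[[a' b'] [m' n']] /=; rewrite /h1 /= => -> ->.
  by [].
case=> -[U V] /= [nU nV] UV.
have [N [oN NU]] := profinite_base cF hF dF (filterI nU nV).
exists N; split=> // a b m n Nm Nn.
have [Um _] := NU _ Nm; have [_ Vn] := NU _ Nn.
exact: (UV (m, n) (conj Um Vn) (a, b)).
Qed.

Local Open Scope ring_scope.

(* The cocycle is inflated from a finite quotient P of F; F -> P lifts to the
   extension of P by F_p that it defines, and the lift provides a cobounding cochain. *)
Lemma free_H2_vanishes (k : F * F -> 'F_p) : continuous (k : F * F -> discrete_topology 'F_p) ->
  (forall a b c, k (b, c) - k ((a * b)%g, c) + k (a, (b * c)%g) - k (a, b) = 0) ->
  exists2 b : F -> 'F_p, continuous (b : F -> discrete_topology 'F_p) &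
    forall u v, k (u, v) = b v - b (u * v)%g + b u.
Proof.
move=> kc kco.
have [N [oN kN]] := @locally_constant 'F_p k kc.
have [P [f [fm pP]]] := pro_p_finmodel p_prime pF oN.
have [fM fS fK] := fm; have fc := finmodel_continuous fm oN.
pose l u := projT1 (cid (fS u)).
have lE u : f (l u) = u by rewrite /l; case: cid.
pose f' u v := k (l u, l v).
have f'E a b : k (a, b) = f' (f a) (f b).
  have Na : nsub N ((l (f a))^-1 * a)%g by apply/(finmodel_eq fm); rewrite lE.
  have Nb : nsub N ((l (f b))^-1 * b)%g by apply/(finmodel_eq fm); rewrite lE.
  by rewrite /f' -(kN (l (f a)) (l (f b)) _ _ Na Nb) !mulVKg.
have f'c : cocycle f'.
  move=> a b c; rewrite -(lE a) -(lE b) -(lE c) -!fM -!f'E; exact: kco.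
have [E [e1 [e2 [e [pE e2M e1M e2e]]]]] := twist_group f'c p_prime pP.
have [h [hM hc] hx] := free_hom F_free (fun i => e 0 (f (x i))) pE.
have e2h : (fun z => e2 (h z)) = f.
  apply: (free_hom_eq F_free pP).
  - split; first by move=> a b; rewrite hM e2M.
    move=> a; apply: (@continuous_comp _ (discrete_topology E) (discrete_topology P)); first exact: hc.
    exact: discrete_continuous.
  - by split.
  - by move=> i; rewrite hx e2e.
exists (fun z => e1 (h z)).
  move=> a; apply: (@continuous_comp _ (discrete_topology E) (discrete_topology 'F_p)); first exact: hc.
  exact: discrete_continuous.
move=> u v; rewrite hM e1M f'E -e2h GRing.opprB (GRing.addrC (e1 (h v))) -GRing.addrA.
by rewrite (GRing.addrC (e1 (h v))) GRing.subrK.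
Qed.

End FreeCohomology.

(** Stated as a property of a map, because it is applied to the quotient type itself, to its copy in
    [Set] and to the representative of its isomorphism class. *)
Record presents (F G : topologicalGroupType) (S : set F) (pi : F -> G) : Prop := IsPresentation {
  pres_morph : {morph pi : a b / a * b};
  pres_surj : forall y, exists z, pi z = y;
  pres_quot : forall A, open A <-> open (pi @^-1` A);
  pres_ker : forall z, pi z = 1 <-> closed_normal_gen S z }.

Section Presentation.
Variables (p g : nat) (F G : topologicalGroupType) (S : set F) (pi : F -> G).
Hypotheses (p_prime : prime p) (pF : pro_p_group p F) (prs : presents S pi).
Let piM := pres_morph prs.
Let piS := pres_surj prs.
Let R := closed_normal_gen S.

Lemma closed_normal_gen_min (K : set F) : is_subgroup K -> conj_stable K -> closed K ->
  S `<=` K -> R `<=` K.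
Proof. by move=> sK nK cK; apply: smallest_sub. Qed.

Lemma sub_closed_normal_gen : S `<=` R.
Proof. exact: sub_gen_smallest. Qed.

Lemma closed_normal_gen_closed : closed R.
Proof. by apply: closed_bigI => K [[]]. Qed.

Lemma pres_eq a b : pi a = pi b <-> R (a^-1 * b).
Proof.
rewrite /R -(pres_ker prs) piM (gmorphV piM); split=> [->|]; first by rewrite mulVg.
by move=> /(congr1 (fun z => pi a * z)); rewrite mulVKg mulg1.
Qed.

Lemma pres_continuous : continuous pi.
Proof. by apply/continuousP => A /(pres_quot prs). Qed.

Lemma pres_open (A : set F) : open A -> open (pi @` A).
Proof.
move=> oA; apply/(pres_quot prs).
have -> : pi @^-1` (pi @` A) = \bigcup_(n in R) ((fun y => y * n) @^-1` A).
  apply/seteqP; split=> [z [y Ay /esym/pres_eq Rzy]|z [n Rn /= Azn]].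
    by exists (z^-1 * y) => //=; rewrite mulVKg.
  by exists (z * n) => //; rewrite piM (iffRL (pres_ker prs n) Rn) mulg1.
by apply: bigcup_open => n _; exact: translater_open.
Qed.

Lemma pres_fun (T : topologicalType) (b : F -> T) : continuous b ->
  (forall u v, R v -> b (u * v) = b u) ->
  exists2 b' : G -> T, continuous b' & forall u, b u = b' (pi u).
Proof.
move=> bc bR; pose b' y := b (projT1 (cid (piS y))).
have bE u : b u = b' (pi u).
  rewrite /b'; case: cid => z /= /pres_eq Rzu.
  by rewrite -(bR z _ Rzu) mulVKg.
exists b' => //; apply/continuousP => A oA; apply/(pres_quot prs).
have -> : pi @^-1` (b' @^-1` A) = b @^-1` A by apply/seteqP; split=> u /=; rewrite bE.
by move/continuousP : bc; apply.
Qed.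

Lemma pres_hom (K : topologicalGroupType) (h : F -> K) : continuous_hom h ->
  closed [set (1 : K)] -> (forall u, S u -> h u = 1) ->
  exists2 h' : G -> K, continuous_hom h' & forall u, h u = h' (pi u).
Proof.
move=> [hM hc] c1 hS.
have hR v : R v -> h v = 1.
  apply: (@closed_normal_gen_min [set v | h v = 1]).
  - exact: (is_subgroup_preimage hM (@is_subgroup1 K)).
  - exact: (conj_stable_preimage hM (@conj_stable1 K)).
  - by move/continuous_closedP : hc => /(_ _ c1).
  - exact: hS.
have [|h' h'c hE] := pres_fun hc; first by move=> u v Rv; rewrite hM (hR v Rv) mulg1.
exists h' => //; split=> // a b; have [u <-] := piS a; have [v <-] := piS b.
by rewrite -piM -!hE hM.
Qed.

(** Two points of G are separated by the image of an open normal subgroup of F missing the relevant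
    coset of the closed kernel; the images are open subgroups, hence clopen. Indices are computed in
    F. *)
Lemma pres_pro_p : pro_p_group p G.
Proof.
have zG : zero_dimensional G.
  move=> a b ab; have [u ua] := piS a; have [v vb] := piS b.
  have nR : ~ R (u^-1 * v) by move=> /pres_eq; rewrite ua vb => e; rewrite e eqxx in ab.
  have [N [oN NR]] := pro_p_separated pF (closed_normal_gen_subgroup S) closed_normal_gen_closed nR.
  have [N1 NM NV] := nsub_subgroup N.
  pose M := pi @` (nsub N); have oM : open M by exact: pres_open.
  have sM : is_subgroup M by exact: (is_subgroup_image piM (nsub_subgroup N)).
  have cM := open_subgroup_closed sM oM.
  exists ((fun y => a^-1 * y) @^-1` M); split.
  - split; first exact: translate_open.
    by have /continuous_closedP := @mulgl_continuous G a^-1; apply.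
  - by rewrite /= mulVg; exists 1 => //; exact: gmorph1.
  - rewrite /= -ua -vb -(gmorphV piM) -piM => -[n Nn] /pres_eq Rn.
    apply: (NR n^-1); first exact: NV.
    have nR' := @closed_normal_gen_conj F S _ n^-1 Rn.
    by rewrite /conjg invgK !mulgA mulgV mul1g in nR'.
have cG : compact [set: G].
  have -> : [set: G] = pi @` [set: F].
    by apply/seteqP; split=> // y _; have [z <-] := piS y; exists z.
  apply: continuous_compact; last by case: pF.
  exact/continuous_subspaceT/pres_continuous.
split=> //.
- rewrite open_hausdorff => a b ab; have [U [[oU cU] Ua Ub]] := zG a b ab.
  exists (U, ~` U) => /=; first by split; rewrite inE.
  by split=> //; [rewrite openC|rewrite setICr].
- exact: zero_dimension_totally_disconnected.
- move=> M oM.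
  have sN : is_subgroup (pi @^-1` M) by apply: is_subgroup_preimage => //; exact: nsub_subgroup.
  have nN : conj_stable (pi @^-1` M) by apply: conj_stable_preimage => //; exact: nsub_normal.
  pose N := NormalSubgroup sN nN.
  have oN : open N by apply/(pres_quot prs).
  have [P [f [fm pP]]] := pro_p_finmodel p_prime pF oN.
  have [fM fS fK] := fm.
  have [|f' f'c fE] := @pres_fun (discrete_topology P) f (finmodel_continuous fm oN).
    move=> u v Rv; rewrite fM; have -> : f v = 1; last by rewrite mulg1.
    by apply/fK => /=; rewrite (iffRL (pres_ker prs v) Rv); case: (nsub_subgroup M).
  have f'm : finmodel (nsub M) (f' : G -> P).
    split=> [a b|y|a].
    - by have [u <-] := piS a; have [v <-] := piS b; rewrite -piM -!fE fM.
    - by have [z <-] := fS y; exists (pi z); rewrite fE.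
    - by have [u <-] := piS a; rewrite -fE fK.
  exists (logn p #|P|).
  have -> : (p ^ logn p #|P|)%N = #|P| by have := card_pgroup pP; rewrite cardsT => <-.
  exact: finmodel_card f'm.
Qed.

Lemma pres_generated (d : nat) (x : 'I_d -> F) :
  closed_gen [set x i | i in [set: 'I_d]] = setT ->
  closed_gen [set pi (x i) | i in [set: 'I_d]] = setT.
Proof.
move=> gx; apply/seteqP; split=> // y _; have [z <-] := piS y.
have : closed_gen [set x i | i in [set: 'I_d]] `<=` pi @^-1` closed_gen [set pi (x i) | i in [set: 'I_d]].
  apply: closed_gen_min.
  - by apply: is_subgroup_preimage => //; exact: closed_gen_subgroup.
  - have /continuous_closedP := pres_continuous; apply; exact: closed_gen_closed.
  - by move=> _ [i _ <-]; apply: sub_closed_gen; exists i.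
by rewrite gx => /(_ z I).
Qed.

End Presentation.

Section LocallyConstant.

Lemma discrete_continuousP (T : topologicalType) (A : choiceType) (f : T -> A) :
  continuous (f : T -> discrete_topology A) <-> forall x, nbhs x [set y | f y = f x].
Proof.
split=> [fc x|fl x B /nbhs_singleton Bx]; first exact: (fc x _ (discrete_set1 _)).
by apply: filterS (fl x) => y /= ->.
Qed.

Lemma continuous_op2 (T : topologicalType) (A B C : choiceType) (op : A -> B -> C)
    (f : T -> A) (h : T -> B) :
  continuous (f : T -> discrete_topology A) -> continuous (h : T -> discrete_topology B) ->
  continuous ((fun x => op (f x) (h x)) : T -> discrete_topology C).
Proof.
move=> /discrete_continuousP fl /discrete_continuousP hl; apply/discrete_continuousP => x.
by apply: filterS2 (fl x) (hl x) => y /= -> ->.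
Qed.

Lemma continuous_op1 (T : topologicalType) (A C : choiceType) (op : A -> C) (f : T -> A) :
  continuous (f : T -> discrete_topology A) ->
  continuous ((fun x => op (f x)) : T -> discrete_topology C).
Proof.
move=> /discrete_continuousP fl; apply/discrete_continuousP => x.
by apply: filterS (fl x) => y /= ->.
Qed.

Lemma continuous_sum (T : topologicalType) (p n : nat) (f : 'I_n -> T -> 'F_p) :
  (forall i, continuous (f i : T -> discrete_topology 'F_p)) ->
  continuous ((fun x => \sum_(i < n) f i x)%R : T -> discrete_topology 'F_p).
Proof.
move=> fc; apply/discrete_continuousP => x.
have : \forall y \near x, forall i, f i y = f i x.
  apply: filter_forall => i; have /discrete_continuousP := fc i; exact.
by apply: filterS => y fy /=; apply: eq_bigr.
Qed.

End LocallyConstant.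

Lemma card_image_ker (P H : finGroupType) (A : {group P}) (f : P -> H) :
  {morph f : x y / x * y} ->
  (#|[set f a | a in A]%SET| * #|[set a in A | f a == 1%g]%SET|)%N = #|A|.
Proof.
move=> fM; rewrite -sum_nat_const -[RHS]sum1_card.
rewrite [RHS](partition_big f (mem [set f a | a in A]%SET)) /=; last by move=> a aA; exact: imset_f.
apply: eq_bigr => _ /imsetP[a0 a0A ->]; rewrite sum1dep_card.
rewrite -(card_imset (mem [set a in A | f a == 1%g]%SET) (mulgI a0)).
apply: eq_card => y; rewrite [RHS]inE.
apply/imsetP/andP => [[a]|[yA /eqP fy]].
  by rewrite inE => /andP[aA /eqP fa] ->; rewrite groupM// fM fa mulg1.
by exists (a0^-1 * y); rewrite ?mulKVg// inE groupM ?groupV//= fM (gmorphV fM) fy mulVg.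
Qed.

Section Digit.
Variables (p n : nat).
Hypothesis p_prime : prime p.
Notation Zpn := 'Z_(p ^ n.+1).

Lemma Zpn_torsionP (a : Zpn) : reflect (a ^+ p = 1) (p ^ n %| a)%N.
Proof.
have p0 := prime_gt0 p_prime; have pn0 : (0 < p ^ n)%N by rewrite expn_gt0 p0.
rewrite -(dvdn_pmul2r p0) -expnSr.
have E : a ^+ p = ((a * p)%N%:R)%R by rewrite Zpn_expg GRing.natrM natr_Zp GRing.mulr_natr.
apply: (iffP idP) => [/dvdnP[k ak]|]; rewrite E.
  by rewrite ak GRing.natrM pchar_Zp ?expn_gt1// GRing.mulr0.
move=> /(congr1 val) /=; rewrite val_Zp_nat ?expn_gt1//.
by move=> /eqP.
Qed.

Lemma Zpn_divp (a : Zpn) : a ^+ (p ^ n) = 1 -> exists b : Zpn, b ^+ p = a.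
Proof.
have pn0 : (0 < p ^ n)%N by rewrite expn_gt0 prime_gt0.
move=> a1; have : (p %| a)%N.
  rewrite -(dvdn_pmul2r pn0) -expnS.
  have : ((a * p ^ n)%N%:R = 0 :> Zpn)%R.
    by rewrite GRing.natrM natr_Zp GRing.mulr_natr; exact: a1.
  by move=> /(congr1 val) /=; rewrite val_Zp_nat ?expn_gt1// => /eqP.
move=> /dvdnP[k ak]; exists (k%:R)%R.
by rewrite Zpn_expg -GRing.mulrnA -ak natr_Zp.
Qed.

(** The leading base-p digit. It is not a morphism, but it is additive when one argument is
    p-torsion ([digitD]); this is what lets the coboundary of [digit] composed with a morphism
    descend to G in [pres_H2_class]. *)
Definition digit (a : Zpn) : 'F_p := ((a %/ p ^ n)%N%:R)%R.

Lemma digitD (a b : Zpn) : b ^+ p = 1 -> digit (a * b) = (digit a + digit b)%R.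
Proof.
have pn0 : (0 < p ^ n)%N by rewrite expn_gt0 prime_gt0.
move=> /Zpn_torsionP/dvdnP[m bm].
have abE : nat_of_ord (a * b : Zpn) = ((a + b) %% p ^ n.+1)%N.
  have -> : a * b = (a + b)%R :> Zpn by [].
  rewrite -[in LHS](natr_Zp a) -[in LHS](natr_Zp b) -GRing.natrD val_Zp_nat//.
  exact: expn_gt1.
have modE (k : nat) : (k %% p ^ n.+1 %/ p ^ n = (k %/ p ^ n) %% p)%N by rewrite modn_divl -expnS.
rewrite /digit abE modE bm addnC divnMDl// mulnK//.
by rewrite Fp_nat_mod// GRing.natrD GRing.addrC.
Qed.

Lemma digit1 : digit 1 = 0%R. Proof. by rewrite /digit div0n. Qed.

Lemma digit_pn : digit ((1%R : Zpn) ^+ (p ^ n)) = 1%R.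
Proof.
rewrite /digit; have -> : nat_of_ord ((1%R : Zpn) ^+ (p ^ n)) = (p ^ n)%N.
  have -> : (1%R : Zpn) ^+ (p ^ n) = ((p ^ n)%:R)%R by [].
  by rewrite val_Zp_nat ?expn_gt1// modn_small// ltn_exp2l// prime_gt1.
by rewrite divnn expn_gt0 prime_gt0.
Qed.

End Digit.

Lemma coboundary_cocycle (V : zmodType) (A B C D E H : V) :
  ((A - B + C) - (A - D + E) + (B - D + H) - (C - E + H) = 0)%R.
Proof.
rewrite !GRing.opprD !GRing.opprK !GRing.addrA.
rewrite [LHS](@GRing.add _).[ACl 1*4*2*7*3*10*5*8*6*11*9*12].
by rewrite !(GRing.subrr, GRing.add0r, GRing.addNr, GRing.sub0r).
Qed.

Lemma subr_exchange (V : zmodType) (A B C D : V) : (A - B = C - D -> A - C = B - D)%R.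
Proof. move/eqP; rewrite GRing.subr_eq => /eqP ->.
by rewrite [LHS](@GRing.add _).[ACl 1*4*3*2] GRing.subrr GRing.add0r. Qed.

(** * Quotients by inverted Frattini relators are Schur sigma-groups *)

Section SchurPresentation.
Variables (p g n : nat) (F G : topologicalGroupType) (x r : 'I_g -> F) (s : F -> F).
Variable pi : F -> G.
Hypotheses (p_prime : prime p) (F_free : free_pro_p p x).
Hypotheses (s_iso : top_group_iso s) (s_inv : forall i, s (x i) = (x i)^-1).
Hypotheses (r_frat : forall j, lower_p_set p 1 (r j)) (r_inv : forall j, s (r j) = (r j)^-1).
Let S := [set r j | j in [set: 'I_g]].
Hypothesis prs : presents S pi.
Hypothesis no_cyclic : forall h : F -> 'Z_(p ^ n.+1),
  continuous_hom (h : F -> discrete_topology 'Z_(p ^ n.+1)) -> (forall j, h (r j) = 1) ->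
  ~ (forall y, exists z, h z = y).

Let pF : pro_p_group p F. Proof. by case: F_free. Qed.
Let piM := pres_morph prs.
Let piS := pres_surj prs.
Let R := closed_normal_gen S.
Let pFp : p.-group [set: 'F_p]%SET.
Proof. by rewrite /pgroup cardsT card_Fp// pnat_id. Qed.
Let pG : pro_p_group p G := pres_pro_p p_prime pF prs.
Let R1 v : R v -> pi v = 1. Proof. by move/(pres_ker prs). Qed.

Lemma character_frat (H : topologicalGroupType) (h : H -> 'F_p) :
  continuous_hom (h : H -> discrete_topology 'F_p) ->
  forall u, lower_p_set p 1 u -> h u = 1.
Proof. by move=> hc u Lu; apply: (Fp_lower_p1 p_prime); exact: (lower_p_hom hc). Qed.

(** The relators lie in the Frattini subgroup, so every character of F descends to G; the basis is
    dual to the generators. *)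
Lemma pres_H1 : dim_H1 p G g.
Proof.
have ex i : exists e : G -> 'F_p, continuous_hom (e : G -> discrete_topology 'F_p) /\
    forall j, e (pi (x j)) = ((i == j)%:R)%R.
  have [h hc hx] := free_hom F_free (fun j => ((i == j)%:R : 'F_p)%R) pFp.
  have [||e ec eE] := pres_hom prs hc; first exact: discrete_closed.
    by move=> _ [j _ <-]; exact: character_frat.
  by exists e; split=> // j; rewrite -eE.
pose e i := projT1 (cid (ex i)); have [ec ex'] : (forall i, continuous_hom (e i : G -> discrete_topology 'F_p)) /\
    forall i j, e i (pi (x j)) = ((i == j)%:R)%R.
  by split=> i; rewrite /e; case: cid => ? [].
exists e; split=> [i|z [zc zM]]; first by have [eM ec'] := ec i; split.
have sumE (c : 'rV['F_p]_g) j : (\sum_(i < g) c 0 i *: (e i (pi (x j)) : ('F_p)^o) = c 0 j)%R.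
  rewrite (bigD1 j)//= ex' eqxx big1 ?GRing.addr0; first exact: GRing.mulr1.
  by move=> i ij; rewrite ex' (negbTE ij) GRing.scaler0.
exists (\row_j z (pi (x j)))%R; split.
  apply/funext => y; have [u <-] := piS y.
  pose h1 v := z (pi v); pose h2 v : 'F_p := (\sum_(i < g) z (pi (x i)) * e i (pi v))%R.
  have pc := pres_continuous prs.
  have : h1 = h2.
    apply: (free_hom_eq F_free pFp).
    - split; first by move=> a b; rewrite /h1 piM zM.
      by move=> a; apply: (@continuous_comp _ _ (discrete_topology 'F_p) pi); [exact: pc|exact: zc].
    - split.
        move=> a b; rewrite /h2 Fp_mulgE -big_split; apply: eq_bigr => i _ /=.
        by have [eM _] := ec i; rewrite piM eM Fp_mulgE GRing.mulrDr.
      apply: (@continuous_sum F p g (fun i v => z (pi (x i)) * e i (pi v))%R) => i.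
      apply: (@continuous_op1 F _ _ (fun a => z (pi (x i)) * a)%R).
      have [_ ec'] := ec i.
      by move=> a; apply: (@continuous_comp _ _ (discrete_topology 'F_p) pi); [exact: pc|exact: ec'].
    - move=> j; rewrite /h1 /h2 -{1}[z (pi (x j))](_ : (\row_j z (pi (x j)))%R 0%R j = _); last by rewrite mxE.
      by rewrite -sumE; apply: eq_bigr => i _; rewrite mxE.
  move=> /(congr1 (fun h => h u)); rewrite /h1 /h2 => hE.
  rewrite !fctE fct_sumE hE; apply/eqP; rewrite GRing.subr_eq0; apply/eqP.
  by apply: eq_bigr => i _; rewrite mxE.
move=> c cE; apply/rowP => j; rewrite mxE; have /eqP := congr1 (fun h => h (pi (x j))) cE.
by rewrite !fctE fct_sumE GRing.subr_eq0 => /eqP ->; rewrite -sumE.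
Qed.

(** If w is the coboundary of b' on G, then b differs from the inflation of b' by a character of F,
    which is trivial on the relators. Conversely, the elements v of R with b(v) = b(1) form a closed
    normal subgroup; containing the relators, it is all of R, so b descends to G. *)
Lemma pres_B2 (w : G * G -> 'F_p) (b : F -> 'F_p) :
  continuous (b : F -> discrete_topology 'F_p) ->
  (forall u v, w (pi u, pi v) = b v - b (u * v)%g + b u)%R ->
  B2 w <-> forall j, b (r j) = b 1.
Proof.
move=> bc wb; split=> [[b' b'c wb'] j|br].
  pose h u := (b' (pi u) - b u)%R.
  have hM : {morph h : u v / u * v}.
    move=> u v; rewrite Fp_mulgE /h piM.
    have := wb' (pi u) (pi v); rewrite wb => e.
    apply/eqP; rewrite -GRing.subr_eq0; apply/eqP.
    transitivity ((b v - b (u * v)%g + b u) - (b' (pi v) - b' (pi u * pi v)%g + b' (pi u)))%R; last by rewrite e GRing.subrr.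
    rewrite !GRing.opprD !GRing.opprK !GRing.addrA.
    by rewrite [LHS](@GRing.add _).[ACl 6*2*4*5*1*3].
  have hc : continuous_hom (h : F -> discrete_topology 'F_p).
    split=> //; apply: (@continuous_op2 F _ _ _ (fun a c => a - c)%R) => //.
    by move=> a; apply: (@continuous_comp _ _ (discrete_topology 'F_p) pi); [exact: pres_continuous prs _|exact: b'c].
  have h1 : h 1 = 1 by exact: gmorph1.
  have hr : h (r j) = 1 by exact: character_frat.
  have pr : pi (r j) = 1 by apply/R1; apply: sub_closed_normal_gen; exists j.
  move: h1 hr; rewrite /h pr (gmorph1 piM).
  by move=> /eqP; rewrite GRing.subr_eq0 => /eqP -> /eqP; rewrite GRing.subr_eq0 => /eqP.
have b_r u v : R v -> b (u * v) = (b u + (b v - b 1%g))%R.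
  move=> /R1 pv; have := wb u v; rewrite pv -[X in w (_, X)](gmorph1 piM) wb mulg1 GRing.subrK.
  move=> e; rewrite e GRing.opprD GRing.opprB (GRing.addrA (b v)) (GRing.addrC (b v)).
  by rewrite GRing.subrK (GRing.addrC (b u)) GRing.subrK.
have b_l u v : R v -> b (v * u) = (b u + (b v - b 1%g))%R.
  move=> /R1 pv; have := wb v u; rewrite pv -[X in w (X, _)](gmorph1 piM) wb mul1g GRing.subrr GRing.add0r.
  move=> e; rewrite e GRing.opprD GRing.opprB (GRing.addrA (b v)) (GRing.addrC (b v)).
  by rewrite GRing.addrK (GRing.addrC (b u)) GRing.subrK.
have sR := closed_normal_gen_subgroup S; have [Rone RM RV] := sR.
pose K := [set v | R v /\ b v = b 1].
have RK : R `<=` K.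
  apply: closed_normal_gen_min.
  - split=> [|u v [Ru bu] [Rv bv]|u [Ru bu]]; split=> //.
    + exact: RM.
    + by rewrite b_r// bu bv GRing.subrr GRing.addr0.
    + exact: RV.
    + by have := b_r u^-1 u Ru; rewrite mulVg bu GRing.subrr GRing.addr0.
  - move=> v u [Rv bv]; split; first exact: closed_normal_gen_conj.
    have Rvu : R (v ^ u) by exact: closed_normal_gen_conj.
    have := b_r u _ Rvu; rewrite -conjgC b_l// bv GRing.subrr => /GRing.addrI/esym/eqP.
    by rewrite GRing.subr_eq0 => /eqP.
  - apply: closedI; first exact: closed_normal_gen_closed.
    have /continuous_closedP cl := bc; exact: (cl _ (@discrete_closed (discrete_topology 'F_p) [set b 1])).
  - by move=> _ [j _ <-]; split; [apply: sub_closed_normal_gen; exists j|exact: br].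
have [|b' b'c bE] := pres_fun prs bc.
  by move=> u v Rv; rewrite b_r//; have [_ ->] := RK v Rv; rewrite GRing.subrr GRing.addr0.
exists b' => // a c; have [u <-] := piS a; have [v <-] := piS c.
by rewrite wb !bE piM.
Qed.

Notation Zpn := 'Z_(p ^ n.+1).
Let pZ : p.-group [set: Zpn]%SET. Proof. exact: pgroup_Zpn. Qed.
Let Zcomm (a b : Zpn) : a * b = b * a. Proof. exact: GRing.addrC. Qed.

(* The square system [T] sends a homomorphism [F -> Z/p^(n+1)] to its values on
   the relators.  Its kernel consists of multiples of p by [no_cyclic], and
   counting gives that its image contains the whole p-torsion. *)
Lemma dual_relators (i : 'I_g) : exists2 h : F -> Zpn,
  continuous_hom (h : F -> discrete_topology Zpn) &
  forall j, h (r j) = if j == i then (1%R : Zpn) ^+ (p ^ n) else 1.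
Proof.
pose L := 'rV[Zpn]_g : finGroupType.
have hmP (a : L) : exists h : F -> Zpn,
    continuous_hom (h : F -> discrete_topology Zpn) /\ forall j, h (x j) = a 0%R j.
  by have [h hc hx] := free_hom F_free (fun j => (a 0%R j : Zpn)) pZ; exists h.
pose hm a := projT1 (cid (hmP a)).
have hmc a : continuous_hom (hm a : F -> discrete_topology Zpn) by rewrite /hm; case: cid => ? [].
have hmx a j : hm a (x j) = a 0%R j by rewrite /hm; case: cid => ? [].
have hmM a b u : hm (a * b) u = hm a u * hm b u.
  have : hm (a * b) = (fun u => hm a u * hm b u).
    apply: (free_hom_eq F_free pZ) => //.
      have [[aM ac] [bM bc]] := (hmc a, hmc b); split; last exact: continuous_op2.
      by move=> v w; rewrite aM bM -!mulgA; congr (_ * _); rewrite !mulgA; congr (_ * _).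
    by move=> j; rewrite !hmx mxE.
  by move=> ->.
pose T (a : L) : L := (\row_j hm a (r j))%R.
have TM : {morph T : a b / a * b}.
  by move=> a b; apply/rowP => j; rewrite !mxE hmM.
have Lcomm (a b : L) : a * b = b * a by exact: GRing.addrC.
have LX (a : L) k j : (a ^+ k) 0%R j = (a 0%R j : Zpn) ^+ k.
  by elim: k => [|k IHk]; rewrite ?expg0 ?mxE// !expgS mxE IHk.
pose pm (a : L) := a ^+ p.
have pmM : {morph pm : a b / a * b} by move=> a b; rewrite /pm expgMn//; exact: Lcomm.
(* A coordinate of a that is not a multiple of p is a unit, and then [hm a] is onto while killing
   the relators. *)
have kerT a : T a = 1 -> exists b, b ^+ p = a.
  move=> Ta; suff aj j : exists b : Zpn, b ^+ p = a 0%R j.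
    exists (\row_j projT1 (cid (aj j)))%R; apply/rowP => j.
    by rewrite LX mxE; case: cid.
  apply: Zpn_divp => //; apply: contrapT => aj; have [|k ak] := @Zpn_unitP p n p_prime (a 0%R j).
    exact/eqP.
  apply: (no_cyclic (hmc a)) => [j'|y].
    by have := congr1 (fun v : L => v 0%R j') Ta; rewrite !mxE.
  exists (x j ^+ (k * (y : nat))); have [aM _] := hmc a.
  by rewrite (gmorphX aM) hmx expgnA ak Zpn_gen.
pose Tp := [set a : L | T a ^+ p == 1]%SET.
have gTp : group_set Tp.
  apply/group_setP; split; first by rewrite inE (gmorph1 TM) expg1n.
  move=> a b; rewrite !inE TM => /eqP Ta /eqP Tb.
  by rewrite -/(pm _) pmM /pm Ta Tb mulg1.
pose A' := Group gTp; pose O := [set a : L | a ^+ p == 1]%SET.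
have c1 := card_image_ker A' TM; have c2 := card_image_ker A' pmM.
(* Both T and the p-th power map act on A', the preimage under T of the p-torsion O. The kernel of T
   is the image of the power map, whose kernel is O; comparing the two factorizations of the order
   of A' shows that T maps A' onto O. *)
have E1 : [set pm a | a in A']%SET = [set a in A' | T a == 1]%SET.
  apply/setP => a; rewrite inE; apply/imsetP/andP => [[b]|[_ /eqP Ta]].
    rewrite inE => /eqP Tb ->; have Tbp : T (pm b) = 1 by rewrite /pm (gmorphX TM).
    by rewrite Tbp eqxx; split=> //; rewrite inE Tbp expg1n.
  have [b ba] := kerT a Ta; exists b => //.
  by rewrite inE -(gmorphX TM) ba Ta.
have E2 : [set a in A' | pm a == 1]%SET = O.
  apply/setP => a; rewrite !inE andb_idl// => /eqP pa.
  by rewrite -(gmorphX TM) -/(pm a) pa (gmorph1 TM).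
have TO : [set T a | a in A']%SET = O.
  apply/eqP; rewrite eqEcard; apply/andP; split.
    by apply/fintype.subsetP => _ /imsetP[a + ->]; rewrite !inE.
  rewrite -E2 -(leq_pmul2r (m := #|[set a in A' | T a == 1]%SET|)); last first.
    by apply/card_gt0P; exists 1; rewrite !inE (gmorph1 TM) expg1n eqxx.
  by rewrite c1 -c2 E1 mulnC.
pose d : Zpn := (1%R : Zpn) ^+ (p ^ n).
pose v : L := (\row_j (if j == i then d else 1%g))%R.
have : v \in O.
  rewrite inE; apply/eqP/rowP => j; rewrite LX !mxE; case: ifP => _; last exact: expg1n.
  by rewrite /d -expgnA -expnSr Zpn_expg_pn.
rewrite -TO => /imsetP[a _ va]; exists (hm a) => // j.
by have := congr1 (fun w : L => w 0%R j) va; rewrite !mxE.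
Qed.

(** The cochain b is the leading digit of the morphism dual to the relator r_i. On R that morphism
    is p-torsion valued, so b is additive against R and invariant under conjugation; hence its
    coboundary only depends on the images in G. *)
Lemma pres_H2_class (i : 'I_g) : exists (e : G * G -> 'F_p) (b : F -> 'F_p),
  [/\ Z2 (p := p) e, continuous (b : F -> discrete_topology 'F_p),
     forall u v, e (pi u, pi v) = (b v - b (u * v)%g + b u)%R &
     forall j, (b (r j) - b 1%g = (j == i)%:R)%R].
Proof.
have [h [hM hc] hr] := dual_relators i.
pose b u := digit (h u); have bc : continuous (b : F -> discrete_topology 'F_p).
  exact: (@continuous_op1 F _ _ (@digit p n)).
have hR v : R v -> h v ^+ p = 1.
  apply: (@closed_normal_gen_min F S [set v | h v ^+ p = 1]).
  - split; first by rewrite /= (gmorph1 hM) expg1n.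
    + move=> u w /= hu hw; rewrite hM expgMn; last exact: Zcomm.
      by rewrite hu hw mulg1.
    + by move=> u /= hu; rewrite (gmorphV hM) expVgn hu invg1.
  - by move=> u w /= hu; rewrite (gmorphJ hM) /conjg Zcomm mulgK.
  - have -> : [set v | h v ^+ p = 1] = h @^-1` [set a | a ^+ p = 1] by [].
    by move/continuous_closedP : hc; apply; exact: discrete_closed.
  - move=> _ [j _ <-] /=; rewrite hr; case: ifP => _; last exact: expg1n.
    by rewrite -expgnA -expnSr Zpn_expg_pn.
have bR u v : R v -> b (u * v) = (b u + b v)%R.
  by move=> /hR hv; rewrite /b hM digitD.
have bJ u v : b (v ^ u) = b v by rewrite /b (gmorphJ hM) /conjg Zcomm mulgK.
pose w u v := (b v - b (u * v)%g + b u)%R.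
have wR u v a c : R a -> R c -> w (u * a) (v * c) = w u v.
  move=> Ra Rc; have Rav : R (a ^ v) by exact: closed_normal_gen_conj.
  have [_ RM _] := closed_normal_gen_subgroup S.
  have -> : w (u * a) (v * c) = ((b v + b c) - (b (u * v)%g + (b a + b c)) + (b u + b a))%R.
    rewrite /w (bR v)// (bR u)//; congr (_ - _ + _)%R.
    have -> : u * a * (v * c) = u * v * (a ^ v * c) by rewrite /conjg !mulgA mulgK.
    have Rac : R (a ^ v * c) by exact: RM.
    by rewrite (bR (u * v))// (bR (a ^ v))// bJ.
  rewrite /w !GRing.opprD !GRing.addrA.
  rewrite [LHS](@GRing.add _).[ACl 1*3*6*2*5*7*4].
  by rewrite GRing.addrK GRing.addrK.
pose l y := projT1 (cid (piS y)).
have lE y : pi (l y) = y by rewrite /l; case: cid.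
pose e (ac : G * G) := w (l ac.1) (l ac.2).
have eE u v : e (pi u, pi v) = w u v.
  rewrite /e /=.
  have Ru : R ((l (pi u))^-1 * u) by apply/(pres_eq prs); rewrite lE.
  have Rv : R ((l (pi v))^-1 * v) by apply/(pres_eq prs); rewrite lE.
  by rewrite -(wR _ _ _ _ Ru Rv) !mulVKg.
exists e, b; split=> //.
- split.
    apply/discrete_continuousP => -[y z]; have [u <-] := piS y; have [v <-] := piS z.
    have wc : continuous ((fun uv : F * F => w uv.1 uv.2) : F * F -> discrete_topology 'F_p).
      apply: (@continuous_op2 (F * F)%type _ _ _ (fun a c => a + c)%R (fun uv => b uv.2 - b (uv.1 * uv.2)%g)%R (fun uv => b uv.1)); last first.
        by move=> q; apply: (@continuous_comp _ _ (discrete_topology 'F_p) fst b); [exact: cvg_fst|exact: bc].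
      apply: (@continuous_op2 (F * F)%type _ _ _ (fun a c => a - c)%R (fun uv => b uv.2) (fun uv => b (uv.1 * uv.2)%g)).
        by move=> q; apply: (@continuous_comp _ _ (discrete_topology 'F_p) snd b); [exact: cvg_snd|exact: bc].
      by move=> q; apply: (@continuous_comp _ _ (discrete_topology 'F_p) (fun q : F * F => q.1 * q.2) b); [exact: mulg_continuous|exact: bc].
    move/discrete_continuousP : wc => /(_ (u, v)) [[U V] /= [nU nV] UV].
    have piO (W : set F) (t : F) : nbhs t W -> nbhs (pi t) (pi @` W).
      rewrite nbhsE => -[W' [oW' W't] W'W].
      apply: (@filterS _ (nbhs (pi t)) _ (pi @` W')); first by move=> _ [q W'q <-]; exists q => //; exact: W'W.
      by apply: open_nbhs_nbhs; split; [exact: (pres_open prs)|exists t].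
    exists (pi @` U, pi @` V); first by split; exact: piO.
    move=> [_ _] [/= [u' Uu' <-] [v' Vv' <-]]; rewrite !eE.
    exact: (UV (u', v')).
  move=> a c d; have [u <-] := piS a; have [v <-] := piS c; have [t <-] := piS d.
  rewrite -!piM !eE /w -!mulgA; exact: coboundary_cocycle.
- move=> j; rewrite /b hr (gmorph1 hM) digit1 GRing.subr0; case: ifP => _; last exact: digit1.
  exact: digit_pn.
Qed.

(** The inflation of z to F is the coboundary of some [bz]. By [pres_B2] the class of z is
    determined by the differences [bz (r j) - bz 1], and these are its coordinates in the basis dual
    to the relators. *)
Lemma pres_H2 : dim_H2 p G g.
Proof.
pose e i := projT1 (cid (pres_H2_class i)).
have eP i : exists b : F -> 'F_p, [/\ Z2 (p := p) (e i), continuous (b : F -> discrete_topology 'F_p),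
     forall u v, e i (pi u, pi v) = (b v - b (u * v)%g + b u)%R &
     forall j, (b (r j) - b 1%g = (j == i)%:R)%R] by rewrite /e; case: cid.
pose b i := projT1 (cid (eP i)).
have bP i : [/\ Z2 (p := p) (e i), continuous (b i : F -> discrete_topology 'F_p),
     forall u v, e i (pi u, pi v) = (b i v - b i (u * v)%g + b i u)%R &
     forall j, (b i (r j) - b i 1%g = (j == i)%:R)%R] by rewrite /b; case: cid.
have eZ i : Z2 (p := p) (e i) by have [] := bP i.
exists e; split=> // z [zc zZ].
have [||bz bzc bzE] := @free_H2_vanishes p g F x p_prime F_free (fun uv => z (pi uv.1, pi uv.2)).
    move=> q; apply: (@continuous_comp _ _ (discrete_topology 'F_p) (fun uv : F * F => (pi uv.1, pi uv.2)) z); last exact: zc.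
    have pc := pres_continuous prs.
    apply: cvg_pair.
      by apply: (@continuous_comp _ _ _ fst pi); [exact: cvg_fst|exact: pc].
    by apply: (@continuous_comp _ _ _ snd pi); [exact: cvg_snd|exact: pc].
  by move=> u v w /=; rewrite !piM; exact: zZ.
pose bc (c : 'rV['F_p]_g) u : 'F_p := (bz u - \sum_(i < g) c 0 i * b i u)%R.
have crit (c : 'rV['F_p]_g) : B2 (z - \sum_(i < g) c 0 i *: (e i : G * G -> ('F_p)^o))%R <->
    forall j, (bz (r j) - bz 1%g = c 0 j)%R.
  have -> : (forall j, (bz (r j) - bz 1%g = c 0 j)%R) <-> (forall j, bc c (r j) = bc c 1).
    have sumE j : (\sum_(i < g) c 0 i * b i (r j) - \sum_(i < g) c 0 i * b i 1%g = c 0 j)%R.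
      rewrite -GRing.sumrB (bigD1 j)//= -GRing.mulrBr; have [_ _ _ ->] := bP j.
      rewrite eqxx GRing.mulr1 big1 ?GRing.addr0// => i ij.
      by rewrite -GRing.mulrBr; have [_ _ _ ->] := bP i; rewrite eq_sym (negbTE ij) GRing.mulr0.
    split=> H j; have := H j; rewrite -(sumE j) /bc.
      exact: subr_exchange.
    exact: subr_exchange.
  apply: pres_B2.
    apply: (@continuous_op2 F _ _ _ (fun a c => a - c)%R bz) => //.
    apply: (@continuous_sum F p g (fun i u => c 0 i * b i u)%R) => i.
    apply: (@continuous_op1 F _ _ (fun a => c 0 i * a)%R).
    by have [] := bP i.
  move=> u v; rewrite !fctE fct_sumE bzE /bc.
  have -> : (\sum_(i < g) (c 0 i *: (e i : G * G -> ('F_p)^o)) (pi u, pi v) =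
     \sum_(i < g) c 0 i * b i v - \sum_(i < g) c 0 i * b i (u * v)%g + \sum_(i < g) c 0 i * b i u)%R.
    rewrite -GRing.sumrB -big_split; apply: eq_bigr => i _ /=.
    have [_ _ eE _] := bP i; transitivity (c 0 i * e i (pi u, pi v))%R; first by [].
    by rewrite eE GRing.mulrDr GRing.mulrBr.
  rewrite !GRing.opprD !GRing.opprK !GRing.addrA.
  by rewrite [LHS](@GRing.add _).[ACl 1*4*2*5*3*6].
exists (\row_j (bz (r j) - bz 1%g))%R; split; first by apply/crit => j; rewrite mxE.
by move=> c /crit cE; apply/rowP => j; rewrite mxE cE.
Qed.

(** Otherwise this is visible in a finite quotient, where [cyclic_quotient] produces a quotient
    Z/p^(n+1) of G. *)
Lemma pres_torsion (y : G) : nsub (closed_derived G) (y ^+ (p ^ n)).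
Proof.
apply: contrapT => ny; set D := nsub (closed_derived G) in ny *.
have sD := nsub_subgroup (closed_derived G).
have cD : closed D by exact: closed_gen_closed.
have [N [oN NN]] := pro_p_separated pG sD cD ny.
have [P [f [fm pP]]] := pro_p_finmodel p_prime pG oN.
have [fM fS fK] := fm; have fc := finmodel_continuous fm oN.
have [|h [hM hS]] := @cyclic_quotient p n p_prime P (f y) pP.
  apply/negP => fy; pose L := Group (group_set_of (is_subgroup_image fM sD)).
  have : [set: P]%G^`(1) \subset L.
    rewrite gen_subG; apply/fintype.subsetP => _ /imset2P[a c _ _ ->].
    rewrite inE; apply/asboolP; have [a' <-] := fS a; have [c' <-] := fS c.
    exists [~ a', c']; last exact: gmorphR.
    by apply: sub_closed_gen; exists a', c'.
  move=> /fintype.subsetP/(_ _ fy); rewrite inE => /asboolP[d Dd].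
  rewrite -(gmorphX fM) => /esym/(finmodel_eq fm) Nd.
  by apply: (NN _ Nd); rewrite mulKVg.
have kc : continuous_hom ((fun u => h (f (pi u))) : F -> discrete_topology Zpn).
  split; first by move=> a c; rewrite piM fM hM.
  move=> a; apply: (@continuous_op1 F _ _ h (f \o pi)) => {}a.
  apply: (@continuous_comp _ _ (discrete_topology P) pi f); last exact: fc.
  exact: pres_continuous prs _.
apply: (no_cyclic kc) => [j|z].
  have -> : pi (r j) = 1 by apply/R1; apply: sub_closed_normal_gen; exists j.
  by rewrite (gmorph1 fM) (gmorph1 hM).
have [a <-] := hS z; have [c <-] := fS a; have [u <-] := piS c; by exists u.
Qed.

(** The abelianization is generated by g elements killed by p^n, so it has at most p^(n g)
    elements. *)
Lemma pres_abelianization : finite_set [set: quotientGroup (closed_derived G)].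
Proof.
have pn0 : (0 < p ^ n)%N by rewrite expn_gt0 prime_gt0.
have [x' x'E] : exists x' : nat -> F, closed_gen [set x' i | i in `I_g] = setT.
  exact: free_gen_by p_prime F_free.
have cen i : (i < g)%N -> (forall c, nsub (closed_derived G) [~ c, (pi \o x') i]) /\
    nsub (closed_derived G) ((pi \o x') i ^+ (p ^ n)).
  move=> _; split=> [c|]; last exact: pres_torsion.
  by apply: sub_closed_gen; exists c, (pi (x' i)).
have cD : closed (nsub (closed_derived G)) by exact: closed_gen_closed.
have [K [sK cK DK Kx covK]] := @cosets_central (p ^ n) G (closed_derived G) g (pi \o x') cD pn0 cen.
apply: (@cosets_finite G ((p ^ n) ^ g)); suff <- : K = setT by [].
apply/seteqP; split=> // y _; have [u <-] := piS y.
have : closed_gen [set x' i | i in `I_g] `<=` pi @^-1` K.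
  apply: closed_gen_min.
  - exact: is_subgroup_preimage.
  - by have /continuous_closedP := pres_continuous prs; apply.
  - by move=> _ [i ig <-]; exact: Kx.
by rewrite x'E => /(_ u I).
Qed.

Lemma pres_GI : exists2 t : G -> G, GI_automorphism t & forall u, t (pi u) = pi (s u).
Proof.
have [[sM sc] _] := s_iso; have hF : hausdorff_space F by case: pF.
have sK : involutive s := GI_automorphism_invol hF (free_GI_automorphism p_prime F_free s_iso s_inv).
have hc : continuous_hom (pi \o s).
  split; first by move=> a c /=; rewrite sM piM.
  by move=> a; apply: continuous_comp; [exact: sc|exact: pres_continuous prs _].
have c1 : closed [set (1 : G)].
  by apply: accessible_closed_set1; apply: hausdorff_accessible; case: pG.
have [|t tc tE] := pres_hom prs hc c1.
  move=> _ [j _ <-] /=; rewrite r_inv (gmorphV piM).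
  have -> : pi (r j) = 1 by apply/R1; apply: sub_closed_normal_gen; exists j.
  by rewrite invg1.
have tK : involutive t by move=> y; have [u <-] := piS y; rewrite -!tE /= sK.
exists t; last by move=> u; rewrite -tE.
split.
  by split=> //; exists t; split=> //; case: tc.
exists [set pi (x i) | i in [set: 'I_g]]; split.
  exact: (pres_generated prs (free_generated p_prime F_free)).
by move=> _ [i _ <-]; rewrite -tE /= s_inv (gmorphV piM).
Qed.

Theorem pres_schur : is_schur_sigma p G.
Proof.
split=> //.
- exists [set pi (x i) | i in [set: 'I_g]]; split.
    by apply: finite_image; exact: finite_finset.
  exact: (pres_generated prs (free_generated p_prime F_free)).
- exact: pres_abelianization.
- by exists g; split; [exact: pres_H1|exact: pres_H2].
- by have [t tGI _] := pres_GI; exists t.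
Qed.

End SchurPresentation.

(** * Isomorphism classes *)

(* Schur sigma-groups are recorded with carriers in [Set], while quotients of a
   free pro-p group live in [Type]. *)
Section SetCopy.
Variables (G : topologicalGroupType) (T : Set) (iota : G -> T).
Hypothesis iota_inj : injective iota.

Definition set_copy of injective iota : Set := {t : T | exists x, iota x = t}.
Local Notation K := (set_copy iota_inj).
HB.instance Definition _ := gen_eqMixin K.
HB.instance Definition _ := gen_choiceMixin K.

Definition to_copy (x : G) : K := exist _ (iota x) (ex_intro _ x erefl).
Definition of_copy (c : K) : G := projT1 (cid (proj2_sig c)).

Lemma of_copyK : cancel of_copy to_copy.
Proof.
move=> [t xt]; rewrite /to_copy /of_copy /=; case: cid => x /= e.
by case: _ / e xt => xt; congr exist; exact: Prop_irrelevance.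
Qed.

Lemma to_copyK : cancel to_copy of_copy.
Proof. by move=> x; rewrite /of_copy; case: cid => y /= /iota_inj. Qed.

Let kmul (a b : K) : K := to_copy (of_copy a * of_copy b).
Let kone : K := to_copy 1.
Let kinv (a : K) : K := to_copy (of_copy a)^-1.
Let kmulA : associative kmul.
Proof. by move=> a b c; rewrite /kmul !to_copyK mulgA. Qed.
Let kmul1 : left_id kone kmul.
Proof. by move=> a; rewrite /kmul /kone to_copyK mul1g of_copyK. Qed.
Let kmulr1 : right_id kone kmul.
Proof. by move=> a; rewrite /kmul /kone to_copyK mulg1 of_copyK. Qed.
Let kmulV : left_inverse kone kinv kmul.
Proof. by move=> a; rewrite /kmul /kinv to_copyK mulVg. Qed.
Let kmulrV : right_inverse kone kinv kmul.
Proof. by move=> a; rewrite /kmul /kinv to_copyK mulgV. Qed.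
HB.instance Definition _ := isGroup.Build K kmulA kmul1 kmulr1 kmulV kmulrV.

Let kop (A : set K) := open (to_copy @^-1` A).
Let kopT : kop setT. Proof. exact: openT. Qed.
Let kopI (A B : set K) : kop A -> kop B -> kop (A `&` B).
Proof. exact: openI. Qed.
Let kop_bigU (I : Type) (f : I -> set K) : (forall i, kop (f i)) -> kop (\bigcup_i f i).
Proof. by move=> fo; rewrite /kop preimage_bigcup; apply: bigcup_open => i _; exact: fo. Qed.
HB.instance Definition _ := isOpenTopological.Build K kopT kopI kop_bigU.

Lemma copy_openE (A : set K) : open A <-> open (to_copy @^-1` A).
Proof. by []. Qed.

Lemma to_copy_continuous : continuous to_copy.
Proof. by apply/continuousP => A /copy_openE. Qed.

Lemma of_copy_continuous : continuous of_copy.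
Proof.
apply/continuousP => A oA; apply/copy_openE.
by have -> : to_copy @^-1` (of_copy @^-1` A) = A by apply/seteqP; split=> x /=; rewrite to_copyK.
Qed.

Let kmul_continuous : continuous (fun q : K * K => q.1 * q.2).
Proof.
move=> q; apply: (@continuous_comp _ _ _ (fun q : K * K => of_copy q.1 * of_copy q.2) to_copy); last exact: to_copy_continuous.
apply: (@continuous_comp _ _ _ (fun q : K * K => (of_copy q.1, of_copy q.2)) (fun z : G * G => z.1 * z.2)); last exact: mulg_continuous.
apply: cvg_pair.
  by apply: (@continuous_comp _ _ _ fst of_copy); [exact: cvg_fst|exact: of_copy_continuous].
by apply: (@continuous_comp _ _ _ snd of_copy); [exact: cvg_snd|exact: of_copy_continuous].
Qed.

Let kinv_continuous : continuous (fun a : K => a^-1).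
Proof.
move=> a; apply: (@continuous_comp _ _ _ (fun a : K => (of_copy a)^-1) to_copy); last exact: to_copy_continuous.
by apply: (@continuous_comp _ _ _ of_copy (fun x : G => x^-1)); [exact: of_copy_continuous|exact: invg_continuous].
Qed.
HB.instance Definition _ := isTopologicalGroup.Build K kmul_continuous kinv_continuous.

Lemma to_copyM : {morph to_copy : x y / x * y}.
Proof. by move=> x y; rewrite [RHS]/mul /= /kmul !to_copyK. Qed.

Lemma set_copy_exists : exists (K0 : Set) (st : TopologicalGroup.axioms_ K0)
    (e : G -> TopologicalGroup.Pack st) (e' : TopologicalGroup.Pack st -> G),
  [/\ {morph e : x y / x * y}, cancel e e', cancel e' e, continuous e & continuous e'].
Proof.
exists K, (TopologicalGroup.class (set_copy iota_inj : topologicalGroupType)), to_copy, of_copy.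
split; [exact: to_copyM|exact: to_copyK|exact: of_copyK|exact: to_copy_continuous|exact: of_copy_continuous].
Qed.

End SetCopy.

Section Isomorphic.

Lemma isomorphicP (G H : topologicalGroupType) : isomorphic G H <->
  exists (e : G -> H) (e' : H -> G),
  [/\ {morph e : x y / x * y}, cancel e e', cancel e' e, continuous e & continuous e'].
Proof.
split=> [[e [[eM ec] [e' [eK e'K e'c]]]]|[e [e' [eM eK e'K ec e'c]]]].
  by exists e, e'; split.
by exists e; split; [split|exists e'].
Qed.

Lemma isomorphic_refl (G : topologicalGroupType) : isomorphic G G.
Proof. by apply/isomorphicP; exists id, id; split=> // x; exact: cvg_id. Qed.

Lemma isomorphic_sym (G H : topologicalGroupType) : isomorphic G H -> isomorphic H G.
Proof.
move=> /isomorphicP[e [e' [eM eK e'K ec e'c]]]; apply/isomorphicP; exists e', e; split=> // x y.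
by apply: (can_inj eK); rewrite eM !e'K.
Qed.

Lemma isomorphic_trans (G H K : topologicalGroupType) :
  isomorphic G H -> isomorphic H K -> isomorphic G K.
Proof.
move=> /isomorphicP[e [e' [eM eK e'K ec e'c]]] /isomorphicP[f [f' [fM fK f'K fc f'c]]].
apply/isomorphicP; exists (f \o e), (e' \o f'); split.
- by move=> x y /=; rewrite eM fM.
- exact: can_comp.
- exact: can_comp.
- by move=> x; apply: continuous_comp; [exact: ec|exact: fc].
- by move=> x; apply: continuous_comp; [exact: f'c|exact: e'c].
Qed.

End Isomorphic.

Section Classes.
Variable p : nat.
Hypothesis p_prime : prime p.

(** An element is determined by its images in the finite groups Q_c(G), that is, by a sequence of
    integers. This gives the small carrier that [schurGroup] requires. *)
Lemma pro_p_inject (G : topologicalGroupType) d : gen_by G d -> pro_p_group p G ->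
  exists iota : G -> (nat -> nat), injective iota.
Proof.
move=> gd pG.
have mod c : exists h : G -> nat, forall x y, h x = h y -> lower_p_set p c (x^-1 * y).
  have [P [f [fm _ _ _]]] := lower_p_model p_prime c gd pG.
  exists (fun x => nat_of_ord (enum_rank (f x))) => x y /ord_inj /enum_rank_inj.
  by move/(finmodel_eq fm).
exists (fun x c => projT1 (cid (mod c)) x) => x y xy.
have : x^-1 * y = 1.
  apply: (pro_p_lower_p1 p_prime pG) => c.
  have := congr1 (fun h => h c) xy; case: cid => h /=; exact.
by move=> /(congr1 (fun z => x * z)); rewrite mulVKg mulg1.
Qed.

Lemma presents_comp (F G K : topologicalGroupType) (S : set F) (pi : F -> G)
    (e : G -> K) (e' : K -> G) :
  {morph e : x y / x * y} -> cancel e e' -> cancel e' e -> continuous e -> continuous e' ->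
  presents S pi -> presents S (e \o pi).
Proof.
move=> eM eK e'K ec e'c prs; split.
- by move=> x y /=; rewrite (pres_morph prs) eM.
- by move=> y; have [z pz] := pres_surj prs (e' y); exists z; rewrite /= pz e'K.
- move=> A; have -> : (e \o pi) @^-1` A = pi @^-1` (e @^-1` A) by [].
  split=> [oA|/(pres_quot prs) oA].
    by apply/(pres_quot prs); move/continuousP : ec; apply.
  have -> : A = e' @^-1` (e @^-1` A) by apply/seteqP; split=> x /=; rewrite e'K.
  by move/continuousP : e'c; apply.
- move=> z; rewrite -(pres_ker prs) /=; split=> [|->]; last exact: gmorph1.
  by rewrite -(gmorph1 eM) => /(can_inj eK).
Qed.

Lemma quotient_presents (F : topologicalGroupType) (S : set F) :
  presents S (qpi (normal_closure S)).
Proof.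
split.
- exact: qpiM.
- by move=> y; exists (qrepr y); exact: qreprK.
- by move=> A; exact: qpi_open.
- move=> z; rewrite -(gmorph1 (@qpiM _ (normal_closure S))); split.
    by move=> /esym /qpi_eqP; rewrite invg1 mul1g.
  by move=> Sz; apply/esym/qpi_eqP; rewrite invg1 mul1g.
Qed.

Definition has_model (G : topologicalGroupType) (c : nat) (P : finGroupType) : Prop :=
  exists f : G -> P, finmodel (lower_p_set p c) f /\ continuous (f : G -> discrete_topology P).

Lemma model_quotient (G : topologicalGroupType) c (P : finGroupType) (f : G -> P) :
  finmodel (lower_p_set p c) f -> continuous (f : G -> discrete_topology P) ->
  exists (e : lower_p_quotient G p c -> discrete_topology P) (e' : discrete_topology P -> lower_p_quotient G p c),
  [/\ {morph e : x y / x * y}, cancel e e', cancel e' e, continuous e & continuous e'] /\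
  forall x, e (qpi (lower_p G p c) x) = f x.
Proof.
move=> fm fc; have [fM fS fK] := fm.
have fqE x : f (qrepr (qpi (lower_p G p c) x)) = f x.
  by apply/(finmodel_eq fm)/(@qpi_eqP _ (lower_p G p c)); rewrite qreprK.
exists (fun a => f (qrepr a)), (fun y => qpi _ (projT1 (cid (fS y)))); split=> //; split.
- by move=> a b; rewrite -(qreprK a) -(qreprK b) -qpiM !fqE fM.
- move=> a; case: cid => z /= fz; rewrite -[RHS]qreprK; apply/qpi_eqP.
  exact/(finmodel_eq fm).
- by move=> y; rewrite fqE; case: cid.
- apply/continuousP => A oA; apply/qpi_open.
  have -> : qpi (lower_p G p c) @^-1` ((fun a => f (qrepr a)) @^-1` A) = f @^-1` A.
    by apply/seteqP; split=> x /=; rewrite fqE.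
  by move/continuousP : fc; apply.
- exact: discrete_continuous.
Qed.

Lemma has_modelP (G : topologicalGroupType) c (P : finGroupType) :
  isomorphic (lower_p_quotient G p c) (discrete_topology P) <-> has_model G c P.
Proof.
split=> [/isomorphicP[e [e' [eM eK e'K ec e'c]]]|[f [fm fc]]].
  exists (e \o qpi (lower_p G p c)); split; last first.
    by move=> x; apply: (@continuous_comp _ _ (discrete_topology P)); [exact: qpi_continuous|exact: ec].
  split.
  - by move=> x y /=; rewrite qpiM eM.
  - by move=> y; exists (qrepr (e' y)); rewrite /= qreprK e'K.
  - have q1 : qpi (lower_p G p c) 1 = 1 by exact: (gmorph1 (@qpiM _ _)).
    move=> x; rewrite /= -(gmorph1 eM) -q1; split=> [/(can_inj eK)/esym/qpi_eqP|Lx].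
      by rewrite invg1 mul1g.
    by congr e; apply/esym/qpi_eqP; rewrite invg1 mul1g.
have [e [e' [[eM eK e'K ec e'c] _]]] := model_quotient fm fc.
by apply/isomorphicP; exists e, e'.
Qed.

Definition fin_iso (P P' : finGroupType) : Prop :=
  exists e : P -> P', {morph e : x y / x * y} /\ bijective e.

Lemma fin_iso_sym P P' : fin_iso P P' -> fin_iso P' P.
Proof.
move=> [e [eM [e' eK e'K]]]; exists e'; split; last by exists e.
by move=> x y; apply: (can_inj eK); rewrite eM !e'K.
Qed.

Lemma models_iso (G : topologicalGroupType) c (P P' : finGroupType) :
  has_model G c P -> has_model G c P' -> fin_iso P P'.
Proof.
move=> [f [fm fc]] [f' [f'm f'c]]; have [fM fS fK] := fm; have [f'M f'S f'K] := f'm.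
have [e eM eE] := model_factor fm f'M f'c (model_lower_p1 f'm).
exists e; split=> //; apply: inj_card_bij.
  apply: (gmorph_inj eM) => y; have [x <-] := fS y; rewrite -eE => /f'K Lx.
  exact/fK.
have fb y : exists x, e x = y by have [x <-] := f'S y; exists (f x); rewrite eE.
pose g y := projT1 (cid (fb y)).
have gK : cancel g e by move=> y; rewrite /g; case: cid.
by apply: (@leq_card _ _ g); exact: can_inj gK.
Qed.

Lemma has_model_fin_iso (G : topologicalGroupType) c (P P' : finGroupType) :
  fin_iso P P' -> has_model G c P -> has_model G c P'.
Proof.
move=> [e [eM [e' eK e'K]]] [f [[fM fS fK] fc]]; exists (e \o f); split; last exact: (@continuous_op1 G _ _ e).
split=> [x y|y|x] /=.
- by rewrite fM eM.
- by have [x fx] := fS (e' y); exists x; rewrite fx e'K.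
- rewrite -fK -(gmorph1 eM); by split=> [/(can_inj eK)//|->].
Qed.

(* Finite groups up to isomorphism are coded by natural numbers, through the
   multiplication tables they realise on ['I_n]. *)
Definition table : countType := {n : nat & {ffun 'I_n * 'I_n -> 'I_n}}.

Definition realizes (P : finGroupType) (t : table) : Prop :=
  exists b : P -> 'I_(tag t), bijective b /\
    forall x y, b (x * y) = (tagged t : {ffun _ -> _}) (b x, b y).

Definition codes (P : finGroupType) : set nat :=
  [set k | exists2 t : table, choice.pickle t = k & realizes P t].

Definition gcode (P : finGroupType) : nat := xget 0%N (codes P).

Lemma gcodeP P : codes P (gcode P).
Proof.
apply: (@xgetPex _ 0%N (codes P)).
pose t : table := Tagged (fun n => {ffun 'I_n * 'I_n -> 'I_n})
  [ffun ij : 'I_#|P| * 'I_#|P| => enum_rank (enum_val ij.1 * enum_val ij.2)].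
exists (choice.pickle t), t => //; exists enum_rank; split.
  by exists enum_val; [exact: enum_rankK|exact: enum_valK].
by move=> x y; rewrite /t /= ffunE /= !enum_rankK.
Qed.

Lemma realizes_iso P P' t : realizes P t -> realizes P' t -> fin_iso P P'.
Proof.
move=> [b [[b' bK b'K] bM]] [h [[h' hK h'K] hM]]; exists (fun x => h' (b x)); split.
  by move=> x y; apply: (can_inj hK); rewrite h'K bM hM !h'K.
by exists (fun y => b' (h y)) => x; rewrite ?h'K ?bK ?b'K ?hK.
Qed.

Lemma realizes_fin_iso P P' t : fin_iso P P' -> realizes P t -> realizes P' t.
Proof.
move=> [e [eM [e' eK e'K]]] [b [bb bM]]; exists (b \o e'); split.
  by apply: bij_comp => //; exists e.
by move=> x y /=; rewrite -bM; congr b; apply: (can_inj eK); rewrite eM !e'K.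
Qed.

Lemma gcode_iso P P' : gcode P = gcode P' <-> fin_iso P P'.
Proof.
split=> [e|PP'].
  have := gcodeP P; have := gcodeP P'; rewrite -e => -[t tk rt] [t' tk' rt'].
  have tt' : t = t' by apply: (pcan_inj choice.pickleK); rewrite tk tk'.
  by rewrite -tt' in rt'; exact: realizes_iso rt' rt.
rewrite /gcode; congr xget; apply/seteqP; split=> k [t tk rt]; exists t => //.
  exact: realizes_fin_iso PP' rt.
exact: realizes_fin_iso (fin_iso_sym PP') rt.
Qed.

End Classes.

Section SchurFacts.
Variable p : nat.
Hypothesis p_prime : prime p.

(** A cyclic quotient is a quotient of the finite abelianization, whose order bounds its size;
    taking that order itself for n is enough. *)
Lemma schur_no_cyclic (G : topologicalGroupType) : is_schur_sigma p G ->
  exists n, forall h : G -> 'Z_(p ^ n.+1),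
    continuous_hom (h : G -> discrete_topology 'Z_(p ^ n.+1)) -> ~ (forall y, exists z, h z = y).
Proof.
move=> [_ _ fG _ _]; have [P [f fm]] := quotient_finmodel fG; exists #|P| => h [hM hc] hS.
have [fM fS fK] := fm.
have hD z : nsub (closed_derived G) z -> h z = 1.
  suff H : closed_gen (commutators (G := G)) `<=` [set u | h u = 1] by exact: H.
  apply: closed_gen_min.
  - exact: (is_subgroup_preimage hM (@is_subgroup1 _)).
  - exact: continuous_ker_closed.
  - by move=> _ [a [b ->]]; rewrite /= (gmorphR hM); apply/eqP/commgP/(GRing.addrC (h a)).
pose k y := h (projT1 (cid (fS y))).
have kE z : k (f z) = h z.
  rewrite /k; case: cid => w /= /(finmodel_eq fm) /hD.
  by rewrite hM (gmorphV hM) => /(congr1 (fun u => h w * u)); rewrite mulVKg mulg1.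
have : (#|{: 'Z_(p ^ #|P|.+1)}| <= #|P|)%N.
  have kS y : exists u, k u = y by have [z <-] := hS y; exists (f z).
  pose e y := projT1 (cid (kS y)).
  have eK : cancel e k by move=> y; rewrite /e; case: cid.
  by apply: (@leq_card _ _ e); exact: can_inj eK.
rewrite card_Zpn// leqNgt => /negP; apply.
by apply: leq_trans (ltnSn _) _; apply: ltnW; apply: ltn_expl; exact: prime_gt1.
Qed.

Lemma schur_gen_by (G : topologicalGroupType) : is_schur_sigma p G -> exists d, gen_by G d.
Proof. by move=> [_ fgG _ _ _]; exact: finitely_generated_gen_by. Qed.

Lemma schur_copy g n (F : topologicalGroupType) (x r : 'I_g -> F) (s : F -> F) :
  free_pro_p p x -> top_group_iso s -> (forall i, s (x i) = (x i)^-1) ->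
  (forall j, inverted p s (r j)) ->
  (forall h : F -> 'Z_(p ^ n.+1),
    continuous_hom (h : F -> discrete_topology 'Z_(p ^ n.+1)) -> (forall j, h (r j) = 1) ->
    ~ (forall y, exists z, h z = y)) ->
  exists (G : schurGroup p),
    isomorphic (quotientGroup (normal_closure [set r j | j in [set: 'I_g]])) G.
Proof.
move=> F_free s_iso s_inv rX no_cyclic; set Q := quotientGroup _.
have prs := quotient_presents [set r j | j in [set: 'I_g]].
have sQ : is_schur_sigma p Q.
  apply: (@pres_schur p g n F Q x r s _ p_prime F_free s_iso s_inv _ _ prs no_cyclic).
    by move=> j; have [] := rX j.
  by move=> j; have [] := rX j.
have [d gd] := schur_gen_by sQ; have [pQ _ _ _ _] := sQ.
have [iota iota_inj] := pro_p_inject p_prime gd pQ.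
have [K [st [e [e' [eM eK e'K ec e'c]]]]] := set_copy_exists iota_inj.
have prK := presents_comp eM eK e'K ec e'c prs.
have sK : is_schur_sigma p (TopologicalGroup.Pack st).
  apply: (@pres_schur p g n F _ x r s _ p_prime F_free s_iso s_inv _ _ prK no_cyclic).
    by move=> j; have [] := rX j.
  by move=> j; have [] := rX j.
by exists (SchurGroup sK); apply/isomorphicP; exists e, e'.
Qed.

Lemma class_repr_iso (G : schurGroup p) : isomorphic (class_repr (iso_class G)) G.
Proof.
rewrite /class_repr; case: cid => H /= e.
suff : [set K : schurGroup p | isomorphic H K] G by [].
by rewrite -e /=; exact: isomorphic_refl.
Qed.

Lemma iso_classP (G H : schurGroup p) : isomorphic G H -> iso_class G = iso_class H.
Proof.
move=> GH; have e : [set K : schurGroup p | isomorphic G K] = [set K : schurGroup p | isomorphic H K].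
  apply/seteqP; split=> K /=; first exact: isomorphic_trans (isomorphic_sym GH).
  exact: isomorphic_trans GH.
rewrite /iso_class; move: (ex_intro _ _ _) (ex_intro _ _ _); rewrite e => u v.
by congr SchurClass; exact: Prop_irrelevance.
Qed.

(** Characters of G factor through Q_(c+1)(G), as P_1 of F_p is trivial. So the rank is read off any
    of these finite quotients. *)
Lemma dim_H1_nhom (G : topologicalGroupType) (P : finGroupType) (f : G -> P) c d :
  finmodel (lower_p_set p c.+1) f -> continuous (f : G -> discrete_topology P) ->
  dim_H1 p G d -> nhom p P = (p ^ d)%N.
Proof.
move=> fm fc [e [eZ ex]]; have [fM fS fK] := fm.
have factor (z : G -> ('F_p)^o) : Z1 z ->
    exists2 h : {ffun P -> 'F_p}, h \in homs p P & forall u, z u = h (f u).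
  move=> [zc zM].
  have [|h hM hE] := @model_factor p G 'F_p P f z c.+1 fm zM zc.
    by move=> y Ly; apply: (Fp_lower_p1 p_prime); apply: lower_p_le Ly.
  by exists (finfun h); [rewrite inE is_mor_ffun; apply/is_morP|move=> u; rewrite ffunE].
have pull (h : {ffun P -> 'F_p}) : h \in homs p P -> Z1 (h \o f : G -> ('F_p)^o).
  rewrite inE => /is_morP hM; split; first exact: (@continuous_op1 _ _ _ h).
  by move=> u v /=; rewrite fM hM.
pose comb (a : 'rV['F_p]_d) : G -> ('F_p)^o := (\sum_(i < d) a 0 i *: e i)%R.
have combE a u : comb a u = (\sum_(i < d) a 0 i * e i u)%R.
  rewrite /comb; elim/big_rec2: _ => [//|i y1 y2 _ <-]; by [].
have combZ a : Z1 (comb a).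
  split.
    have -> : comb a = (fun u => \sum_(i < d) a 0 i * e i u)%R by apply/funext => u; exact: combE.
    apply: (@continuous_sum _ p d (fun i u => a 0 i * e i u)%R) => i.
    by have [ec _] := eZ i; apply: (@continuous_op1 _ _ _ (fun t : 'F_p => a 0 i * t)%R).
  move=> u v; rewrite !combE -big_split; apply: eq_bigr => i _ /=.
  by have [_ ->] := eZ i; rewrite GRing.mulrDr.
have coords z : Z1 z -> exists2 a, z = comb a & forall b, z = comb b -> b = a.
  move=> Zz; have [a [/GRing.subr0_eq za ua]] := ex z Zz; exists a => // b zb.
  by apply/esym/ua; rewrite /B1 /= zb; exact: GRing.subrr.
have cV : #|{: 'rV['F_p]_d}| = (p ^ d)%N by rewrite card_mx card_Fp// mul1n.
apply/eqP; rewrite eqn_leq -cV; apply/andP; split.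
  pose co (h : {ffun P -> 'F_p}) : 'rV['F_p]_d := xget 0%R [set a | (h \o f : G -> 'F_p) = comb a].
  rewrite /nhom -(@card_in_imset _ _ co (homs p P)); first exact: max_card.
  move=> h h' hP h'P; have coE k : k \in homs p P -> (k \o f : G -> 'F_p) = comb (co k).
    move=> kP; apply: (@xgetPex _ 0%R [set a | (k \o f : G -> 'F_p) = comb a]).
    by have [a ha _] := coords _ (pull _ kP); exists a.
  move=> e1; apply/ffunP => y; have [u <-] := fS y.
  by have := congr1 (fun k => k u) (coE _ hP); rewrite e1 -(coE _ h'P).
pose bk a := projT1 (cid2 (factor _ (combZ a))).
have bkP a : bk a \in homs p P /\ forall u, comb a u = bk a (f u).
  by rewrite /bk; case: cid2.
have bkI : injective bk.
  move=> a b ab; have [c1 _ uc] := coords _ (combZ a).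
  rewrite (uc a erefl); apply/esym/uc/funext => u.
  by rewrite (bkP a).2 (bkP b).2 ab.
rewrite -(card_imset _ bkI); apply: subset_leq_card; apply/fintype.subsetP => _ /imsetP[a _ ->].
exact: (bkP a).1.
Qed.

End SchurFacts.

(** * Numerical codes for the quotients Q_c, and measurability *)

Section Codes.
Variable p : nat.
Hypotheses (p_prime : prime p) (p_odd : odd p).
Implicit Types C : schurClass p.

Lemma class_has_model C c : exists P : finGroupType,
  has_model p (class_repr C) c P /\ p.-group [set: P]%SET.
Proof.
have sC := schur_groupP (class_repr C); have [d gd] := schur_gen_by sC.
have [pC _ _ _ _] := sC; have [P [f [fm pP fc _]]] := lower_p_model p_prime c gd pC.
by exists P; split=> //; exists f.
Qed.

Definition cmodel c C : finGroupType := projT1 (cid (class_has_model C c)).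
Lemma cmodelP c C : has_model p (class_repr C) c (cmodel c C).
Proof. by rewrite /cmodel; case: cid => P []. Qed.
Lemma pgroup_cmodel c C : p.-group [set: cmodel c C]%SET.
Proof. by rewrite /cmodel; case: cid => P []. Qed.

(** Numbers instead of groups make the unions over isomorphism types countable: by
    [code_invariant_measurable], every set that only depends on Q_c is measurable. *)
Definition ccode c C : nat := gcode (cmodel c C).

Lemma ccodeP c C (P : finGroupType) :
  ccode c C = gcode P <-> has_model p (class_repr C) c P.
Proof.
split=> [/gcode_iso PC|PC].
  exact: has_model_fin_iso PC (cmodelP c C).
exact/gcode_iso/(models_iso (cmodelP c C) PC).
Qed.

Lemma model_lower (G : topologicalGroupType) (P : finGroupType) (k : G -> P) b c :
  (b <= c)%N -> finmodel (lower_p_set p c) k -> continuous (k : G -> discrete_topology P) ->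
  forall x, lower_p_set (G := discrete_topology P) p b (k x) <-> lower_p_set p b x.
Proof.
move=> bc fm kc x; have [kM kS kK] := fm; split; last by apply: (@lower_p_hom p _ (discrete_topology P)); split.
move=> /(lower_p_lift kM kS)[u Lu /(finmodel_eq fm) ux].
have [_ LM _] := @lower_p_set_subgroup G p b.
by rewrite -(mulKVg u x); apply: LM => //; apply: lower_p_le ux.
Qed.

Lemma ccode_le b c C C' : (b <= c)%N -> ccode c C = ccode c C' -> ccode b C = ccode b C'.
Proof.
move=> bc /ccodeP [k [km kc]]; have [k' [k'm k'c]] := cmodelP c C'.
have [f [fm fc]] := cmodelP b C'; have [fM fS fK] := fm; have [kM kS kK] := km.
have [k'M k'S k'K] := k'm.
have [|m mM mE] := model_factor k'm fM fc.
  by move=> y Ly; apply: (model_lower_p1 fm); apply: lower_p_le Ly.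
apply/ccodeP; exists (m \o k); split; last exact: (@continuous_op1 _ _ _ m).
split=> [x y|y|x] /=.
- by rewrite kM mM.
- have [z <-] := fS y; have [x kx] := kS (k' z); exists x; by rewrite kx mE.
- rewrite -(model_lower bc km kc); have [z kz] := k'S (k x).
  by rewrite -kz -mE fK (model_lower bc k'm k'c).
Qed.

Lemma ccode_measurable c n : measurable ([set C | ccode c C = n] : set (schurSpace p)).
Proof.
have [[C0 C0n]|nC] := pselect (exists C0, ccode c C0 = n); last first.
  by rewrite (_ : [set C | _] = set0)//; apply/seteqP; split=> // C Cn; apply: nC; exists C.
apply: sub_sigma_algebra; exists (cmodel c C0), c; split; first exact: pgroup_cmodel.
apply/seteqP; split=> C /=; rewrite -C0n => H.
  exact/has_modelP/ccodeP.
exact/ccodeP/has_modelP.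
Qed.

Lemma code_invariant_measurable c (A : set (schurSpace p)) :
  (forall C C', ccode c C = ccode c C' -> A C -> A C') -> measurable A.
Proof.
move=> Ainv.
have -> : A = \bigcup_(n in [set n | exists2 C, A C & ccode c C = n]) [set C | ccode c C = n].
  apply/seteqP; split=> [C AC|C [n [C' AC' C'n] /= Cn]]; first by exists (ccode c C) => //; exists C.
  by apply: (Ainv C' C); rewrite ?C'n.
by apply: bigcup_measurable => n _; exact: ccode_measurable.
Qed.

Lemma code_fun_measurable c d (T : measurableType d) (g : schurSpace p -> T) :
  (forall C C', ccode c C = ccode c C' -> g C = g C') -> measurable_fun setT g.
Proof.
move=> ginv _ A mA; rewrite setTI; apply: (@code_invariant_measurable c) => C C' CC' /=.
by rewrite (ginv _ _ CC').
Qed.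

Lemma cmodel_fin_iso c C C' : ccode c C = ccode c C' ->
  exists e : cmodel c C -> cmodel c C', {morph e : x y / x * y} /\ bijective e.
Proof. by move/gcode_iso. Qed.

Lemma schur_rank_exists C : exists d, schur_rank d C.
Proof. by have [_ _ _ [d [dC _]] _] := schur_groupP (class_repr C); exists d. Qed.

Lemma schur_rank_nhom d c C : schur_rank d C -> nhom p (cmodel c.+1 C) = (p ^ d)%N.
Proof. by move=> dC; have [f [fm fc]] := cmodelP c.+1 C; exact: (dim_H1_nhom p_prime fm fc dC). Qed.

Lemma nhom_fin_iso (P P' : finGroupType) (e : P -> P') :
  {morph e : x y / x * y} -> bijective e -> nhom p P = nhom p P'.
Proof.
move=> eM [e' eK e'K].
have e'M : {morph e' : x y / x * y} by move=> x y; apply: (can_inj eK); rewrite eM !e'K.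
apply/eqP; rewrite eqn_leq; apply/andP; split.
  by apply: (nhom_surj p e'M) => x; exists (e x).
by apply: (nhom_surj p eM) => y; exists (e' y).
Qed.

Lemma schur_rank_code c d C C' : ccode c.+1 C = ccode c.+1 C' -> schur_rank d C -> schur_rank d C'.
Proof.
move=> /cmodel_fin_iso[e [eM eb]] dC; have [d' d'C'] := schur_rank_exists C'.
have := nhom_fin_iso eM eb; rewrite (schur_rank_nhom c dC) (schur_rank_nhom c d'C').
by move=> /eqP; rewrite eqn_exp2l ?prime_gt1// => /eqP ->.
Qed.

Lemma schur_rank_measurable d : measurable (schur_rank d : set (schurSpace p)).
Proof. by apply: (@code_invariant_measurable 1) => C C'; exact: schur_rank_code. Qed.

Lemma cmodel_GI c C : exists2 t : cmodel c C -> cmodel c C, GI t &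
  forall (R : realType) (H : finGroupType) (tau : discrete_topology H -> discrete_topology H),
    (forall y : discrete_topology H, lower_p_set p c y -> y = 1) ->
    card_Sur R tau C = (nsur t (tau : H -> H))%:R%:E.
Proof.
have [f [fm fc]] := cmodelP c C.
have sGI : GI_automorphism (@schur_sigma p (class_repr C)) by rewrite /schur_sigma; case: cid.
have [t tGI tE] := induced_GI sGI fm fc; exists t => // R H tau Htriv.
exact: counting_card (Sur_sigma_model tau fm fc tE Htriv).
Qed.

Definition cgi c C : cmodel c C -> cmodel c C := projT1 (cid2 (cmodel_GI c C)).
Lemma cgiP c C : GI (@cgi c C). Proof. by rewrite /cgi; case: cid2. Qed.
Lemma card_SurE (R : realType) c C (H : finGroupType) (tau : discrete_topology H -> discrete_topology H) :
  (forall y : discrete_topology H, lower_p_set p c y -> y = 1) ->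
  card_Sur R tau C = (nsur (@cgi c C) (tau : H -> H))%:R%:E.
Proof. by rewrite /cgi; case: cid2 => t tGI tE; exact: tE. Qed.

(** An isomorphism carries one GI-automorphism to another, possibly different from the chosen one,
    but conjugate to it by [GI_conjugate]. *)
Lemma nsur_code c C C' (H : finGroupType) (tau : H -> H) : ccode c C = ccode c C' ->
  nsur (@cgi c C) tau = nsur (@cgi c C') tau.
Proof.
move=> /cmodel_fin_iso[e [eM [e' eK e'K]]].
pose s y := e (cgi (e' y)).
have e'M : {morph e' : x y / x * y} by move=> x y; apply: (can_inj eK); rewrite eM !e'K.
rewrite (@nsur_iso _ _ _ s _ tau e eM) //; [|by exists e'|by move=> x; rewrite /s eK].
apply: (@nsur_GI p p_prime _ s (@cgi c C') p_odd (pgroup_cmodel c C')); last exact: cgiP.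
have [gM [A gA tA]] := cgiP c C; split; first by move=> x y; rewrite /s e'M gM eM.
exists [set e x | x in A]%SET; last first.
  by move=> _ /imsetP[x xA ->]; rewrite /s eK tA// (gmorphV eM).
have gMP : is_subgroup (e @^-1` [set y | y \in <<[set e x | x in A]%SET>>]).
  by apply: is_subgroup_preimage => //; exact: (is_subgroup_group <<_>>%G).
have Ae : <<A>> \subset Group (group_set_of gMP).
  rewrite gen_subG; apply/fintype.subsetP => x xA; rewrite inE; apply/asboolP => /=.
  by apply/mem_gen/imset_f.
apply/setP => y; rewrite [in RHS]inE -(e'K y).
have /(fintype.subsetP Ae) : e' y \in <<A>> by rewrite gA inE.
by rewrite inE => /asboolP.
Qed.

End Codes.

(** * An alternating sieve *)

Section Sieve.
Import Order.TTheory GRing.Theory Num.Theory.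
Local Open Scope ring_scope.
Variables (R : realType) (p : nat).
Hypothesis p2 : (2 < p)%N.
Local Notation P := (p%:R : R).
Local Notation q := (p%:R^-1 : R).

(** This is (-1)^k p^(k(k-1)/2) / |GL_k(F_p)|. The product of the p^m - p^i for i < k counts the
    surjections F_p^m -> F_p^k, so the sieve is Möbius inversion in the lattice of subspaces, which
    detects m = 0. *)
Definition sieve_coef (k : nat) : R := \prod_(j < k) (- (P ^+ j.+1 - 1)^-1).

Lemma p_gt0 : 0 < P. Proof. by rewrite ltr0n; lia. Qed.
Lemma q_ge0 : 0 <= q. Proof. by rewrite invr_ge0 ler0n. Qed.
Lemma q_lt1 : q <= 2^-1.
Proof. by rewrite lef_pV2 ?posrE ?ltr0n ?ler_nat//; lia. Qed.

(** This rests on p >= 3 and is the source of the ratio 1/2 in all error terms below. *)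
Lemma pX_sub1_ge2 j : 2 <= P ^+ j.+1 - 1.
Proof.
rewrite lerBrDr (_ : 2 + 1 = 3%:R) -?natrX ?ler_nat; last by rewrite -[RHS]natr1.
by rewrite (leq_trans p2)// -{1}(expn1 p) leq_exp2l//; lia.
Qed.

Lemma pX_sub1_neq0 j : P ^+ j.+1 - 1 != 0.
Proof. by rewrite gt_eqF// (lt_le_trans _ (pX_sub1_ge2 j)). Qed.

Lemma sieve_coefS k : sieve_coef k.+1 = - (sieve_coef k / (P ^+ k.+1 - 1)).
Proof. by rewrite /sieve_coef big_ord_recr /= mulrN. Qed.

Lemma normr_sieve_coef k : `|sieve_coef k| <= 2^-1 ^+ k.
Proof.
elim: k => [|k IHk]; first by rewrite /sieve_coef big_ord0 normr1 expr0.
rewrite sieve_coefS normrN normrM [2^-1 ^+ _]exprSr; apply: ler_pM => //.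
have h := pX_sub1_ge2 k; rewrite normfV ger0_norm; last by apply: le_trans h.
by rewrite lef_pV2 ?posrE// (lt_le_trans _ h).
Qed.

(* The partial sums of the sieve vanish at y = p, ..., p^K. *)
Lemma sieve_identity K (y : R) :
  \sum_(k < K.+1) sieve_coef k * \prod_(i < k) (y - P ^+ i) =
  sieve_coef K * \prod_(j < K) (y - P ^+ j.+1).
Proof.
elim: K => [|K IHK]; first by rewrite big_ord_recl !big_ord0 addr0.
rewrite big_ord_recr /= IHK [in X in _ + X]big_ord_recl big_ord_recr /= sieve_coefS expr0.
set A := \prod_(j < K) _.
have := pX_sub1_neq0 K; set b := P ^+ K.+1 => b1.
rewrite (_ : sieve_coef K * A = sieve_coef K / (b - 1) * A * (b - 1)); last first.
  by rewrite mulrAC divfK.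
rewrite mulNr mulrCA [in X in _ + X]mulrC.
rewrite mulNr mulrA -mulrBr.
rewrite -mulrN; congr (_ * _); lra.
Qed.

Definition sieve_sum (K : nat) (x : R) : R := \sum_(k < K.+1) sieve_coef k * x ^+ k.

(** The truncated form of the functional equation S(x) = (1 - q x) S(q x), which characterizes the
    product of the 1 - q^j x over j >= 1. *)
Lemma sieve_sum_step K x : sieve_sum K x - (1 - q * x) * sieve_sum K (q * x) =
  sieve_coef K * (q * x) ^+ K.+1.
Proof.
elim: K => [|K IHK].
  by rewrite /sieve_sum !big_ord_recl !big_ord0 /= /sieve_coef big_ord0 !addr0 !expr0 !mulr1 expr1; lra.
rewrite /sieve_sum big_ord_recr [in X in _ - X]big_ord_recr /= -/(sieve_sum K x) -/(sieve_sum K (q * x)).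
have P0 : P != 0 by rewrite gt_eqF// p_gt0.
have e : sieve_coef K * (q * x) ^+ K.+1 = - (sieve_coef K.+1 * x ^+ K.+1) + sieve_coef K.+1 * (q * x) ^+ K.+1.
  rewrite -mulrN -mulrDr sieve_coefS exprMn exprVn mulNr.
  have := pX_sub1_neq0 K; have : P ^+ K.+1 != 0 by rewrite expf_neq0.
  set b := P ^+ K.+1; set y := x ^+ K.+1 => b0 b1.
  rewrite (_ : - y + b^-1 * y = - ((b - 1) * (b^-1 * y))); last first.
    by rewrite mulrBl mul1r mulVKf//; lra.
  by rewrite mulrN opprK [RHS]mulrA divfK.
move: IHK; rewrite e [(q * x) ^+ K.+2]exprS.
set S := sieve_sum K x; set S' := sieve_sum K (q * x); set c := sieve_coef K.+1.
set z := (q * x); set t := x ^+ K.+1; set u := z ^+ K.+1 => IHK.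
rewrite mulrDr opprD addrACA IHK mulrBl mul1r.
rewrite [z * (c * u)]mulrCA; lra.
Qed.

Lemma sieve_sum_near1 K (x : R) : 0 <= x <= 1 -> `|sieve_sum K x - 1| <= x.
Proof.
move=> /andP[x0 x1]; rewrite /sieve_sum big_ord_recl {1}/sieve_coef big_ord0 expr0 mulr1 addrC addKr.
have h : forall n, `|\sum_(i < n) sieve_coef (lift ord0 i) * x ^+ (lift ord0 i)| <= x * (1 - 2^-1 ^+ n).
  elim=> [|n IHn]; first by rewrite big_ord0 normr0 expr0 subrr mulr0.
  rewrite big_ord_recr /=; apply: le_trans (ler_normD _ _) _.
  apply: le_trans (lerD IHn _) _.
    by rewrite normrM [X in _ * X]ger0_norm ?exprn_ge0//; exact: (lexx (`|sieve_coef n.+1| * x ^+ n.+1)).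
  have a := normr_sieve_coef n.+1.
  have b : x ^+ n.+1 <= x by rewrite exprS ler_piMr// exprn_ile1.
  have d : `|sieve_coef n.+1| * x ^+ n.+1 <= 2^-1 ^+ n.+1 * x by apply: ler_pM => //; exact: exprn_ge0.
  apply: le_trans (lerD (lexx _) d) _; rewrite [X in _ + X]mulrC -mulrDr.
  by rewrite ler_wpM2l// exprS; lra.
apply: le_trans (h K) _; rewrite ler_piMr// lerBlDr lerDl; exact: exprn_ge0.
Qed.

(** The functional equation is iterated D times, each time with defect at most 2^(-K); the remaining
    factor S(q^D x) is within q^D x of 1. *)
Lemma sieve_sum_prod K D (x : R) : 0 <= x <= 1 ->
  `|sieve_sum K x - \prod_(j < D) (1 - q ^+ j.+1 * x)| <= q ^+ D * x + D%:R * 2^-1 ^+ K.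
Proof.
elim: D x => [|D IHD] x x01.
  by rewrite big_ord0 expr0 mul1r mul0r addr0; exact: sieve_sum_near1.
have /andP[x0 x1] := x01; have := q_ge0; have := q_lt1; move=> q1 q0.
have qx : 0 <= q * x <= 1 by rewrite mulr_ge0//= mulr_ile1//; lra.
have /andP[qx0 qx1] := qx.
rewrite big_ord_recl expr1; have e := sieve_sum_step K x.
rewrite (_ : \prod_(i < D) _ = \prod_(j < D) (1 - q ^+ j.+1 * (q * x))); last first.
  by apply: eq_bigr => i _; rewrite exprSr mulrA.
set Pi := \prod_(j < D) _.
rewrite (_ : sieve_sum K x - _ = sieve_coef K * (q * x) ^+ K.+1 + (1 - q * x) * (sieve_sum K (q * x) - Pi)); last first.
  by rewrite -e mulrBr; lra.
apply: le_trans (ler_normD _ _) _; rewrite !normrM.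
have a : `|sieve_coef K| * `|(q * x) ^+ K.+1| <= 2^-1 ^+ K * 1.
  apply: ler_pM => //; first exact: normr_sieve_coef.
  by rewrite ger0_norm ?exprn_ile1 ?exprn_ge0.
have b : `|1 - q * x| * `|sieve_sum K (q * x) - Pi| <= 1 * (q ^+ D * (q * x) + D%:R * 2^-1 ^+ K).
  apply: ler_pM => //; last exact: IHD.
  by rewrite ger0_norm; lra.
apply: le_trans (lerD a b) _; rewrite mulr1 mul1r exprSr -[D.+1%:R]natr1 mulrDl mul1r -mulrA; lra.
Qed.

Lemma cvg_half : (GRing.exp (2^-1 : R)) @ \oo --> (0 : R).
Proof. by apply: cvg_expr; rewrite ger0_norm; lra. Qed.

Lemma eulerian_limit (x I : R) : 0 <= x <= 1 ->
  (forall K, `|sieve_sum K x - I| <= 2^-1 ^+ K) ->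
  (fun D => \prod_(j < D) (1 - q ^+ j.+1 * x)) @ \oo --> I.
Proof.
move=> x01 HI; have /andP[x0 x1] := x01; have := q_ge0; have := q_lt1; move=> q1 q0.
(* For fixed D, letting K tend to infinity removes the terms in 2^(-K) and leaves q^D x, at most
   2^(-D). *)
have H D : `|I - \prod_(j < D) (1 - q ^+ j.+1 * x)| <= 2^-1 ^+ D.
  set Pi := \prod_(j < D) _.
  have h : (fun K => 2^-1 ^+ D + (D.+1%:R * 2^-1 ^+ K) : R) @ \oo --> (2^-1 ^+ D + D.+1%:R * 0 : R).
    by apply: cvgD; [exact: cvg_cst|apply: cvgM; [exact: cvg_cst|exact: cvg_half]].
  rewrite mulr0 addr0 in h; apply: (cvgr_to_ge h); apply: nearW => K; rewrite (_ : I - Pi = (sieve_sum K x - Pi) - (sieve_sum K x - I)); last by lra.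
  apply: le_trans (ler_normB _ _) _.
  apply: le_trans (lerD (sieve_sum_prod K D x01) (HI K)) _.
  rewrite -[D.+1%:R]natr1 mulrDl mul1r addrA lerD2r lerD2r.
  rewrite -[leRHS]mulr1; apply: ler_pM; rewrite ?exprn_ge0//.
  by apply: lerXn2r; rewrite ?nnegrE//; lra.
apply/cvgrPdist_le => e e0; have := cvg_half => /cvgrPdist_le /(_ e e0).
apply: filterS => D; rewrite sub0r normrN => h; apply: le_trans (H D) _.
by apply: le_trans h; exact: ler_norm.
Qed.

(** With E_n the product of the 1 - p^(-k) for k <= n, the order of GL_g(F_p) is p^(g^2) E_g. Hence
    mu_CL(g) |GL_g(F_p)| is the infinite product divided by E_g, that is, the product over k > g. *)
Lemma mu_CL_prod g (I : R) :
  (fun D => \prod_(j < D) (1 - q ^+ j.+1 * q ^+ g)) @ \oo --> I ->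
  mu_CL R p g * \prod_(i < g) (P ^+ g - P ^+ i) = I.
Proof.
move=> cI; pose E n : R := \prod_(1 <= i < n.+1) (1 - P ^- i).
have P0 : P != 0 by rewrite gt_eqF// p_gt0.
have E0 n : E n != 0.
  rewrite /E big_add1 big_mkord; apply/prodf_neq0 => i _.
  rewrite subr_eq0 eq_sym -exprVn lt_eqF//.
  by rewrite exprn_ilt1 ?q_ge0//; have := q_lt1; lra.
have EgD D : E (D + g)%N = E g * \prod_(j < D) (1 - q ^+ j.+1 * q ^+ g).
  elim: D => [|D IHD]; first by rewrite big_ord0 mulr1.
  rewrite addSn /E big_nat_recr//= -/(E (D + g)%N) IHD big_ord_recr /= -mulrA.
  by rewrite -exprD -exprVn addSn.
have cE : E @ \oo --> E g * I.
  rewrite -(cvg_shiftn g) (_ : (fun n => _) = (fun D => E g * \prod_(j < D) (1 - q ^+ j.+1 * q ^+ g))).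
    by apply: cvgM => //; exact: cvg_cst.
  by apply/funext => D; exact: EgD.
have -> : \prod_(i < g) (P ^+ g - P ^+ i) = P ^+ (g ^ 2) * E g.
  rewrite /E big_add1 big_mkord /= (reindex_inj rev_ord_inj) /=.
  rewrite (_ : P ^+ (g ^ 2) = \prod_(i < g) P ^+ g) -?big_split; last first.
    by rewrite prodr_const card_ord -exprM mulnn.
  apply: eq_bigr => i _ /=; rewrite mulrBr mulr1 -exprVn; congr (_ - _).
  rewrite expfB_cond; first by rewrite exprVn.
  by rewrite (negbTE P0) add0n.
rewrite /mu_CL -/E (cvg_lim _ cE)// prodfV prodrXl.
rewrite -/(E g); have := E0 g; have : P ^+ (g ^ 2) != 0 by rewrite expf_neq0.
set a := P ^+ _; set b := E g => a0 b0.
rewrite [LHS]((@GRing.mul R).[AC ((2*2)*2) (((1*5)*((6*3)*2))*4)]) mulVf// mul1r -expr2 divff ?mul1r//.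
by rewrite expf_neq0.
Qed.

Lemma falling_ge0 m k : 0 <= \prod_(i < k) (P ^+ m - P ^+ i).
Proof.
have [km|mk] := leqP k m.
  apply: prodr_ge0 => i _; rewrite subr_ge0 ler_weXn2l ?ler1n//; first by lia.
  by apply: ltnW; apply: leq_trans (ltn_ord i) km.
by rewrite (bigD1 (Ordinal mk))//= subrr mul0r.
Qed.

(** The Bonferroni bound: for m > 0, [sieve_identity] expresses the partial sum through the factors
    p^m - p^(j+1), which are dominated by p^m - p^j. Past K = m both sides vanish. *)
Lemma sieve_error m K :
  `|\sum_(k < K.+1) sieve_coef k * \prod_(i < k) (P ^+ m - P ^+ i) - (m == 0%N)%:R|
    <= `|sieve_coef K| * \prod_(i < K) (P ^+ m - P ^+ i).
Proof.
have p1 : 1 <= P by rewrite ler1n; lia.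
case: m => [|m].
  have z k : \prod_(i < k.+1) (P ^+ 0 - P ^+ i) = 0 by rewrite big_ord_recl !expr0 subrr mul0r.
  rewrite [\sum_(_ < _) _]big_ord_recl [\sum_(_ < _) _]big1 => [|i _]; last by rewrite z mulr0.
  rewrite addr0.
  rewrite /sieve_coef !big_ord0 mul1r subrr normr0.
  by rewrite mulr_ge0//; exact: falling_ge0.
rewrite subr0 sieve_identity normrM ler_wpM2l//.
have [Km|mK] := leqP K m.+1; last first.
  have mK' : (m < K)%N by exact: ltnW.
  by rewrite (bigD1 (Ordinal mK'))//= subrr mul0r normr0 falling_ge0.
have h (i : 'I_K) : (i < m.+1)%N by apply: leq_trans (ltn_ord i) Km.
rewrite ger0_norm; last by apply: prodr_ge0 => i _; rewrite subr_ge0 ler_weXn2l.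
by apply: ler_prod => i _; rewrite subr_ge0 ler_weXn2l//= lerD2l lerN2 ler_weXn2l.
Qed.

(** Integrating [sieve_error] against f bounds the error by |c_K| q^(g K), hence by 2^(-K); only
    moments given by hypothesis occur. The limit is then supplied by [eulerian_limit] and
    [mu_CL_prod]. *)
Lemma sieve_integral d (T : measurableType d) (nu : {measure set T -> \bar R})
    (f m : T -> nat) g :
  let F k t : R := (f t)%:R * \prod_(i < k) (P ^+ m t - P ^+ i) in
  let G t : R := (f t)%:R * (m t == 0%N)%:R in
  (forall k, measurable_fun setT (F k)) -> measurable_fun setT G ->
  (forall k, (\int[nu]_t (F k t)%:E = ((q ^+ g) ^+ k)%:E)%E) ->
  (\int[nu]_t (G t)%:E = (mu_CL R p g * \prod_(i < g) (P ^+ g - P ^+ i))%:E)%E.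
Proof.
move=> F G mF mG intF.
have F0 k t : 0 <= F k t by rewrite mulr_ge0// falling_ge0.
have iF k : nu.-integrable setT (EFin \o F k).
  apply/integrableP; split; first exact/measurable_EFinP.
  under eq_integral do rewrite /= ger0_norm//.
  by rewrite intF ltry.
have iG : nu.-integrable setT (EFin \o G).
  apply: (le_integrable measurableT _ _ (iF 0%N)); first exact/measurable_EFinP.
  move=> t _ /=; rewrite lee_fin !ger0_norm ?mulr_ge0 ?falling_ge0//.
  by rewrite /F /G big_ord0; apply: ler_wpM2l => //; case: (m t == 0%N).
have RF k : \int[nu]_t F k t = (q ^+ g) ^+ k by rewrite /Rintegral intF.
pose S n t := \sum_(k < n) sieve_coef k * F k t.
have icF k : nu.-integrable setT (EFin \o (fun t => sieve_coef k * F k t)).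
  have := @integrableZl _ _ _ nu setT measurableT (sieve_coef k) _ (iF k).
  by apply: eq_integrable => // t _ /=; rewrite EFinM.
have [iS RS] : (forall n, nu.-integrable setT (EFin \o S n)) /\
    (forall n, \int[nu]_t S n t = \sum_(k < n) sieve_coef k * (q ^+ g) ^+ k).
  apply/all_and2; elim=> [|n [iSn RSn]].
    have S0 : S 0%N = cst 0 by apply/funext => t; rewrite /S big_ord0.
    rewrite S0 big_ord0; split; first exact: (integrable0 nu).
    by rewrite Rintegral_cst// mul0r.
  have SE : S n.+1 = (fun t => S n t + sieve_coef n * F n t).
    by apply/funext => t; rewrite /S big_ord_recr.
  rewrite SE; split.
    have := integrableD measurableT iSn (icF n).
    by apply: eq_integrable => // t _ /=; rewrite EFinD.
  by rewrite RintegralD// RSn big_ord_recr RintegralZl// RF.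
set I := \int[nu]_t G t.
have IE : (\int[nu]_t (G t)%:E)%E = I%:E.
  by rewrite /I /Rintegral fineK//; exact: integrable_fin_num.
have q01 : 0 <= q ^+ g <= 1.
  by rewrite exprn_ge0 ?q_ge0//= exprn_ile1 ?q_ge0//; have := q_lt1; lra.
have /andP[qg0 qg1] := q01.
rewrite IE; congr _%:E; apply/esym/mu_CL_prod/eulerian_limit => // K.
rewrite /sieve_sum -RS /I -RintegralB//.
have iD : nu.-integrable setT (EFin \o (fun t => S K.+1 t - G t)).
  have := integrableB measurableT (iS K.+1) iG.
  by apply: eq_integrable => // t _ /=; rewrite EFinB.
apply: le_trans (le_normr_Rintegral measurableT iD) _.
apply: (@le_trans _ _ (\int[nu]_t (`|sieve_coef K| * F K t))).
  apply: le_Rintegral => //.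
  - have := integrable_abse iD; by apply: eq_integrable.
  - have := @integrableZl _ _ _ nu setT measurableT `|sieve_coef K| _ (iF K).
    by apply: eq_integrable => // t _ /=; rewrite EFinM.
  - move=> t _; rewrite /S /F /G.
    under eq_bigr do rewrite mulrCA.
    rewrite -mulr_sumr -mulrBr normrM ger0_norm// mulrCA ler_wpM2l//.
    exact: sieve_error.
rewrite RintegralZl// RF -[leRHS]mulr1; apply: ler_pM => //.
- exact: normr_sieve_coef.
- by rewrite exprn_ile1.
Qed.

End Sieve.

(** * Moments determine the measure *)

Section Uniqueness.
Variable p : nat.
Hypotheses (p_prime : prime p) (p_odd : odd p).
Implicit Types C : schurClass p.

Let p_gt2 : (2 < p)%N. Proof. exact: odd_prime_gt2. Qed.

Definition crank C : nat := projT1 (cid (schur_rank_exists C)).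
Lemma crankP C : schur_rank (crank C) C. Proof. by rewrite /crank; case: cid. Qed.

Lemma crank_nhom c C : nhom p (cmodel p_prime c.+1 C) = (p ^ crank C)%N.
Proof. exact: (schur_rank_nhom p_prime c (crankP C)). Qed.

Lemma schur_rankE d C : schur_rank d C <-> crank C = d.
Proof.
split=> [dC|<-]; last exact: crankP.
have := crank_nhom 0 C; rewrite (schur_rank_nhom p_prime 0 dC).
by move=> /eqP; rewrite eqn_exp2l ?prime_gt1// => /eqP.
Qed.

Lemma crank_code c C C' : ccode p_prime c.+1 C = ccode p_prime c.+1 C' -> crank C = crank C'.
Proof. by move=> /schur_rank_code/(_ (crankP C)); rewrite schur_rankE => ->. Qed.

(** Rank d gives d generators by [nhom_gens]. This bound is what lets the downward induction of
    [rank_code_determined] start. *)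
Lemma card_cmodel_bound c d C : schur_rank d C ->
  (#|cmodel p_prime c.+1 C| <= lower_p_bound p d c.+1)%N.
Proof.
move=> dC; set P := cmodel _ _ _.
have pP : p.-group [set: P]%SET by exact: pgroup_cmodel.
have [s [sd sP]] := nhom_gens p_prime pP (schur_rank_nhom p_prime c dC).
have gP : gen_by (discrete_topology P) d.
  exists (nth 1 s); apply/seteqP; split=> // y _.
  have : <<[set x in s]%SET>> \subset Group (group_set_of (@closed_gen_subgroup (discrete_topology P) [set nth 1 s i | i in `I_d])).
    rewrite gen_subG; apply/fintype.subsetP => x; rewrite inE => xs; rewrite inE; apply/asboolP.
    apply: sub_closed_gen; exists (index x s); last by rewrite nth_index.
    by rewrite /=; apply: leq_trans sd; rewrite index_mem.
  rewrite sP => /fintype.subsetP/(_ y); rewrite finset.in_setT => /(_ isT).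
  by rewrite inE => /asboolP.
have [t tP] := lower_p_cosets c.+1 (prime_gt0 p_prime) gP.
have [f [fm _]] := cmodelP p_prime c.+1 C.
have sub : {subset [set: P]%SET <= [seq t i | i <- iota 0 (lower_p_bound p d c.+1)]}.
  move=> y _; have [i [ib /(model_lower_p1 fm) ty]] := tP y I.
  apply/mapP; exists i; first by rewrite mem_iota.
  by move: ty => /(congr1 (fun z => t i * z)); rewrite mulKVg mulg1.
rewrite -cardsT cardE; apply: leq_trans (uniq_leq_size (enum_uniq _) _) _.
  by move=> y; rewrite mem_enum; exact: sub.
by rewrite size_map size_iota.
Qed.

Lemma trivial_lower_p (H : finGroupType) : p.-group [set: H]%SET ->
  exists c, forall b, (c <= b)%N -> forall y : discrete_topology H, lower_p_set p b y -> y = 1.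
Proof.
move=> pH; have [c cH] := lower_p_finite p_prime pH; exists c => b cb y Ly.
by apply: cH; apply: lower_p_le Ly.
Qed.

Section CardSur.
Import Order.TTheory GRing.Theory Num.Theory.
Variables (R : realType) (H : finGroupType) (tau : discrete_topology H -> discrete_topology H).
Hypothesis pH : p.-group [set: H]%SET.

Lemma card_Sur_ge0 (C : schurSpace p) : (0 <= card_Sur R tau C)%E.
Proof.
have [c cH] := trivial_lower_p pH.
by rewrite (card_SurE p_prime R _ _ (cH c (leqnn c))) lee_fin.
Qed.

Lemma card_Sur_measurable (D : set (schurSpace p)) :
  measurable_fun D (card_Sur R tau : schurSpace p -> \bar R).
Proof.
have [c cH] := trivial_lower_p pH; have {}cH := cH c (leqnn c).
apply: measurable_funTS; apply: (@code_fun_measurable p p_prime c) => C C' CC'.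
by rewrite !(card_SurE p_prime R _ _ cH); congr (_%:R%:E); exact: nsur_code.
Qed.

End CardSur.

Section Moments.
Import Order.TTheory GRing.Theory Num.Theory.
Variables (R : realType) (nu : {measure set (schurSpace p) -> \bar R}%R).
Hypothesis nu_moments : forall (H : finGroupType) (tau : discrete_topology H -> discrete_topology H),
  p.-group [set: H]%SET -> GI_automorphism tau ->
  (\int[nu]_(C in [set: schurSpace p]) card_Sur R tau C = 1)%E.

Lemma rank_moment (H : finGroupType) (tau : discrete_topology H -> discrete_topology H) d :
  p.-group [set: H]%SET -> GI_automorphism tau -> nhom p H = (p ^ d)%N ->
  (\int[nu]_(C in schur_rank d) card_Sur R tau C =
   (mu_CL R p d * \prod_(i < d) (p%:R ^+ d - p%:R ^+ i))%:E)%E.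
Proof.
move=> pH tauGI hH; have tGI := (GI_automorphismP tau).1 tauGI.
have [c cH] := trivial_lower_p pH.
(* The level is [c.+1] so that the rank can be read off the same quotient. *)
pose f C := nsur (@cgi p p_prime c.+1 C) (tau : H -> H).
(* The truncation of the subtraction is harmless: by [rkd], [f C] vanishes when the rank is below
   d. *)
pose m C := (crank C - d)%N.
have fE C : card_Sur R tau C = (f C)%:R%:E by apply: card_SurE; exact: cH.
have rkd C : (0 < f C)%N -> (d <= crank C)%N.
  move=> /(nsur_gt0_nhom p); rewrite crank_nhom hH leq_exp2l//.
  exact: prime_gt1.
have fallE k n : ((\prod_(i < k) (p ^ n - p ^ i))%N%:R)%R = (\prod_(i < k) ((p%:R : R) ^+ n - p%:R ^+ i))%R.
  have [kn|nk] := leqP k n.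
    rewrite natr_prod; apply: eq_bigr => i _; rewrite natrB ?natrX// leq_exp2l ?prime_gt1//.
    by apply: ltnW; apply: leq_trans (ltn_ord i) kn.
  by rewrite (bigD1 (Ordinal nk))//= subnn mul0n [RHS](bigD1 (Ordinal nk))//= subrr mul0r.
have extE k C : card_Sur R (ext_aut (p := p) (tau : H -> H) (k := k) : discrete_topology (ext p H k) -> discrete_topology (ext p H k)) C =
    ((((p%:R : R) ^+ d) ^+ k)%:E * ((f C)%:R * \prod_(i < k) ((p%:R : R) ^+ m C - p%:R ^+ i)%R)%:E)%E.
  have [b bH] := trivial_lower_p (pgroup_ext p_prime k pH).
  (* A level deep enough for both H x F_p^k and H; the count for H agrees with [f C], as both
     compute [card_Sur]. *)
  rewrite (@card_SurE p p_prime R (maxn b c).+1); last by apply: bH; lia.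
  rewrite (nsur_extk p_prime); last by apply: GI_negates; exact: cgiP.
  have -> : nsur (@cgi p p_prime (maxn b c).+1 C) (tau : H -> H) = f C.
    apply/eqP; rewrite -(eqr_nat R); apply/eqP; apply: EFin_inj; rewrite -fE.
    by rewrite (@card_SurE p p_prime R (maxn b c).+1)//; apply: cH; lia.
  rewrite crank_nhom hH -EFinM; congr _%:E.
  have [->|f0] := posnP (f C); first by rewrite mul0n mul0r mulr0.
  rewrite natrM mulrCA -natrX -natrX -fallE; congr (_ * _)%R; rewrite -natrM; congr (_%:R)%R.
  have cC := rkd C f0.
  rewrite -[in RHS](card_ord k) -prod_nat_const card_ord -big_split /=.
  apply: eq_big => [i|i _]; first by rewrite inE.
  by rewrite /m mulnBr [(p ^ d * p ^ i)%N]mulnC -[(p ^ d * _)%N]expnD subnKC.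
have fc C C' : ccode p_prime c.+1 C = ccode p_prime c.+1 C' -> f C = f C'.
  by move=> CC'; exact: nsur_code.
have mc C C' : ccode p_prime c.+1 C = ccode p_prime c.+1 C' -> m C = m C'.
  by move=> CC'; rewrite /m (crank_code CC').
have mE k : measurable_fun setT (fun C : schurSpace p => card_Sur R (ext_aut (p := p) (tau : H -> H) (k := k) : discrete_topology (ext p H k) -> discrete_topology (ext p H k)) C).
  by apply: (@code_fun_measurable p p_prime c.+1) => C C' CC'; rewrite !extE (fc _ _ CC') (mc _ _ CC').
have P0 : ((p%:R : R) != 0)%R by rewrite pnatr_eq0; lia.
rewrite -(@sieve_integral R p p_gt2 _ (schurSpace p) nu f m d).
(* Where f is nonzero, [m C = 0] means that the rank is exactly d, so the integrand is the
   restriction of f to rank d. *)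
- rewrite [LHS]integral_mkcond; apply: eq_integral => C _; rewrite /patch fE /m.
  have [->|f0] := posnP (f C); first by rewrite mul0r; case: ifP.
  have := rkd C f0; case: ifPn => [/[!inE] /schur_rankE -> _|].
    by rewrite subnn eqxx mulr1.
  rewrite notin_setE => nd dC; suff -> : (crank C - d == 0)%N = false by rewrite mulr0.
  apply/negbTE; rewrite subn_eq0 -ltnNge ltn_neqAle dC andbT.
  by apply/eqP => e; apply: nd; apply/schur_rankE.
- by move=> k; apply: (@code_fun_measurable p p_prime c.+1) => C C' CC'; rewrite (fc _ _ CC') (mc _ _ CC').
- by apply: (@code_fun_measurable p p_prime c.+1) => C C' CC'; rewrite (fc _ _ CC') (mc _ _ CC').
move=> k; have := @nu_moments (ext p H k) (ext_aut (p := p) (tau : H -> H) (k := k)) (pgroup_ext p_prime k pH).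
rewrite GI_automorphismP => /(_ (GI_ext p k tGI)) int1.
rewrite -[RHS]mule1 -int1 -ge0_integralZl_EFin//.
- apply: eq_integral => C _; rewrite extE -EFinM mulrA -exprMn -exprMn mulVf//.
  by rewrite !expr1n mul1r.
- by move=> C _; rewrite extE -EFinM lee_fin; rewrite !mulr_ge0 ?falling_ge0 ?exprn_ge0 ?ler0n.
Qed.

End Moments.

Section Determined.
Import Order.TTheory GRing.Theory Num.Theory.
Variables (R : realType) (c d : nat).

Let F n : set (schurSpace p) := [set C | ccode p_prime c.+1 C = n] `&` schur_rank d.

Lemma rank_code_measurable n : measurable (F n).
Proof.
by apply: measurableI; [exact: ccode_measurable|exact: schur_rank_measurable].
Qed.

(** On rank d the integrand only depends on Q_(c+1), so the integral is a countable sum over the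
    codes; codes of no class of rank d get the value 0. *)
Let rank_code_series (nu : {measure set (schurSpace p) -> \bar R}%R) (H : finGroupType)
    (tau : discrete_topology H -> discrete_topology H) :
  (forall y : discrete_topology H, lower_p_set p c.+1 y -> y = 1) ->
  exists2 S : nat -> \bar R, (forall n, (0 <= S n)%E) /\
    (forall C, schur_rank d C -> S (ccode p_prime c.+1 C) = card_Sur R tau C) &
    (\int[nu]_(C in schur_rank d) card_Sur R tau C = \sum_(0 <= n <oo) S n * nu (F n))%E.
Proof.
move=> H1.
have SP n : exists v : \bar R, (0 <= v)%E /\ forall C, F n C -> v = card_Sur R tau C.
  have [[C0 [C0n dC0]]|nC] := pselect (exists C, F n C); last first.
    by exists 0%E; split=> // C FC; case: nC; exists C.
  exists (card_Sur R tau C0); split; first by rewrite (card_SurE p_prime R _ _ H1) lee_fin ler0n.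
  move=> C [Cn dC]; rewrite !(card_SurE p_prime R _ _ H1); congr (_%:R%:E).
  by apply: nsur_code => //; rewrite C0n Cn.
exists (fun n => projT1 (cid (SP n))).
  split=> [n|C dC]; first by case: cid => v [].
  by case: cid => v /= [_ h]; exact: h.
have rE : schur_rank d = \bigcup_n F n.
  by apply/seteqP; split=> [C dC|C [n _ []]//]; exists (ccode p_prime c.+1 C).
rewrite [in LHS]rE ge0_integral_bigcup.
- apply: eq_eseriesr => n _; rewrite -integral_cst; last exact: rank_code_measurable.
  by apply: eq_integral => C; rewrite inE => FC; case: cid => v /= [_ h]; rewrite (h C).
- by move=> n; exact: rank_code_measurable.
- apply: measurable_funTS; apply: (@code_fun_measurable p p_prime c.+1) => C C' CC'.
  by rewrite !(card_SurE p_prime R _ _ H1); congr (_%:R%:E); exact: nsur_code.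
- by move=> C _; rewrite (card_SurE p_prime R _ _ H1) lee_fin ler0n.
- by move=> i j _ _ [C [[/= <- _] [/= <- _]]].
Qed.

Variables m1 m2 : {measure set (schurSpace p) -> \bar R}%R.
Hypothesis m12 : forall (H : finGroupType) (tau : discrete_topology H -> discrete_topology H),
  p.-group [set: H]%SET -> GI_automorphism tau -> nhom p H = (p ^ d)%N ->
  exists v : R, (\int[m1]_(C in schur_rank d) card_Sur R tau C = v%:E)%E /\
                (\int[m2]_(C in schur_rank d) card_Sur R tau C = v%:E)%E.

(* Downward induction on the order of the quotient: in the moment of H = Q_c(C0),
   the other contributions come from strictly larger quotients. *)
Lemma rank_code_determined C0 : schur_rank d C0 ->
  m1 (F (ccode p_prime c.+1 C0)) = m2 (F (ccode p_prime c.+1 C0)).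
Proof.
have [k] := ubnP (lower_p_bound p d c.+1 - #|cmodel p_prime c.+1 C0|)%N.
elim: k => // k IHk in C0 * => kC0 dC0.
set H := cmodel p_prime c.+1 C0; pose tau : H -> H := @cgi p p_prime c.+1 C0.
set n0 := ccode _ _ _.
have [f [fm _]] := cmodelP p_prime c.+1 C0.
have H1 := model_lower_p1 fm.
have [v [v1 v2]] := @m12 H tau (pgroup_cmodel p_prime c.+1 C0) ((GI_automorphismP (tau : discrete_topology H -> discrete_topology H)).2 (cgiP p_prime c.+1 C0)) (schur_rank_nhom p_prime c dC0).
have [S [S0 SE] e1] := @rank_code_series m1 H tau H1.
have [S' [S'0 S'E] e2] := @rank_code_series m2 H tau H1.
have SS' n : (S n * m1 (F n) = S' n * m1 (F n) /\ S n * m2 (F n) = S' n * m2 (F n))%E.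
  have [[C [/= Cn dC]]|nC] := pselect (exists C, F n C).
    by rewrite -Cn SE// S'E.
  have -> : F n = set0 by apply/seteqP; split=> // C FC; apply: nC; exists C.
  by rewrite !measure0 !mule0.
move: e2; rewrite (eq_eseriesr (g := fun n => (S n * m2 (F n))%E)) => [e2|n _]; last first.
  by rewrite (SS' n).2.
(* A nonzero coefficient means a surjection onto H from another quotient of rank d, which is
   strictly larger than H and so covered by induction. *)
have tail n : n != n0 -> (S n * m1 (F n) = S n * m2 (F n))%E.
  move=> nn0; have [[C [/= Cn dC]]|nC] := pselect (exists C, F n C); last first.
    have -> : F n = set0 by apply/seteqP; split=> // C FC; apply: nC; exists C.
    by rewrite !measure0 !mule0.
  rewrite -Cn SE// (card_SurE p_prime R _ _ H1).
  have [->|f0] := posnP (nsur (@cgi p p_prime c.+1 C) tau); first by rewrite !mul0e.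
  congr (_ * _)%E; apply: IHk => //.
  have CB := card_cmodel_bound c dC; have := nsur_gt0_card f0; rewrite leq_eqVlt.
  move=> /predU1P[e|]; last by rewrite -/H; move: kC0; rewrite -/H; lia.
  have /gcode_iso CC0 := nsur_iso_card f0 (esym e).
  by case/negP: nn0; rewrite -Cn; apply/eqP; exact: CC0.
have [s s0 sE] : exists2 s : R, (0 < s)%R & S n0 = s%:E.
  exists (nsur tau tau)%:R%R; first by rewrite ltr0n nsur_self.
  by rewrite /n0 SE// (card_SurE p_prime R _ _ H1).
have pos (m : {measure set (schurSpace p) -> \bar R}%R) n : (0 <= S n * m (F n))%E.
  exact: mule_ge0.
move: v1 v2; rewrite e1 e2 (@nneseriesD1 R _ n0 xpredT (fun n _ => pos m1 n))// (@nneseriesD1 R _ n0 xpredT (fun n _ => pos m2 n))//.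
rewrite (eq_eseriesr (g := fun n => (S n * m2 (F n))%E) (P := fun n => true && (n != n0))); last first.
  by move=> n /= /tail.
set z := (\sum_(_ <= _ <oo | _) _)%E => v1 v2.
have z0 : (0 <= z)%E by apply: nneseries_ge0 => n _ _; exact: pos.
(* The common remainder is bounded by the moment v, so it is finite and can be cancelled. *)
have zfin : z \is a fin_num.
  rewrite ge0_fin_numE//; apply: le_lt_trans (ltry v); rewrite -v1 leeDr//; exact: pos.
have := v1; rewrite -v2 => /(congr1 (fun t => t - z)%E); rewrite !addeK// sE.
have sV : ((s^-1)%:E * s%:E = 1 :> \bar R)%E by rewrite -EFinM mulVf// gt_eqF.
by move=> /(congr1 (fun t => (s^-1)%:E * t)%E); rewrite !muleA sV !mul1e.
Qed.

End Determined.

Lemma moments_determine (R : realType) (m1 m2 : {measure set (schurSpace p) -> \bar R}%R) :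
  (forall d (H : finGroupType) (tau : discrete_topology H -> discrete_topology H),
    p.-group [set: H]%SET -> GI_automorphism tau -> nhom p H = (p ^ d)%N ->
    exists v : R, (\int[m1]_(C in schur_rank d) card_Sur R tau C = v%:E)%E /\
                  (\int[m2]_(C in schur_rank d) card_Sur R tau C = v%:E)%E) ->
  (m1 setT < +oo)%E ->
  forall A, measurable A -> m1 A = m2 A.
Proof.
move=> m12 m1oo; pose E c n : set (schurSpace p) := [set C | ccode p_prime c.+1 C = n].
pose G : set (set (schurSpace p)) := [set A | A = set0 \/ exists c n, A = E c n].
have mE c n : measurable (E c n) by exact: ccode_measurable.
have GE : measurable = <<s G >>.
  apply/seteqP; split; apply: smallest_sub; [exact: smallest_sigma_algebra| |exact: sigma_algebra_measurable|].
    (* Each generator of Omega, with c = 0 included, is a countable union of events on Q_(c+1),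
       where the rank is visible. *)
    move=> _ [P [c [pP ->]]]; rewrite (_ : [set C | _] = \bigcup_(n in [set n | exists2 C, ccode p_prime c C = gcode P & ccode p_prime c.+1 C = n]) E c n).
      apply: (@bigcup_measurable _ (g_sigma_algebraType G)) => n _.
      by apply: sub_sigma_algebra; right; exists c, n.
    apply/seteqP; split=> [C /has_modelP PC|C [n [C' C'P C'n] Cn]].
      by exists (ccode p_prime c.+1 C) => //; exists C => //; exact/ccodeP.
    apply/has_modelP/(ccodeP p_prime); rewrite -C'P; apply: (ccode_le (leqnSn c)).
    by rewrite C'n.
  by move=> _ [->|[c [n ->]]]; [exact: measurable0|exact: mE].
apply: (@measure_unique _ _ _ G (E 0%N)) => //.
(* For c <= c' the deeper quotient determines the other one, so two events are nested or disjoint;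
   the empty set completes the pi-system. *)
- move=> A B [->|[c [n ->]]]; first by rewrite set0I; left.
  case=> [->|[c' [n' ->]]]; first by rewrite setI0; left.
  wlog cc' : c c' n n' / (c <= c')%N.
    by move=> w; have [/w|/ltnW/w] := leqP c c'; [exact|rewrite setIC; exact].
  have [[C [Cn Cn']]|nC] := pselect (exists C, (E c n `&` E c' n') C); last first.
    by left; apply/seteqP; split=> // C CE; apply: nC; exists C.
  right; exists c', n'; apply: setIidr => C' /= C'n'.
  by rewrite -Cn; apply: (@ccode_le p p_prime c.+1 c'.+1); rewrite ?C'n' ?Cn'.
- by move=> i; right; exists 0%N, i.
- by apply/seteqP; split=> // C _; exists (ccode p_prime 1 C).
- move=> _ [->|[c [n ->]]]; first by rewrite !measure0.
  have [[C0 C0n]|nC] := pselect (exists C, E c n C); last first.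
    by rewrite (_ : E c n = set0) ?measure0//; apply/seteqP; split=> // C CE; apply: nC; exists C.
  have := @rank_code_determined R c (crank C0) m1 m2 (m12 _) C0 (crankP C0).
  rewrite C0n; suff -> : [set C | ccode p_prime c.+1 C = n] `&` schur_rank (crank C0) = E c n by [].
  apply: setIidl => C /= Cn; apply/schur_rankE; apply: (@crank_code c).
  by rewrite Cn.
- move=> k; apply: Order.POrderTheory.le_lt_trans m1oo; apply: le_measure; rewrite ?inE//; exact: mE.
Qed.

End Uniqueness.

(** * Random relators *)

Section FiniteUnion.
Variables (R : realType) (d : measure_display) (T : measurableType d).
Variables (m : {measure set T -> \bar R}%R) (I : finType) (B : {set I}) (F : I -> set T).
Hypothesis mF : forall i, measurable (F i).

Let unionE : [set r | exists2 i, i \in B & F i r] = \bigcup_(i in [set` enum B]) F i.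
Proof.
by apply/seteqP; split=> [r [i iB Fr]|r [i /= iB Fr]]; exists i => //=; rewrite ?mem_enum// -mem_enum.
Qed.

Let fin_enum : finite_set [set` enum B]. Proof. exact: finite_seq. Qed.

Lemma measurable_fin_union : measurable [set r | exists2 i, i \in B & F i r].
Proof. by rewrite unionE; apply: fin_bigcup_measurable => // i _; exact: mF. Qed.

Lemma measure_fin_union : (forall i j r, F i r -> F j r -> i = j) ->
  m [set r | exists2 i, i \in B & F i r] = (\sum_(i in B) m (F i))%E.
Proof.
move=> tF; rewrite unionE measure_fin_bigcup//.
  by rewrite -fsbig_seq ?enum_uniq// big_enum.
by move=> i j _ _ [r [Fi Fj]]; exact: tF Fi Fj.
Qed.

Lemma measure_fin_union_le : (m [set r | exists2 i, i \in B & F i r] <= \sum_(i in B) m (F i))%E.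
Proof.
rewrite -big_enum (fsbig_seq _ (fun i => m (F i)) (enum_uniq B)); apply: content_sub_fsum => //.
- exact: measurable_fin_union.
- by rewrite unionE.
Qed.

End FiniteUnion.

Section Transfer.
Variables (p g c : nat) (F G G' : topologicalGroupType) (Q P : finGroupType).
Variables (r r' : 'I_g -> F) (pi : F -> G) (pi' : F -> G') (f : F -> Q).
Hypothesis fm : finmodel (lower_p_set p c) f.
Hypothesis rr' : forall j, f (r j) = f (r' j).
Hypotheses (prs : presents [set r j | j in [set: 'I_g]] pi)
           (prs' : presents [set r' j | j in [set: 'I_g]] pi').

Lemma model_lift (k : G -> P) : finmodel (lower_p_set p c) k ->
  continuous (k : G -> discrete_topology P) ->
  exists2 h : G' -> P, continuous_hom (h : G' -> discrete_topology P) & forall u, h (pi' u) = k (pi u).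
Proof.
move=> km kc; have [kM kS kK] := km.
have hc : continuous_hom (k \o pi : F -> discrete_topology P).
  split; first by move=> u v /=; rewrite (pres_morph prs) kM.
  by move=> u; apply: (@continuous_comp _ _ (discrete_topology P)); [exact: (pres_continuous prs)|exact: kc].
have [||h hh hE] := @pres_hom F G' _ pi' prs' (discrete_topology P) (k \o pi) hc.
- exact: discrete_closed.
- move=> _ [j _ <-] /=; have rK : pi (r j) = 1.
    by apply/(pres_ker prs); apply: (@sub_closed_normal_gen _ [set r j | j in [set: 'I_g]]); exists j.
  have /(finmodel_eq fm) Lj := rr' j.
  have -> : r' j = r j * ((r j)^-1 * r' j) by rewrite mulKVg.
  rewrite (pres_morph prs) rK mul1g; apply/kK; apply: (lower_p_hom _ Lj).
  by split; [exact: pres_morph prs|exact: pres_continuous prs].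
by exists h => // u; rewrite -hE.
Qed.

End Transfer.

(** Q_c of the quotient only depends on the relators modulo P_c(F). Each map to Q_c kills the other
    system of relators, which gives morphisms in both directions. *)
Lemma model_transfer p g c (F G G' : topologicalGroupType) (Q P : finGroupType)
    (r r' : 'I_g -> F) (pi : F -> G) (pi' : F -> G') (f : F -> Q) :
  finmodel (lower_p_set p c) f -> (forall j, f (r j) = f (r' j)) ->
  presents [set r j | j in [set: 'I_g]] pi -> presents [set r' j | j in [set: 'I_g]] pi' ->
  (exists P', has_model p G' c P') -> has_model p G c P -> has_model p G' c P.
Proof.
move=> fm rr' prs prs' [P' [k' [k'm k'c]]] [k [km kc]].
have [kM kS kK] := km; have [k'M k'S k'K] := k'm.
have [h hh hE] := model_lift fm rr' prs prs' km kc.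
have [h' h'h h'E] := model_lift fm (fun j => esym (rr' j)) prs' prs k'm k'c.
have [hM hcn] := hh; have [h'M h'cn] := h'h.
have [|a aM aE] := model_factor km h'M h'cn.
  exact: model_lower_p1 k'm.
exists h; split=> //; split=> //.
  by move=> y; have [z <-] := kS y; have [u <-] := pres_surj prs z; exists (pi' u).
move=> y; have [u <-] := pres_surj prs' y; split=> [|Ly].
  by rewrite hE => ku; apply/k'K; rewrite -h'E aE ku (gmorph1 aM).
by apply: (model_lower_p1 km); apply: (lower_p_hom _ Ly); split.
Qed.

Section RandomRelators.
Import Order.TTheory GRing.Theory Num.Theory.
Variables (R : realType) (p g : nat) (F : topologicalGroupType) (x : 'I_g -> F) (s : F -> F).
Variable mu : probability (borel F) R.
Hypotheses (p_prime : prime p) (p_odd : odd p) (F_free : free_pro_p p x).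
Hypotheses (s_iso : top_group_iso s) (s_inv : forall i, s (x i) = (x i)^-1).
Hypothesis mu_natural : natural_measure p s mu.

Lemma borel_open (A : set F) : open A -> measurable (A : set (borel F)).
Proof. by move=> oA; exact: sub_sigma_algebra. Qed.

Lemma borel_closed (A : set F) : closed A -> measurable (A : set (borel F)).
Proof.
move=> cA; rewrite -[A]setCK; apply: (@measurableC _ (borel F)); apply: borel_open.
by rewrite openC.
Qed.

Let sGI : GI_automorphism s. Proof. exact: (free_GI_automorphism p_prime F_free). Qed.
Let pF : pro_p_group p F. Proof. by case: F_free. Qed.

Lemma inverted_measurable : measurable (inverted p s : set (borel F)).
Proof.
have -> : inverted p s = lower_p_set p 1 `&` [set z | s z * z = 1].
  apply/seteqP; split=> z [Lz /=] sz; split=> //; first by rewrite /= sz mulVg.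
  by rewrite -[s z](mulgK z) sz mul1g.
apply: (@measurableI _ (borel F)); apply: borel_closed; first exact: lower_p_closed.
have [_ hF _ _] := pF; have [[sM sc] _] := s_iso.
have c1 : closed [set (1 : F)] by apply: accessible_closed_set1; exact: hausdorff_accessible.
have cz : continuous (fun z => s z * z).
  move=> z; apply: (@continuous_comp _ _ _ (fun z => (s z, z)) (fun w : F * F => w.1 * w.2)).
    by apply: cvg_pair; [exact: sc|exact: cvg_id].
  exact: mulg_continuous.
by have -> : [set z | s z * z = 1] = (fun z => s z * z) @^-1` [set 1] by []; move/continuous_closedP : cz; apply.
Qed.

Lemma kernel_measurable (H : finGroupType) (h : F -> H) y :
  continuous (h : F -> discrete_topology H) -> measurable ([set z | h z = y] : set (borel F)).
Proof.
move=> /continuousP hc; apply: borel_open.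
have -> : [set z | h z = y] = h @^-1` [set y] by [].
by apply: hc; exact: discrete_open.
Qed.

Section ImageMeasure.
Variables (H : finGroupType) (t : H -> H) (h : F -> H).
Hypotheses (pH : p.-group [set: H]%SET) (hh : continuous_hom (h : F -> discrete_topology H)).
Hypotheses (hS : forall y, exists z, h z = y) (ht : forall z, h (s z) = t (h z)).

(** For c large, h factors through Q_c(F), where the measure is uniform on X_c; by [invd_frat_card]
    its image is uniform on the inverted Frattini elements of H. *)
Lemma image_measure : mu (inverted p s `&` [set z | h z = 1]) =
  ((#|invd t (frat p H)|%:R)^-1)%:E.
Proof.
have [hM hc] := hh; have [c0 c0H] := trivial_lower_p p_prime pH.
set c := c0.+1; have cH := c0H c (leqnSn c0).
have [Q [f [fm pQ fc _]]] := lower_p_model p_prime c (free_gen_by p_prime F_free) pF.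
have [fM fS fK] := fm.
have [k kM kE] := model_factor fm hM hc cH.
have [s' s'GI fs] := induced_GI sGI fm fc.
have [e [e' [[eM eK e'K ec e'c] eE]]] := model_quotient fm fc.
have [_ nat] := mu_natural.
pose Xc := inverted p (@quotient_map F (lower_p F p c) s).
pose B := invd s' (frat p Q).
have XcB a : Xc a <-> e a \in B.
  have e1 : lower_p_set p 1 a <-> e a \in frat p Q.
    rewrite -(fratE p_prime pQ); split=> La; first exact: (lower_p_hom (conj eM ec)).
    rewrite -(eK a); apply: (@lower_p_hom p _ _ e') => //; split=> // u v.
    by apply: (can_inj eK); rewrite eM !e'K.
  have es : e (quotient_map s a) = s' (e a).
    by rewrite /quotient_map eE fs -eE qreprK.
  rewrite inE; split=> [[/e1 -> /= sa]|/andP[/e1 La /eqP sa]].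
    by rewrite -es sa (gmorphV eM) eqxx.
  by split=> //; apply: (can_inj eK); rewrite (gmorphV eM) -sa es.
have cardXc : (#|` fset_set Xc|)%fset = #|B|.
  apply: card_fset_set; apply: (@card_eq_finset _ Xc Q B e').
  - by move=> b bB; apply/XcB; rewrite e'K.
  - by move=> b b' _ _; exact: (can_inj e'K).
  - by move=> a /XcB aB; exists (e a).
have muB b : b \in B -> mu (inverted p s `&` [set z | f z = b]) = ((#|B|%:R)^-1)%:E.
  move=> bB; have Xb : Xc (e' b) by apply/XcB; rewrite e'K.
  have := nat c (e' b) Xb; rewrite -/Xc cardXc => <-; congr (mu (_ `&` _)).
  apply/seteqP; split=> z /= zb; first by rewrite -zb -eE eK.
  by rewrite -eE zb e'K.
pose B1 := [set b in B | k b == 1]%SET.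
have XE : inverted p s `&` [set z | h z = 1] =
    [set z | exists2 b, b \in B1 & (inverted p s `&` [set z | f z = b]) z].
  apply/seteqP; split=> [z [Xz /= hz]|z [b]].
    exists (f z); last by [].
    suff fB : f z \in B by rewrite inE fB -kE hz eqxx.
    have [Lz sz] := Xz; rewrite inE; apply/andP; split.
      apply/(fratE p_prime pQ); apply: (@lower_p_hom p F (discrete_topology Q) f) => //; by split.
    by rewrite -fs sz (gmorphV fM).
  by rewrite inE => /andP[_ /eqP kb] [Xz /= fz]; split=> //=; rewrite kE fz.
rewrite XE measure_fin_union; last first.
- by move=> b b' z [_ /= <-] [_ /= <-].
- by move=> b; apply: (@measurableI _ (borel F)); [exact: inverted_measurable|exact: kernel_measurable].
rewrite (eq_bigr (fun=> ((#|B|%:R)^-1)%:E)); last first.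
  by move=> b; rewrite inE => /andP[bB _]; exact: muB.
rewrite sumEFin sumr_const; congr (_%:E).
have kt b : k (s' b) = t (k b) by have [z <-] := fS b; rewrite -fs -!kE ht.
have kS y : exists b, k b = y by have [z <-] := hS y; exists (f z); rewrite kE.
have e0 : (#|invd t (frat p H)| * #|B1|)%N = #|B| := @invd_frat_card p p_prime Q H s' t k p_odd pQ (GI_morph s'GI) (GI_invol s'GI) kM kt
  (frat_lift p_prime pQ pH kM kS).
have B10 : (#|B1|%:R != 0 :> R)%R.
  have oneB : 1 \in B.
    by rewrite inE (gmorph1 (GI_morph s'GI)) invg1 eqxx andbT; exact: (group1 (frat_group p Q)).
  by rewrite pnatr_eq0 -lt0n; apply/card_gt0P; exists 1; rewrite inE oneB (gmorph1 kM) eqxx.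
by rewrite -[LHS]mulr_natr -e0 natrM invfM -mulrA mulVf// mulr1.
Qed.

End ImageMeasure.

Variable mug : probability (g.-tuple (borel F)) R.
Hypothesis mug_product : product_measure_of mu mug.

Definition relators_in (A : set F) : set (g.-tuple (borel F)) := [set r | forall i, A (tnth r i)].

Lemma relators_in_measurable (A : set F) :
  measurable (A : set (borel F)) -> measurable (relators_in A).
Proof.
move=> mA.
have -> : relators_in A = ~` [set r | exists2 i, i \in [set: 'I_g]%SET & (tnth (T := borel F) ^~ i @^-1` (~` A)) r].
  apply/seteqP; split=> [r rA [i _]|r nr i]; first exact.
  by apply: contrapT => nA; apply: nr; exists i; rewrite ?finset.in_setT.
apply: measurableC; apply: measurable_fin_union => i.
rewrite -[X in measurable X]setTI; apply: measurable_tnth => //.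
exact: (@measurableC _ (borel F)).
Qed.

Lemma mug_relators_in (A : set F) (v : R) : measurable (A : set (borel F)) ->
  mu A = v%:E -> mug (relators_in A) = (v ^+ g)%:E.
Proof.
move=> mA Av; rewrite (mug_product (A := fun=> A))//.
by rewrite Av -(big_morph EFin (@EFinM R) erefl) prodr_const card_ord.
Qed.

Lemma mug_inverted : mug (relators_in (inverted p s)) = 1%E.
Proof.
have [mu1 _] := mu_natural.
by rewrite (mug_relators_in inverted_measurable mu1) expr1n.
Qed.

Section KilledRelators.
Variable H : finGroupType.
Hypothesis pH : p.-group [set: H]%SET.

Definition hom_of (y : {ffun 'I_g -> H}) : F -> H := projT1 (cid2 (free_hom F_free y pH)).
Lemma hom_ofP y : continuous_hom (hom_of y : F -> discrete_topology H).
Proof. by rewrite /hom_of; case: cid2. Qed.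
Lemma hom_ofE y i : hom_of y (x i) = y i.
Proof. by rewrite /hom_of; case: cid2 => f /=. Qed.
Lemma hom_of_eq (h : F -> H) : continuous_hom (h : F -> discrete_topology H) ->
  h = hom_of [ffun i => h (x i)].
Proof.
move=> hh; apply: (free_hom_eq F_free pH hh (hom_ofP _)) => i.
by rewrite hom_ofE ffunE.
Qed.

Definition killed y := relators_in (inverted p s `&` [set z | hom_of y z = 1]).

Lemma killed_measurable y : measurable (killed y).
Proof.
apply: relators_in_measurable; apply: (@measurableI _ (borel F)).
  exact: inverted_measurable.
by apply: kernel_measurable; have [] := hom_ofP y.
Qed.

Lemma mug_killed (t : H -> H) y : (forall a, exists z, hom_of y z = a) ->
  (forall z, hom_of y (s z) = t (hom_of y z)) ->
  mug (killed y) = (((#|invd t (frat p H)|%:R)^-1) ^+ g)%:E.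
Proof.
move=> yS yt; apply: mug_relators_in; last exact: (image_measure pH (hom_ofP y) yS yt).
apply: (@measurableI _ (borel F)); first exact: inverted_measurable.
by apply: kernel_measurable; have [] := hom_ofP y.
Qed.

End KilledRelators.
Section CyclicRelators.
Variable n : nat.
Local Notation Z := 'Z_(p ^ n.+1).
Local Notation pZ := (pgroup_Zpn n p_prime).

Lemma card_frat_Zpn : (p ^ n <= #|invd (fun a : Z => a^-1) (frat p Z)|)%N.
Proof.
pose e (i : 'I_(p ^ n)) : Z := (1%R : Z) ^+ (p * i).
have eI : injective e.
  move=> i j /(congr1 (@nat_of_ord _)); rewrite /e !Zpn_expg !val_Zp_nat ?expn_gt1// !modn_small.
  - by move=> /eqP; rewrite eqn_pmul2l ?prime_gt0// => /eqP/val_inj.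
  - by rewrite expnS ltn_pmul2l ?prime_gt0.
  - by rewrite expnS ltn_pmul2l ?prime_gt0.
rewrite -[X in (X <= _)%N](card_ord (p ^ n)) -(card_imset _ eI); apply: subset_leq_card.
apply/fintype.subsetP => _ /imsetP[i _ ->]; rewrite inE eqxx andbT; apply/fratP => h hM.
have hp : h (1%R : Z) ^+ p = 1 by rewrite Fp_expgE -mulr_natr pchar_Fp_0// mulr0.
by rewrite /e expgM !(gmorphX hM) hp expg1n.
Qed.

Lemma mug_killed_cyclic (y : {ffun 'I_g -> Z}) : (forall a, exists z, hom_of pZ y z = a) ->
  (mug (killed pZ y) <= ((((p%:R)^-1 ^+ n) ^+ g) : R)%:E)%E.
Proof.
move=> yS; have [hM hc] := hom_ofP pZ y; have [[sM sc] _] := s_iso.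
rewrite (@mug_killed _ pZ (fun a => a^-1) y yS).
  rewrite lee_fin; apply: lerXn2r; rewrite ?nnegrE ?invr_ge0 ?exprn_ge0 ?invr_ge0//.
  have p0 : (0 < (p ^ n)%:R :> R)%R by rewrite ltr0n expn_gt0 prime_gt0.
  have le : ((p ^ n)%:R <= #|invd (fun a : Z => a^-1)%g (frat p Z)|%:R :> R)%R.
    by rewrite ler_nat; exact: card_frat_Zpn.
  by rewrite exprVn -natrX lef_pV2 ?posrE//; apply: lt_le_trans le.
have e : (fun z => hom_of pZ y (s z)) = (fun z => (hom_of pZ y z)^-1).
  apply: (free_hom_eq F_free pZ).
  - split; first by move=> a b; rewrite sM hM.
    by move=> z; apply: (@continuous_comp _ _ (discrete_topology Z)); [exact: sc|exact: hc].
  - split; last exact: (@continuous_op1 _ _ _ (fun a : Z => a^-1)).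
    by move=> a b; rewrite hM invMg; exact: addrC.
  - by move=> i; rewrite s_inv (gmorphV hM).
by move=> z; exact: (congr1 (fun k => k z) e).
Qed.

Definition surjections := [set y : {ffun 'I_g -> Z} | `[< forall a, exists z, hom_of pZ y z = a >]]%SET.

Definition cyclic_quotients := [set r | exists2 y, y \in surjections & killed pZ y r].

Lemma cyclic_quotientsP r : relators_in (inverted p s) r ->
  (exists h : F -> Z, [/\ continuous_hom (h : F -> discrete_topology Z),
    (forall j, h (tnth r j) = 1) & forall y, exists z, h z = y]) -> cyclic_quotients r.
Proof.
move=> rX [h [hh hr hS]]; exists [ffun i => h (x i)].
  by rewrite inE; apply/asboolP; rewrite -(hom_of_eq pZ hh).
by move=> j; split; [exact: rX|rewrite /= -(hom_of_eq pZ hh); exact: hr].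
Qed.

(* Up to a unit a surjection onto Z/p^(n+1) takes the value 1 on some generator,
   which leaves g * p^((n+1)(g-1)) of them, each of weight at most p^(-n g). *)
Lemma mug_cyclic_quotients :
  (mug cyclic_quotients <= ((g * p ^ g)%:R * ((p%:R)^-1 ^+ n) : R)%:E)%E.
Proof.
pose I : finType := ('I_g * {ffun 'I_g.-1 -> Z})%type.
pose e (iw : I) : {ffun 'I_g -> Z} :=
  [ffun j => if unlift iw.1 j is Some k then iw.2 k else (1%R : Z)].
have e1 iw : e iw iw.1 = 1%R by rewrite ffunE unlift_none.
have eS iw a : exists z, hom_of pZ (e iw) z = a.
  have [hM _] := hom_ofP pZ (e iw).
  by exists (x iw.1 ^+ (a : nat)); rewrite (gmorphX hM) hom_ofE e1 Zpn_gen.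
pose U := [set r | exists2 iw, iw \in [set: I]%SET & killed pZ (e iw) r].
have mK y : measurable (killed pZ y) by exact: killed_measurable.
apply: (@le_trans _ _ (mug U)).
  apply: le_measure; rewrite ?inE; try exact: measurable_fin_union.
  move=> r [y]; rewrite inE => /asboolP yS yr.
  have [hM hc] := hom_ofP pZ y.
  (* Otherwise p^n would kill the image of the surjection, which is all of Z/p^(n+1). *)
  have [i yi] : exists i, (y i) ^+ (p ^ n) != 1.
    apply: contrapT => ny.
    have triv : (fun z => hom_of pZ y z ^+ (p ^ n)) = (fun=> 1).
      apply: (free_hom_eq F_free pZ).
      - split; last exact: (@continuous_op1 _ _ _ (fun a : Z => a ^+ (p ^ n))).
        by move=> a b; rewrite hM expgMn//; exact: (addrC (hom_of pZ y a)).
      - split; first by move=> a b; rewrite mulg1.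
        by move=> z; exact: cst_continuous.
      - by move=> i; rewrite hom_ofE; apply: contrapT => /eqP yi; apply: ny; exists i.
    have [z zE] := yS (1%R : Z); have := congr1 (fun k => k z) triv.
    rewrite /= zE Zpn_expg => /(congr1 (@nat_of_ord _)); rewrite val_Zp_nat ?expn_gt1//.
    rewrite modn_small; last by rewrite ltn_exp2l ?prime_gt1.
    by apply/eqP; rewrite -lt0n expn_gt0 prime_gt0.
  have [k yk] := Zpn_unitP p_prime yi.
  pose y' : {ffun 'I_g -> Z} := [ffun j => y j ^+ k].
  have y'E : hom_of pZ y' = (fun z => hom_of pZ y z ^+ k).
    apply: (free_hom_eq F_free pZ (hom_ofP pZ y')).
    - split; last exact: (@continuous_op1 _ _ _ (fun a : Z => a ^+ k)).
      by move=> a b; rewrite hM expgMn//; exact: (addrC (hom_of pZ y a)).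
    - by move=> j; rewrite !hom_ofE ffunE.
  exists (i, [ffun k => y' (lift i k)]); first by rewrite inE.
  rewrite (_ : e _ = y'); last first.
    apply/ffunP => j; rewrite ffunE /=; case: unliftP => [k' ->|->]; first by rewrite ffunE.
    by rewrite ffunE yk.
  move=> j; have [rX rk] := yr j; split=> //=.
  by rewrite y'E [hom_of pZ y _]rk expg1n.
apply: le_trans (measure_fin_union_le _ _ _) _ => //.
apply: (@le_trans _ _ (\sum_(iw in [set: I]%SET) ((((p%:R)^-1 ^+ n) ^+ g) : R)%:E)%E).
  by apply: lee_sum => iw _; apply: mug_killed_cyclic; exact: eS.
rewrite sumEFin sumr_const cardsT card_prod card_ord card_ffun card_Zpn// card_ord lee_fin.
rewrite -[X in (X <= _)%R]mulr_natl.
(* The exponent of p in the total weight is (n+1)(g-1) - n g = g - 1 - n, at most g - n; the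
   predecessor of g sets the case g = 0 apart. *)
have [->|g0] := posnP g; first by rewrite !mul0n !mul0r.
rewrite !natrM -!mulrA ler_wpM2l// -expnM.
rewrite -exprM exprVn exprVn.
have P0 k : (0 < (p%:R : R) ^+ k)%R by rewrite exprn_gt0// ltr0n prime_gt0.
rewrite ler_pdivrMr// mulrAC ler_pdivlMr// -!natrX -!natrM ler_nat -!expnD leq_exp2l ?prime_gt1//.
nia.
Qed.

End CyclicRelators.

Lemma relator_set (r : g.-tuple (borel F)) :
  [set` (r : seq F)] = [set (tnth r j : F) | j in [set: 'I_g]].
Proof.
apply/seteqP; split=> [z /tnthP[j ->]|_ [j _ <-]]; first by exists j.
exact: (@mem_tnth _ F).
Qed.

Definition schur_event : set (g.-tuple (borel F)) := @relator_event p F s g setT.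

Lemma schur_eventP r : schur_event r -> exists (G : schurGroup p) (pi : F -> G),
  isomorphic (quotientGroup (normal_closure [set` (r : seq F)])) G /\
  presents [set (tnth r j : F) | j in [set: 'I_g]] pi.
Proof.
move=> [rX [G [QG _]]]; have := QG => /isomorphicP[e [e' [eM eK e'K ec e'c]]].
exists G, (e \o qpi _); split=> //; rewrite -relator_set.
by apply: (presents_comp eM eK e'K ec e'c); exact: quotient_presents.
Qed.

(** A Schur sigma-group has finite abelianization, hence no large cyclic quotient; conversely
    [pres_schur] applies. The event thus becomes a countable combination of events about finite
    groups. *)
Lemma schur_eventE : schur_event =
  \bigcup_n (relators_in (inverted p s) `\` cyclic_quotients n).
Proof.
apply/seteqP; split=> [r rD|r [n _ [rX nr]]].
  have [rX _] := rD; have [G [pi [_ prs]]] := schur_eventP rD.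
  have [n nG] := schur_no_cyclic p_prime (schur_groupP G).
  exists n => //; split=> // -[y]; rewrite inE => /asboolP yS yr.
  have [||h hh hE] := @pres_hom F G _ pi prs (discrete_topology 'Z_(p ^ n.+1)) _ (hom_ofP (pgroup_Zpn n p_prime) y).
  - exact: discrete_closed.
  - by move=> _ [j _ <-]; have [] := yr j.
  apply: (nG h hh) => a; have [z <-] := yS a; exists (pi z); exact: esym (hE z).
split=> //.
have [|G QG] := @schur_copy p p_prime g n F x (fun j => tnth r j) s F_free s_iso s_inv rX.
  by move=> h hh hr hS; apply: nr; apply: cyclic_quotientsP => //; exists h.
by exists G; rewrite relator_set.
Qed.

Lemma schur_event_measurable : measurable schur_event.
Proof.
rewrite schur_eventE; apply: bigcup_measurable => n _; apply: measurableD.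
  exact: relators_in_measurable inverted_measurable.
by apply: measurable_fin_union => y; exact: killed_measurable.
Qed.

(** Outside a null set, failure means a quotient Z/p^(n+1) for every n; the bound of
    [mug_cyclic_quotients] tends to 0 with n. *)
Lemma schur_event_null : mug (~` schur_event) = 0%E.
Proof.
have mX : measurable (relators_in (inverted p s)) by exact: relators_in_measurable inverted_measurable.
have mB n : measurable (cyclic_quotients n).
  by apply: measurable_fin_union => y; exact: killed_measurable.
have mD : measurable (~` schur_event) by exact: measurableC schur_event_measurable.
have X0 : mug (~` relators_in (inverted p s)) = 0%E.
  by rewrite probability_setC// mug_inverted subee.
have le n : (mug (~` schur_event) <= ((g * p ^ g)%:R * (2^-1 ^+ n) : R)%:E)%E.
  apply: (@le_trans _ _ (mug (~` relators_in (inverted p s) `|` cyclic_quotients n))).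
    apply: le_measure; rewrite ?inE//; first by apply: measurableU => //; exact: measurableC.
    move=> r; rewrite schur_eventE => nr.
    have [rX|] := pselect (relators_in (inverted p s) r); last by left.
    by right; apply: contrapT => nc; apply: nr; exists n.
  apply: le_trans (measureU2 _ _ _) _ => //; first exact: measurableC.
  rewrite [X in (X + _ <= _)%E]X0 add0e; apply: le_trans (mug_cyclic_quotients n) _.
  rewrite lee_fin ler_wpM2l//; apply: lerXn2r; rewrite ?nnegrE ?invr_ge0//.
  by rewrite lef_pV2 ?posrE ?ltr0n ?prime_gt0// ler_nat prime_gt1.
have mfin : mug (~` schur_event) \is a fin_num by exact: fin_num_measure.
apply/eqP; rewrite eq_le measure_ge0 andbT -(fineK mfin) lee_fin.
have cv : (fun n => (g * p ^ g)%:R * (2^-1 ^+ n) : R)%R @ \oo --> ((g * p ^ g)%:R * 0 : R)%R.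
  by apply: cvgM; [exact: cvg_cst|exact: cvg_half].
rewrite mulr0 in cv; apply: (cvgr_to_ge cv); apply: nearW => n.
by rewrite -lee_fin fineK//; exact: le.
Qed.

(** The default class off the almost sure event makes this a total map, along which the measure can
    be pushed forward. *)
Definition cls (r : g.-tuple (borel F)) : schurSpace p :=
  if pselect (schur_event r) is left rD then iso_class (projT1 (cid (schur_eventP rD))) else point.

Lemma cls_presents r : schur_event r -> exists pi : F -> class_repr (cls r),
  presents [set (tnth r j : F) | j in [set: 'I_g]] pi.
Proof.
move=> rD; rewrite /cls; case: pselect => // rD'; case: cid => G /= [pi [_ prs]].
have := isomorphic_sym (class_repr_iso G) => /isomorphicP[e [e' [eM eK e'K ec e'c]]].
by exists (e \o pi); exact: (presents_comp eM eK e'K ec e'c prs).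
Qed.

Lemma relator_eventE A : @relator_event p F s g A = schur_event `&` cls @^-1` A.
Proof.
apply/seteqP; split=> [r [rX [G [QG AG]]]|r [rD]].
  have rD : schur_event r by split=> //; exists G.
  split=> //; rewrite /= /cls; case: pselect => // rD'; case: cid => G' /= [pi [QG' _]].
  by rewrite (iso_classP (isomorphic_trans (isomorphic_sym QG') QG)).
rewrite /= /cls; case: pselect => // rD'; case: cid => G /= [pi [QG _]] AG.
by have [rX _] := rD; split=> //; exists G.
Qed.

Lemma cls_rank r : schur_event r -> schur_rank g (cls r).
Proof.
move=> rD; have [pi prs] := cls_presents rD; apply: (pres_H1 p_prime F_free _ prs) => j.
by have [rX _] := rD; have [] := rX j.
Qed.

(** Off [schur_event] the map is constant. On it, by [model_transfer], a generator of Omega is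
    detected by the residues of the relators in the finite group Q_c(F), which take finitely many
    values. *)
Lemma cls_measurable : measurable_fun setT cls.
Proof.
apply: (@measurability _ _ _ _ setT cls (omega_generators (p := p))) => // _ [_ [P [c [pP ->]] <-]].
rewrite setTI; set E := [set C | _].
have -> : cls @^-1` E = (schur_event `&` cls @^-1` E) `|` (~` schur_event `&` cls @^-1` E).
  by rewrite -setIUl setUv setTI.
apply: measurableU; last first.
  have [Ept|nE] := pselect (E point).
    rewrite (_ : _ `&` _ = ~` schur_event); first exact: measurableC schur_event_measurable.
    by apply: setIidl => r nr; rewrite /= /cls; case: pselect.
  rewrite (_ : _ `&` _ = set0)//; apply/seteqP; split=> // r [nr]; rewrite /= /cls.
  by case: pselect.
have [Q [f [fm pQ fc _]]] := lower_p_model p_prime c (free_gen_by p_prime F_free) pF.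
pose V (y : {ffun 'I_g -> Q}) : set (g.-tuple (borel F)) := [set r | forall j, f (tnth r j) = y j].
pose B := [set y | `[< exists r, [/\ schur_event r, E (cls r) & V y r] >]]%SET.
have mV y : measurable (V y).
  have -> : V y = ~` [set r | exists2 i, i \in [set: 'I_g]%SET & (tnth (T := borel F) ^~ i @^-1` (~` [set z | f z = y i])) r].
    apply/seteqP; split=> [r rV [i _]|r nr i]; first by apply; exact: rV.
    by apply: contrapT => nA; apply: nr; exists i; rewrite ?finset.in_setT.
  apply: measurableC; apply: measurable_fin_union => i.
  rewrite -[X in measurable X]setTI; apply: measurable_tnth => //.
  by apply: (@measurableC _ (borel F)); exact: kernel_measurable.
have -> : schur_event `&` cls @^-1` E = schur_event `&` [set r | exists2 y, y \in B & V y r].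
  apply/seteqP; split=> r [rD rE]; split=> //.
    exists [ffun j => f (tnth r j)]; last by move=> j; rewrite ffunE.
    by rewrite inE; apply/asboolP; exists r; split=> // j; rewrite ffunE.
  have [y] := rE; rewrite inE => /asboolP[r0 [r0D r0E r0y]] ry.
  have [pi prs] := cls_presents rD; have [pi0 prs0] := cls_presents r0D.
  apply/has_modelP; apply: (@model_transfer p g c F _ _ Q P (fun j => tnth r0 j) (fun j => tnth r j) pi0 pi f fm _ prs0 prs).
  - by move=> j; rewrite (r0y j) (ry j).
  - by have [P' [H _]] := class_has_model p_prime (cls r) c; exists P'.
  - by apply/has_modelP; exact: r0E.
apply: measurableI; first exact: schur_event_measurable.
exact: measurable_fin_union.
Qed.

End RandomRelators.

(** * The distribution of the random quotient and its moments *)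

Section LawOfQuotient.
Import Order.TTheory GRing.Theory Num.Theory.
Variables (R : realType) (p g : nat) (F : topologicalGroupType) (x : 'I_g -> F) (s : F -> F).
Variable mu : probability (borel F) R.
Hypotheses (p_prime : prime p) (p_odd : odd p) (F_free : free_pro_p p x).
Hypotheses (s_iso : top_group_iso s) (s_inv : forall i, s (x i) = (x i)^-1).
Hypothesis mu_natural : natural_measure p s mu.

Variable mug : probability (g.-tuple (borel F)) R.
Hypothesis mug_product : product_measure_of mu mug.

Let D : set (g.-tuple (borel F)) := schur_event p s.
Let mD : measurable D. Proof. exact: (schur_event_measurable p_prime F_free s_iso s_inv). Qed.
Let D0 : mug (~` D) = 0%E.
Proof. exact: (schur_event_null p_prime p_odd F_free s_iso s_inv mu_natural mug_product). Qed.
Let mcls : measurable_fun setT (@cls p g F s).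
Proof. exact: (cls_measurable p_prime F_free s_iso s_inv). Qed.
Let clsP r (rD : D r) := cls_presents rD.
Let clsD r (rD : D r) : schur_rank g (cls p s r). Proof. exact: (cls_rank p_prime F_free). Qed.

Lemma mug_schur A : measurable A -> mug (A `&` D) = mug A.
Proof.
move=> mA; rewrite [RHS](measureDI _ mA mD) [X in (X + _)%E](_ : _ = 0%E) ?add0e//.
apply/eqP; rewrite eq_le measure_ge0 andbT -D0; apply: le_measure; rewrite ?inE.
- exact: measurableD.
- exact: measurableC.
- by move=> r [].
Qed.

Definition law : {measure set (schurSpace p) -> \bar R}%R :=
  measure_function_pushforward__canonical__measure_function_Measure mug mcls.

Lemma lawE A : measurable A -> law A = mug (relator_event s (A `&` @schur_rank p g)).
Proof.
move=> mA; have mcA : measurable (@cls p g F s @^-1` A) by rewrite -[X in measurable X]setTI; exact: mcls.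
rewrite relator_eventE /= /pushforward -(mug_schur mcA); congr (mug _).
apply/seteqP; split=> [r [rA rD]|r [rD [rA _]]]; split=> //.
by split=> //; exact: clsD.
Qed.

Section LawMoments.
Variables (H : finGroupType) (tau : discrete_topology H -> discrete_topology H).
Hypotheses (pH : p.-group [set: H]%SET) (tauGI : GI_automorphism tau).

Let equivariant := [set y : {ffun 'I_g -> H} |
  `[< (forall a, exists z, hom_of F_free pH y z = a) /\
      forall z, hom_of F_free pH y (s z) = tau (hom_of F_free pH y z) >]]%SET.

(** Surjections from the quotient are those of F that kill the relators. The automorphism induced by
    s may be used in place of the fixed one by [nsur_GI]. The sum of indicators is then ready to be
    integrated. *)
Lemma card_Sur_cls r : D r -> card_Sur R tau (cls p s r) =
  (\sum_(y in equivariant) (\1_(killed s F_free pH y) r)%:E)%E.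
Proof.
move=> rD; have [pi prs] := clsP rD; have [rX _] := rD.
have [|t tGI tE] := @pres_GI p g F _ x (fun j => tnth r j) s pi p_prime F_free s_iso s_inv _ prs.
  by move=> j; have [] := rX j.
have [c cH] := trivial_lower_p p_prime pH; have {}cH := cH c (leqnn c).
have [f [fm fc]] := cmodelP p_prime c (cls p s r).
have [t' t'GI t'E] := induced_GI tGI fm fc.
rewrite (card_SurE p_prime R _ _ cH).
rewrite (nsur_GI p_prime p_odd (pgroup_cmodel p_prime c _) (cgiP p_prime c _) t'GI).
rewrite -(counting_card R (Sur_sigma_model tau fm fc t'E cH)).
pose Br := [set y in equivariant | `[< killed s F_free pH y r >]]%SET.
pose fac y : class_repr (cls p s r) -> discrete_topology H := xget (fun=> 1)
  [set h | Sur_sigma t tau h /\ forall u, hom_of F_free pH y u = h (pi u)].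
have facP y : y \in Br -> Sur_sigma t tau (fac y) /\ forall u, hom_of F_free pH y u = fac y (pi u).
  rewrite !inE => /andP[/asboolP[yS yt] /asboolP yr].
  apply: (@xgetPex _ (fun=> 1) [set h : class_repr (cls p s r) -> discrete_topology H | Sur_sigma t tau h /\ forall u, hom_of F_free pH y u = h (pi u)]).
  have [||h hh hE] := @pres_hom F _ _ pi prs (discrete_topology H) _ (hom_ofP F_free pH y).
  - exact: discrete_closed.
  - by move=> _ [j _ <-]; have [] := yr j.
  exists h; split=> //; split=> //.
    by move=> a; have [z <-] := yS a; exists (pi z); rewrite -hE.
  by move=> b; have [z <-] := pres_surj prs b; rewrite tE -!hE yt.
have cardBr : (Sur_sigma t tau #= `I_#|Br|)%card.
  apply: (@card_eq_finset _ _ _ Br fac).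
  - by move=> y /facP[].
  - move=> y y' /facP[_ yE] /facP[_ y'E] e; apply/ffunP => i.
    by rewrite -(hom_ofE F_free pH y) -(hom_ofE F_free pH y') yE y'E e.
  - move=> h [[hM hc] hS ht].
    have hh : continuous_hom (h \o pi : F -> discrete_topology H).
      split; first by move=> u v /=; rewrite (pres_morph prs) hM.
      by move=> u; apply: (@continuous_comp _ _ (discrete_topology H)); [exact: (pres_continuous prs)|exact: hc].
    pose y := [ffun i => (h \o pi) (x i)].
    have yE : hom_of F_free pH y = h \o pi by rewrite -(hom_of_eq F_free pH hh).
    have yB : y \in Br.
      rewrite !inE yE; apply/andP; split; apply/asboolP.
        split=> [a|z]; last by rewrite /= -tE ht.
        by have [b <-] := hS a; have [z <-] := pres_surj prs b; exists z.
      move=> j; split; first exact: rX.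
      rewrite /= yE /=; have -> : pi (tnth r j) = 1; last exact: (gmorph1 hM).
      by apply/(pres_ker prs); apply: (@sub_closed_normal_gen _ [set (tnth r j : F) | j in [set: 'I_g]]); exists j.
    exists y => //; apply/funext => b; have [u <-] := pres_surj prs b.
    by rewrite -(facP y yB).2 yE.
rewrite (counting_card R cardBr) sumEFin; congr (_%:E).
rewrite -sum1_card natr_sum big_mkcond [RHS]big_mkcond /=; apply: eq_bigr => y _.
rewrite [y \in Br]inE indicE; case: (y \in equivariant) => //=.
by case: asboolP => h; [rewrite mem_set|rewrite memNset].
Qed.

Let card_equivariant c (Q : finGroupType) (f : F -> Q) (s' : Q -> Q) :
  finmodel (lower_p_set p c) f -> continuous (f : F -> discrete_topology Q) ->
  (forall z, f (s z) = s' (f z)) ->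
  (forall y : discrete_topology H, lower_p_set p c y -> y = 1) ->
  #|equivariant| = nsur s' (tau : H -> H).
Proof.
move=> fm fc fs cH; apply/eqP; rewrite -(eqr_nat R); apply/eqP; apply: EFin_inj.
rewrite -(counting_card R (Sur_sigma_model tau fm fc fs cH)); apply/esym/counting_card.
apply: (@card_eq_finset _ _ _ equivariant (fun y => hom_of F_free pH y : F -> discrete_topology H)).
- by move=> y; rewrite inE => /asboolP[yS yt]; split=> //; exact: hom_ofP.
- by move=> y y' _ _ e; apply/ffunP => i; rewrite -(hom_ofE F_free pH y) e hom_ofE.
- move=> h [hh hS ht]; exists [ffun i => h (x i)]; last by rewrite -(hom_of_eq F_free pH hh).
  by rewrite inE; apply/asboolP; rewrite -(hom_of_eq F_free pH hh).
Qed.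

Let measurable_card_Sur := @card_Sur_measurable p p_prime p_odd R H tau pH.
Let card_Sur_ge0 := @card_Sur_ge0 p p_prime R H tau pH.

Lemma law_moment_other d : d != g ->
  (\int[law]_(C in schur_rank d) card_Sur R tau C = 0)%E.
Proof.
move=> dg; have mr : measurable (schur_rank d : set (schurSpace p)) by exact: schur_rank_measurable.
apply: null_set_integral => //; apply/eqP; rewrite eq_le measure_ge0 andbT.
have mc : measurable (@cls p g F s @^-1` schur_rank d) by rewrite -[X in measurable X]setTI; exact: mcls.
rewrite /= /pushforward -D0; apply: le_measure; rewrite ?inE//; first exact: measurableC.
move=> r rd /clsD/(schur_rankE p_prime); move/(schur_rankE p_prime): rd => -> e.
by rewrite e eqxx in dg.
Qed.

Lemma law_moment : nhom p H = (p ^ g)%N ->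
  (\int[law]_(C in schur_rank g) card_Sur R tau C =
   (\prod_(i < g) (p%:R ^+ g - p%:R ^+ i))%:E)%E.
Proof.
move=> hH; have mr : measurable (schur_rank g : set (schurSpace p)) by exact: schur_rank_measurable.
have mc : measurable (@cls p g F s @^-1` schur_rank g) by rewrite -[X in measurable X]setTI; exact: mcls.
rewrite (ge0_integral_pushforward mcls)//.
have mK y : measurable (killed s F_free pH y) by exact: (killed_measurable F_free s_iso).
have mDc : measurable (~` D) by exact: measurableC.
have mf : measurable_fun (@cls p g F s @^-1` schur_rank g) (card_Sur R tau \o @cls p g F s).
  move=> _ Y mY; apply: measurableI => //.
  have mY' := measurable_card_Sur measurableT mY; rewrite setTI in mY'.
  by have := mcls measurableT mY'; rewrite setTI.
rewrite (@ge0_negligible_integral _ _ _ mug _ (~` D) _ mDc mc mf (fun r _ => card_Sur_ge0 _) D0).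
rewrite (_ : _ `\` _ = D); last first.
  apply/seteqP; split=> [r [_ /contrapT]//|r rD]; split; first exact: clsD.
  exact.
rewrite (eq_integral (fun r => \sum_(y <- enum equivariant) (\1_(killed s F_free pH y) r)%:E)%E); last first.
  by move=> r /set_mem rD; rewrite /= card_Sur_cls// big_enum.
have mI y : measurable_fun D (fun r => (\1_(killed s F_free pH y) r)%:E : \bar R).
  by apply/measurable_EFinP; exact: measurable_indic.
rewrite (ge0_integral_sum mug mD mI); last by move=> y r _; rewrite lee_fin indicE.
rewrite big_enum /=.
have [c0 c0H] := trivial_lower_p p_prime pH.
have [c1 c1V] := trivial_lower_p p_prime (pgroup_Vp p_prime g).
(* The level must suit both H and [Vp g], through which [nsur_free_count] passes, and be positive
   for [nhom_free_model]. *)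
pose c := (maxn c0 c1).+1.
have cH : forall y : discrete_topology H, lower_p_set p c y -> y = 1 by apply: c0H; rewrite /c; lia.
have cV : forall y : discrete_topology (Vp p g), lower_p_set p c y -> y = 1 by apply: c1V; rewrite /c; lia.
have [Q [f [fm pQ fc _]]] := lower_p_model p_prime c (free_gen_by p_prime F_free) (proj1 F_free).
have [s' s'GI fs] := induced_GI (free_GI_automorphism p_prime F_free s_iso s_inv) fm fc.
have [fM _ _] := fm.
have card_e : #|equivariant| = ((\prod_(i < g) (p ^ g - p ^ i)) * #|invd (tau : H -> H) (frat p H)| ^ g)%N.
  rewrite (card_equivariant fm fc fs cH).
  apply: (@nsur_free_count p p_prime g Q (fun i => f (x i)) s') => //.
  - exact: (model_gen p_prime F_free fm fc).
  - exact: GI_morph s'GI.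
  - by move=> i; rewrite -fs s_inv (gmorphV fM).
  - exact: (nhom_free_model p_prime F_free fm fc).
  - exact/GI_automorphismP.
  - exact: (model_free F_free fm pH cH).
  - exact: (model_free F_free fm (pgroup_Vp p_prime g) cV).
rewrite (eq_bigr (fun=> (((#|invd (tau : H -> H) (frat p H)|%:R)^-1) ^+ g)%:E)); last first.
  move=> y; rewrite inE => /asboolP[yS yt].
  transitivity (mug (killed s F_free pH y `&` D)); first exact: (integral_indic mug mD (mK y)).
  rewrite mug_schur//.
  exact: (mug_killed p_prime p_odd s_iso s_inv mu_natural mug_product yS yt).
rewrite sumEFin sumr_const card_e; congr (_%:E); rewrite -[LHS]mulr_natl natrM natrX.
have X0 : (#|invd (tau : H -> H) (frat p H)|%:R != 0 :> R)%R.
  rewrite pnatr_eq0 -lt0n; apply/card_gt0P; exists 1.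
  have tGI := (GI_automorphismP tau).1 tauGI.
  by rewrite inE (gmorph1 (GI_morph tGI)) invg1 eqxx andbT; exact: (group1 (frat_group p H)).
rewrite exprVn mulfK ?expf_neq0// natr_prod; apply: eq_bigr => i _.
by rewrite natrB ?natrX// leq_exp2l ?prime_gt1// ltnW.
Qed.

End LawMoments.
End LawOfQuotient.

Section BBH.
Import Order.TTheory GRing.Theory Num.Theory.

Lemma mu_CL_ge0 (R : realType) p g : (2 < p)%N -> (0 <= mu_CL R p g)%R.
Proof.
move=> p2; have q0 := q_ge0 R p; have q1 := q_lt1 R p2.
have qk k : (0 <= 1 - p%:R ^- k :> R)%R by rewrite subr_ge0 -exprVn exprn_ile1//; lra.
rewrite /mu_CL; apply: mulr_ge0; first apply: mulr_ge0.
- by rewrite invr_ge0 exprn_ge0.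
- by apply: prodr_ge0 => i _; rewrite invr_ge0 exprn_ge0.
(* For a divergent sequence [lim] would be the default point 0. *)
set u := fun n : nat => _; have [c|/dvgP -> //] := pselect (cvg (u @ \oo)).
by apply: limr_ge => //; apply: nearW => n; apply: prodr_ge0.
Qed.

End BBH.

Import Order.TTheory GRing.Theory Num.Theory.
Unset Implicit Arguments.
Local Close Scope group_scope.
Local Open Scope classical_set_scope.
Local Open Scope ring_scope.

Theorem theorem1p4 (R : realType) (p : nat) (p_prime : prime p) (p_odd : odd p)
  (F : nat -> topologicalGroupType) (x : forall g : nat, 'I_g -> F g)
  (F_free : forall g : nat, free_pro_p p (x g))
  (sigma : forall g : nat, F g -> F g)
  (sigma_iso : forall g : nat, top_group_iso (sigma g))
  (sigma_inv : forall (g : nat) (i : 'I_g), sigma g (x g i) = ((x g i)^-1)%g)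
  (mu : forall g : nat, probability (borel (F g)) R)
  (mu_natural : forall g : nat, natural_measure p (sigma g) (mu g))
  (mug : forall g : nat, probability (g.-tuple (borel (F g))) R)
  (mug_product : forall g : nat, product_measure_of (mu g) (mug g))
  (nu : {measure set (schurSpace p) -> \bar R})
  (nu_moments : forall (H : finGroupType) (tau : discrete_topology H -> discrete_topology H),
     (p.-group [set: H]%SET)%g -> GI_automorphism tau ->
     (\int[nu]_(C in [set: schurSpace p]) card_Sur R tau C = 1)%E) :
  forall A : set (schurSpace p), measurable A -> nu A = mu_BBH sigma mug A.
Proof.
move=> A mA; have p2 : (2 < p)%N by exact: odd_prime_gt2.
(* The Boston-Bush-Hajir measure as a genuine measure: the sum over g of the laws weighted by
   mu_CL(g). *)
pose L g := law p_prime (F_free g) (sigma_iso g) (sigma_inv g) (mug g).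
pose M g := mscale (NngNum (mu_CL_ge0 R g p2)) (L g).
pose m : {measure set (schurSpace p) -> \bar R} := mseries M 0.
transitivity (m A); last first.
  rewrite /m /= /mseries /mu_BBH; apply: eq_eseriesr => g _.
  rewrite /M /= /mscale; congr (_ * _)%E.
  exact: lawE.
apply: (moments_determine p_prime p_odd) => //.
- move=> d H tau pH tauGI hH.
  exists (mu_CL R p d * \prod_(i < d) (p%:R ^+ d - p%:R ^+ i))%R; split.
    exact: rank_moment.
  have mr : measurable (schur_rank d : set (schurSpace p)) by exact: schur_rank_measurable.
  have S0 := @card_Sur_ge0 p p_prime R H tau pH.
  have mS := @card_Sur_measurable p p_prime p_odd R H tau pH.
  have ME g : (\int[M g]_(C in schur_rank d) card_Sur R tau C =
      (mu_CL R p g)%:E * \int[L g]_(C in schur_rank d) card_Sur R tau C)%E.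
    by rewrite /M (ge0_integral_mscale _ mr).
  (* The law attached to g is carried by rank g, so only the term g = d contributes on rank d. *)
  rewrite /m (ge0_integral_measure_series _ mr)// (@nneseriesD1 R _ d xpredT)//; last first.
    by move=> k _; apply: integral_ge0.
  rewrite ME (law_moment p_prime p_odd (F_free d) _ _ (mu_natural d) (mug_product d) pH tauGI hH) EFinM eseries0 ?adde0// => g _ /= gd.
  rewrite ME (law_moment_other p_prime p_odd _ _ _ (mu_natural g) (mug_product g) _ pH) ?mule0//.
  by rewrite eq_sym.
(* The total mass of nu is its moment for the trivial group [Vp p 0], hence finite. *)
- have negC (C : schurClass p) : negates p (@cgi p p_prime 0 C) by apply: GI_negates; exact: cgiP.
  have := nu_moments (Vp p 0) (@Vp_inv p 0) (pgroup_Vp p_prime 0).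
  rewrite GI_automorphismP => /(_ (GI_Vp p 0)).
  rewrite (eq_integral (cst 1%E)) => [|C _]; last first.
    rewrite (card_SurE p_prime R (c := 0)) ?nsur_Vp ?big_ord0//; last by case=> -[].
  by rewrite integral_cst// mul1e => ->; exact: ltry.
Qed.
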